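(* For every $\alpha \in [0,1]$ and every non-empty compact set $R \subseteq (0,\infty)$, there exists a compact set $Y \subseteq [1,2]$ such that $$\dim_F(Y) = \dim_H(Y) = \overline{\dim_M}(Y) = \alpha$$ and $$\dim_F(RY) \geq \min\{1,\ \dim_F(R)+\dim_F(Y)\}.$$
   Context: Here $RY = \{ry : r\in R,\ y\in Y\}\subseteq\mathbb{R}$. For $A \subseteq \mathbb{R}$, $\mathcal{M}(A)$ is the set of non-zero finite Borel measures on $\mathbb{R}$ with compact support contained in $A$. The Fourier transform is $\widehat{\mu}(\xi) = \int e^{-2\pi i x\xi}\,d\mu(x)$. $\dim_H(A)$ is Hausdorff dimension; for Borel $A$ it equals $\sup\{0<s<1 : \iint |x-y|^{-s}d\mu(x)d\mu(y)<\infty \text{ for some } \mu \in \mathcal{M}(A)\}$. The Fourier dimension of a Borel set $A \subseteq \mathbb{R}$ is $\dim_F(A) = \sup\{0<s<1 : \sup_{\xi\in\mathbb{R}} |\widehat{\mu}(\xi)|^2|\xi|^s < \infty \text{ for some } \mu\in\mathcal{M}(A)\}$. The supremum of the empty set is taken to be $0$. The upper Minkowski dimension of a non-empty bounded set $A$ is $\overline{\dim_M}(A) = \limsup_{\epsilon\to 0^+} \frac{\log N(A,\epsilon)}{\log(1/\epsilon)}$, where $N(A,\epsilon)$ is the smallest number of $\epsilon$-balls needed to cover $A$; since it is defined only for non-empty sets, the set $Y$ in the claim is in particular non-empty. *)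

(* Defs.v *)
From mathcomp Require Import all_boot all_order all_algebra.
From mathcomp Require Import all_classical all_reals all_analysis.
From mathcomp Require Import complex.
Import Order.TTheory GRing.Theory Num.Theory.
Import numFieldNormedType.Exports.

Set Implicit Arguments.
Unset Strict Implicit.
Unset Printing Implicit Defensive.

Local Open Scope classical_set_scope.
Local Open Scope ring_scope.

Definition mulset (K : realType) (A B : set K) : set K :=
  [set a * b | a in A & b in B].

Definition finite_borel_measure (K : realType) :=
  {finite_measure set (measurableTypeR K) -> \bar K}.

Definition msupport (K : realType) (mu : finite_borel_measure K) : set K :=
  ~` \bigcup_(U in [set U : set K | open U /\ mu U = 0%E]) U.

(* The class M(A); the measure is non-zero iff its total mass is. *)
Definition supported_measures (K : realType) (A : set K) :
    set (finite_borel_measure K) :=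
  [set mu : finite_borel_measure K |
    [/\ mu setT <> 0%E, compact (msupport mu) & msupport mu `<=` A]].

(* e^{i t} for real t *)
Definition expi (K : realType) (t : K) : complex K := Complex (cos t) (sin t).

(* The library has no integral of complex-valued functions: integrate the real
   and imaginary parts separately. *)
Definition complex_integral (K : realType) (mu : finite_borel_measure K)
    (f : K -> complex K) : complex K :=
  Complex (Rintegral mu setT (fun x => complex.Re (f x)))
          (Rintegral mu setT (fun x => complex.Im (f x))).

Definition fourier (K : realType) (mu : finite_borel_measure K) (xi : K) :
    complex K :=
  complex_integral mu (fun x => expi (- (2 * pi * x * xi))).

(* [sup set0 = 0] in the library. The index set lies in ]0, 1[, so [sup] is a
   genuine supremum as soon as the set is non-empty. *)
Definition fourier_dim (K : realType) (A : set K) : K :=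
  sup [set s : K | 0 < s < 1 /\
    exists2 mu : finite_borel_measure K, supported_measures A mu &
      (ereal_sup [set ((ComplexField.Normc.normc (fourier mu xi)) ^+ 2
                        * `|xi| `^ s)%:E | xi in [set: K]] < +oo)%E].

(* The extra point 0 makes the diameter of the empty set 0, not -oo. *)
Definition diam (K : realType) (U : set K) : \bar K :=
  ereal_sup (0%E |` [set `|x - y|%:E | x in U & y in U]).

Definition hausdorff_premeasure (K : realType) (s delta : K) (A : set K) :
    \bar K :=
  ereal_inf [set (\sum_(0 <= i <oo) poweR (diam (U i)) s)%E |
    U in [set U : (set K)^nat |
      A `<=` \bigcup_i U i /\ forall i, (diam (U i) <= delta%:E)%E]].

Definition hausdorff_measure (K : realType) (s : K) (A : set K) : \bar K :=
  ereal_sup [set hausdorff_premeasure s delta A | delta in [set d : K | 0 < d]].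

(* s = 0 is left out because [0 `^ 0 = 1] would count empty covering sets; this
   does not change the infimum. *)
Definition hausdorff_dim (K : realType) (A : set K) : \bar K :=
  ereal_inf [set s%:E | s in [set s : K | 0 < s /\ hausdorff_measure s A = 0%E]].

(* The smallest number of e-balls covering A, as a real number. For bounded A
   and e > 0 the infimum is over a non-empty set of natural numbers, hence it is
   attained. *)
Definition covering_number (K : realType) (A : set K) (e : K) : K :=
  inf [set (size c)%:R | c in
    [set c : seq K | A `<=` \bigcup_(x in [set` c]) ball x e]].

Definition upper_minkowski_dim (K : realType) (A : set K) : \bar K :=
  limf_esup (fun e : K => (ln (covering_number A e) / ln (1 / e))%:E) 0^'+.

(* Main.v *)
Require Import Defs.
From mathcomp Require Import complex.
From HB Require Import structures.
From mathcomp Require Import all_boot all_order all_algebra.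
From mathcomp Require Import all_classical all_reals all_analysis.
From mathcomp Require Import measurable_realfun.
From mathcomp Require Import ring lra zify.
Import Order.TTheory GRing.Theory Num.Theory.
Import numFieldNormedType.Exports.

Set Implicit Arguments.
Unset Strict Implicit.
Unset Printing Implicit Defensive.

Local Open Scope classical_set_scope.
Local Open Scope ring_scope.

(* Y is a Cantor set of dyadic intervals: level k consists of about 2^(alpha k)
   intervals of length 2^-k, and at each level either both halves of every
   interval are kept, or exactly one half of each, selected by a sign.

   Let mu be a measure on R with |mu^(xi)| <= A |xi|^(-s/2), and let nu be the
   natural measure of Y. The transform of the image of mu x nu under
   multiplication is the nu-average of y |-> mu^(y xi). When a level is refined
   by signs, this average changes by a mean of 2^(alpha k) signed terms, each at
   most A xi^(-s/2) min(1, 2^k / xi). Signs chosen greedily against an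
   exponential potential give square-root cancellation for an exponentially fine
   grid of frequencies and for the first k members of a countable family of
   measures mu at once; summing over k gives decay xi^(-(s + alpha)/2 + eps).
   The factor 2^k / xi comes from an antiderivative of the transform, that is,
   from dividing mu by r; a bounded weight absorbs this division.

   The family contains the unit mass at 1, which yields dim_F Y >= alpha, and
   measures on R whose exponents approach min(dim_F R, 1 - alpha). The upper
   bounds follow from the number of intervals, for the Fourier dimension by
   comparing the Fejer-smoothed energy of a measure with its mass on few
   intervals; the lower bounds for the other two dimensions follow from the
   Frostman estimate for nu. *)

(** * Derandomized signs *)

(** The signs of a level must work for a continuum of frequencies, while a greedy choice serves
    finitely many targets. At level k the frequencies up to 2^(3k) are sampled with step 2^(-5k):
    the Lipschitz bound makes the sampling error negligible, and beyond that range the factor 2^k /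
    xi is already at most 2^(-k/2) xi^(-1/2). Only exponentially many targets arise, so serving all
    of them costs a factor linear in k, which the loss eps absorbs. The sampling and range errors
    decay only like xi^(-1/2); this forces s + alpha <= 1 and is the source of the minimum with 1.
    The supremum defining dim_F R need not be attained, hence a sequence of exponents for one and
    the same Y: member n is controlled from level n on, and its first n levels cost a constant
    depending on n. The loss eps lies in ]0, alpha / 2], so alpha = 0 is treated apart, with Y a
    point. *)

Lemma expR_add_oppr_le (K : realType) (a : K) : `|a| <= 2^-1 ->
  expR a + expR (- a) <= 2 * expR (2 * a ^+ 2).
Proof.
(* From exp (-x) >= 1 - x alone: exp x (1 - x) <= 1, while (1 + x + 2 x^2) (1 - x) = 1 + x^2 (1 -
   2x) >= 1 for x <= 1/2. *)
have main (x : K) : `|x| <= 2^-1 -> expR x <= 1 + x + 2 * x ^+ 2.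
  rewrite ler_norml => /andP[x1 x2].
  have ex := expR_ge1Dx (- x).
  have e1 : expR x * expR (- x) = 1 by rewrite -expRD subrr expR0.
  have e0 := expR_gt0 x.
  have h : expR x * (1 - x) <= 1 by rewrite -[leRHS]e1 ler_pM2l.
  rewrite -(@ler_pM2r _ (1 - x)); last by rewrite subr_gt0; lra.
  apply: (le_trans h).
  rewrite [leRHS](_ : _ = 1 + x ^+ 2 * (1 - 2 * x)); last by ring.
  by rewrite lerDl mulr_ge0 ?sqr_ge0//; lra.
move=> ha; have h1 := main _ ha; have := main (- a); rewrite normrN => /(_ ha) h2.
have := expR_ge1Dx (2 * a ^+ 2); lra.
Qed.

(* Signs chosen greedily never increase the potential [sum_j cosh (S_j)] by more
   than the factor [exp (2 c^2)] per step. *)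
Lemma sign_potential (K : realType) (I : finType) (c : K) (a : nat -> I -> K)
    (n : nat) : c <= 2^-1 -> (forall i j, `|a i j| <= c) ->
  exists e : nat -> bool,
    \sum_j (expR (\sum_(i < n) (-1) ^+ e i * a i j) +
            expR (- \sum_(i < n) (-1) ^+ e i * a i j))
    <= 2 * #|I|%:R * expR (2 * n%:R * c ^+ 2).
Proof.
move=> hc ha; elim: n => [|n [e he]].
  exists xpred0; under eq_bigr do rewrite big_ord0 oppr0 expR0.
  rewrite sumr_const mulr0 mul0r expR0 mulr1 -[_ + _]/(2%:R).
  by rewrite -[_ *+ _]mulr_natr.
pose S j := \sum_(i < n) (-1) ^+ e i * a i j.
pose T (b : bool) := \sum_j (expR (S j + (-1) ^+ b * a n j) +
                             expR (- (S j + (-1) ^+ b * a n j))).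
have Tle : T false + T true <=
    2 * (expR (2 * c ^+ 2) * \sum_j (expR (S j) + expR (- S j))).
  rewrite /T -big_split mulrA !mulr_sumr; apply: ler_sum => j _ /=.
  rewrite expr0 expr1 mul1r mulN1r !opprD !opprK !expRD.
  have c0 : 0 <= c by rewrite (le_trans _ (ha n j)).
  have := expR_add_oppr_le (le_trans (ha n j) hc).
  have : expR (2 * a n j ^+ 2) <= expR (2 * c ^+ 2).
    rewrite ler_expR ler_pM2l// -[a n j ^+ 2]real_normK ?num_real//.
    by rewrite lerXn2r ?nnegrE.
  have := expR_gt0 (S j); have := expR_gt0 (- S j).
  set x := expR (S j); set y := expR (- S j); set u := expR (a n j).
  set v := expR (- a n j) => *.
  have h : u + v <= 2 * expR (2 * c ^+ 2) by lra.
  rewrite [leLHS](_ : _ = (u + v) * (x + y)); last by ring.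
  by rewrite ler_wpM2r//; lra.
have [b Tb] : exists b, T b <=
    expR (2 * c ^+ 2) * \sum_j (expR (S j) + expR (- S j)).
  by have [h|h] := leP (T false) (T true); [exists false|exists true]; lra.
exists (fun i => if i == n then b else e i).
have E j : \sum_(i < n.+1) (-1) ^+ (if i == n :> nat then b else e i) * a i j
    = S j + (-1) ^+ b * a n j.
  rewrite big_ord_recr /= eqxx; congr (_ + _); apply: eq_bigr => i _.
  by rewrite ltn_eqF.
under eq_bigr do rewrite E.
apply: (le_trans Tb).
rewrite [leRHS](_ : _ = expR (2 * c ^+ 2) *
    (2 * #|I|%:R * expR (2 * n%:R * c ^+ 2))).
  by rewrite ler_pM2l ?expR_gt0.
have -> : n.+1%:R = n%:R + 1 :> K by rewrite natr1.
rewrite (_ : 2 * (n%:R + 1) * c ^+ 2 = 2 * c ^+ 2 + 2 * n%:R * c ^+ 2) ?expRD; ring.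
Qed.

(** The terms are scaled by 2 sqrt n B_j, so that the potential grows by a factor of at most exp
    (1/2) over all n steps. Each summand is at most the whole potential, and taking logarithms
    bounds all targets at once. *)
Lemma sign_choice (K : realType) (I : finType) (a : nat -> I -> K)
    (B : I -> K) (n : nat) : (0 < n)%N -> (forall j, 0 < B j) ->
    (forall i j, `|a i j| <= B j) ->
  exists e : nat -> bool, forall j,
    `|\sum_(i < n) (-1) ^+ e i * a i j|
    <= 2 * Num.sqrt n%:R * B j * (ln (2 * #|I|%:R) + 2^-1).
Proof.
move=> n0 B0 aB.
pose q : K := Num.sqrt n%:R.
have q1 : 1 <= q by rewrite -[leLHS]sqrtr1 ler_sqrt ?ler1n.
have q2 : q ^+ 2 = n%:R by rewrite sqr_sqrtr.
pose c : K := (2 * q)^-1.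
have c12 : c <= 2^-1 by rewrite lef_pV2 ?posrE; nra.
have abc i j : `|a i j / (2 * q * B j)| <= c.
  rewrite normrM normfV (gtr0_norm (_ : 0 < 2 * q * B j)); last first.
    by rewrite !mulr_gt0//; lra.
  rewrite ler_pdivrMr; last by rewrite !mulr_gt0//; lra.
  by rewrite /c mulrA mulVf ?mul1r//; lra.
have [e he] := sign_potential n c12 abc.
exists e => j.
set S := \sum_(i < n) _ in he |- *.
pose s : K := S / (2 * q * B j).
have E : \sum_(i < n) (-1) ^+ e i * (a i j / (2 * q * B j)) = s.
  by rewrite /s /S mulr_suml; apply: eq_bigr => i _; rewrite mulrA.
have I0 : (0 < #|I|)%N by apply/card_gt0P; exists j.
have hs : expR `|s| <= expR (ln (2 * #|I|%:R) + 2^-1).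
  rewrite expRD lnK ?posrE ?mulr_gt0 ?ltr0n//.
  have -> : (2^-1 : K) = 2 * n%:R * c ^+ 2.
    rewrite /c -q2; field; lra.
  apply: le_trans he; rewrite (bigD1 j)//= E.
  apply: (@le_trans _ _ (expR s + expR (- s))).
    by case: (ger0P s) => _; [rewrite lerDl|rewrite lerDr]; exact: expR_ge0.
  by rewrite lerDl sumr_ge0.
rewrite ler_expR in hs.
have -> : S = s * (2 * q * B j).
  by rewrite /s divfK// !mulf_neq0 ?gt_eqF//; lra.
have qB : 0 < 2 * q * B j by rewrite !mulr_gt0//; lra.
by rewrite normrM (gtr0_norm qB) mulrC ler_pM2l.
Qed.

(** * Trees of dyadic intervals *)

Section Tree.
Context {K : realType}.
Variable alpha : K.

(** All intervals of a level split together or none does. The uniform measures on the levels are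
    therefore compatible, and every interval of a level has the same mass. *)
Definition splits (k p : nat) : bool :=
  (2 * p)%:R <= (2 : K) `^ (alpha * k.+1%:R).

Fixpoint tree_size (k : nat) : nat :=
  if k is l.+1 then
    if splits l (tree_size l) then 2 * tree_size l else tree_size l
  else 1.

(** A strategy rather than a sequence of signs: the second argument receives the positions of the
    current level, so the signs may depend on the intervals reached so far. *)
Variable e : nat -> (nat -> nat) -> nat -> bool.

(* The [i]-th interval of level [k] is [[1 + a/2^k, 1 + (a+1)/2^k]] with
   [a = tree_pos k i]; at a non-splitting level it keeps its left half iff
   [e k (tree_pos k) i]. *)
Fixpoint tree_pos (k : nat) : nat -> nat :=
  if k is l.+1 then
    if splits l (tree_size l) then fun i => 2 * tree_pos l i./2 + odd i
    else fun i => 2 * tree_pos l i + ~~ e l (tree_pos l) i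
  else id.

Lemma tree_size_gt0 k : (0 < tree_size k)%N.
Proof. by elim: k => //= k ih; case: ifP; rewrite ?muln_gt0. Qed.

(** At a split the right inequality survives because 2^alpha <= 2; without a split it is the failed
    test itself. *)
Lemma tree_size_bound k : 0 <= alpha <= 1 ->
  (tree_size k)%:R <= (2 : K) `^ (alpha * k%:R) < 2 * (tree_size k)%:R.
Proof.
move=> /andP[a0 a1]; elim: k => [|k /andP[ih1 ih2]].
  by rewrite mulr0 powRr0 /=; lra.
have S : (2 : K) `^ (alpha * k.+1%:R) = 2 `^ alpha * 2 `^ (alpha * k%:R).
  by rewrite -powRD ?pnatr_eq0 ?implybT// -natr1; congr powR; ring.
have p1 : 1 <= (2 : K) `^ alpha.
  rewrite -[leLHS](powRr0 2); apply: ler_powR => //; lra.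
have p2 : (2 : K) `^ alpha <= 2.
  rewrite -[leRHS]powRr1//; apply: ler_powR => //; lra.
have t0 : 0 <= (2 : K) `^ (alpha * k%:R) by exact: powR_ge0.
rewrite /=; case: ifPn; rewrite /splits.
- move=> h; rewrite h natrM /= S; nra.
- rewrite -ltNge natrM => h; rewrite h S andbT; nra.
Qed.

Lemma tree_pos_lt k i : (i < tree_size k)%N -> (tree_pos k i < 2 ^ k)%N.
Proof.
elim: k i => //= k ih i; case: ifP => _ ik; rewrite expnS.
- have := ih i./2; lia.
- by have := ih i ik; case: (e _ _ _) => /=; lia.
Qed.

Lemma tree_pos_mono k i j : (i < j)%N -> (tree_pos k i < tree_pos k j)%N.
Proof.
elim: k i j => //= k ih i j ij; case: ifP => _.
- have [hij|hij] := ltnP i./2 j./2; first by have := ih _ _ hij; lia.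
  have -> : j./2 = i./2 by lia.
  lia.
- by have := ih _ _ ij; do 2 case: (e _ _ _) => /=; lia.
Qed.

Lemma tree_pos_dist k i j :
  (i <= j)%N -> (tree_pos k i + (j - i) <= tree_pos k j)%N.
Proof.
move=> /subnKC <-; elim: (j - i)%N => [|d ih]; first by rewrite addn0; lia.
have := @tree_pos_mono k (i + d) (i + d.+1); lia.
Qed.

Definition parent (k i : nat) : nat :=
  if splits k (tree_size k) then i./2 else i.

Lemma tree_pos_parent k i :
  (tree_pos k.+1 i)./2 = tree_pos k (parent k i).
Proof.
rewrite /parent /=; case: ifP => _; last case: (e _ _ _); lia.
Qed.

End Tree.

(** * Dyadic means and their averages over a tree *)

Section Means.
Context {K : realType}.
Implicit Types (Psi g : K -> K) (k a : nat).

Definition gridpt k a : K := 1 + a%:R / 2 ^+ k.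

(** The mean over a dyadic interval of the derivative of [Psi], written without an integral. It can
    be bounded through the derivative, by the mean value theorem, or through the size of [Psi]. *)
Definition dyadic_mean Psi k a : K :=
  2 ^+ k * (Psi (gridpt k a.+1) - Psi (gridpt k a)).

Definition half_gap Psi k a : K :=
  (dyadic_mean Psi k.+1 (2 * a).+1 - dyadic_mean Psi k.+1 (2 * a)) / 2.

Lemma gridpt_double k a : gridpt k.+1 (2 * a) = gridpt k a.
Proof.
rewrite /gridpt natrM exprS invfM mulrACA divff ?pnatr_eq0// mul1r//.
Qed.

Lemma gridpt_succ k a : gridpt k a.+1 = gridpt k a + 2 ^- k.
Proof. by rewrite /gridpt -natr1 mulrDl mul1r addrA. Qed.

Lemma gridpt_ge1 k a : 1 <= gridpt k a.
Proof. by rewrite /gridpt lerDl divr_ge0// exprn_ge0. Qed.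

Lemma gridpt_le2 k a : (a <= 2 ^ k)%N -> gridpt k a <= 2.
Proof.
move=> h; rewrite /gridpt -[leRHS]/(1 + 1) lerD2l ler_pdivrMr ?exprn_gt0//.
by rewrite mul1r -natrX ler_nat.
Qed.

Lemma dyadic_mean_child Psi k a (b : bool) :
  dyadic_mean Psi k.+1 (2 * a + ~~ b) =
  dyadic_mean Psi k a + (-1) ^+ b * half_gap Psi k a.
Proof.
have e2 : gridpt k.+1 (2 * a).+2 = gridpt k a.+1.
  by rewrite -[in RHS]gridpt_double; congr gridpt; lia.
rewrite /half_gap /dyadic_mean e2 gridpt_double exprS.
by case: b => /=; rewrite ?addn0 ?addn1 ?expr1 ?expr0 ?gridpt_double ?e2; field.
Qed.

Lemma dyadic_mean_split Psi k a :
  dyadic_mean Psi k.+1 (2 * a) + dyadic_mean Psi k.+1 (2 * a).+1 =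
  2 * dyadic_mean Psi k a.
Proof.
have := dyadic_mean_child Psi k a true; have := dyadic_mean_child Psi k a false.
by rewrite /= addn1 addn0 => -> ->; rewrite expr0 expr1; ring.
Qed.

Lemma dyadic_meanB Psi Psi' k a :
  dyadic_mean (fun y => Psi y - Psi' y) k a =
  dyadic_mean Psi k a - dyadic_mean Psi' k a.
Proof. by rewrite /dyadic_mean; ring. Qed.

Lemma half_gapB Psi Psi' k a :
  half_gap (fun y => Psi y - Psi' y) k a = half_gap Psi k a - half_gap Psi' k a.
Proof. by rewrite /half_gap !dyadic_meanB; ring. Qed.

Lemma dyadic_mean_le Psi M k a : (a < 2 ^ k)%N ->
  (forall y, 1 <= y <= 2 -> `|Psi y| <= M) ->
  `|dyadic_mean Psi k a| <= 2 * 2 ^+ k * M.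
Proof.
move=> ak hM; rewrite /dyadic_mean normrM ger0_norm ?exprn_ge0//.
rewrite (_ : 2 * _ * M = 2 ^+ k * (M + M)); last by ring.
rewrite ler_pM2l ?exprn_gt0//; apply: (le_trans (ler_normB _ _)).
by apply: lerD; apply: hM; rewrite gridpt_ge1 gridpt_le2//; lia.
Qed.

Lemma dyadic_mean_deriv Psi g k a :
  (forall y : K, is_derive y 1 Psi (g y)) ->
  exists2 y, gridpt k a <= y <= gridpt k a.+1 & dyadic_mean Psi k a = g y.
Proof.
move=> dPsi.
have p0 : 0 < (2 : K) ^- k by rewrite invr_gt0 exprn_gt0.
have lt : gridpt k a < gridpt k a.+1 by rewrite gridpt_succ ltrDl.
have cont : {within `[gridpt k a, gridpt k a.+1], continuous Psi}.
  apply: continuous_subspaceT => y; apply: differentiable_continuous.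
  by apply/derivable1_diffP; have [] := dPsi y.
have [y + E] := MVT lt (fun y _ => dPsi y) cont.
rewrite in_itv/= => /andP[y1 y2]; exists y; first by rewrite !ltW.
rewrite /dyadic_mean E gridpt_succ addrAC subrr add0r.
by rewrite mulrCA divff ?mulr1// expf_neq0.
Qed.

Lemma half_gap_deriv Psi g M k a : (a < 2 ^ k)%N ->
  (forall y : K, is_derive y 1 Psi (g y)) ->
  (forall y, 1 <= y <= 2 -> `|g y| <= M) -> `|half_gap Psi k a| <= M.
Proof.
move=> ak dPsi hM.
have m b : (b < 2 ^ k.+1)%N -> `|dyadic_mean Psi k.+1 b| <= M.
  move=> bk; have [y /andP[y1 y2] ->] := dyadic_mean_deriv k.+1 b dPsi.
  by apply: hM; rewrite (le_trans (gridpt_ge1 _ _) y1) (le_trans y2)// gridpt_le2.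
rewrite /half_gap normrM [`|2^-1|]ger0_norm// ler_pdivrMr//.
apply: (le_trans (ler_normB _ _)).
have := m (2 * a).+1; have := m (2 * a)%N; rewrite expnS; 
  move=> /(_ ltac:(lia)) h1 /(_ ltac:(lia)) h2; lra.
Qed.

Lemma half_gap_le Psi M k a : (a < 2 ^ k)%N ->
  (forall y, 1 <= y <= 2 -> `|Psi y| <= M) ->
  `|half_gap Psi k a| <= 4 * 2 ^+ k * M.
Proof.
move=> ak hM.
rewrite /half_gap normrM [`|2^-1|]ger0_norm// ler_pdivrMr//.
apply: (le_trans (ler_normB _ _)).
have := @dyadic_mean_le _ _ k.+1 (2 * a).+1 _ hM.
have := @dyadic_mean_le _ _ k.+1 (2 * a)%N _ hM.
rewrite expnS exprS; move=> /(_ ltac:(lia)) h1 /(_ ltac:(lia)) h2; lra.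
Qed.

End Means.

Section TreeAverage.
Context {K : realType}.
Variables (alpha : K) (e : nat -> (nat -> nat) -> nat -> bool).
Notation P := (tree_size alpha).
Notation pos := (tree_pos alpha e).

(** For [Psi] with derivative g, this is the integral of g against the uniform probability measure
    on the intervals of level [k]. *)
Definition tree_avg (Psi : K -> K) (k : nat) : K :=
  (P k)%:R^-1 * \sum_(i < P k) dyadic_mean Psi k (pos k i).

Lemma sum_double (F : nat -> K) n :
  \sum_(i < (2 * n)%N) F i = \sum_(i < n) (F (2 * i)%N + F (2 * i).+1).
Proof.
elim: n => [|n ih]; first by rewrite muln0 !big_ord0.
by rewrite mulnS !addSn !big_ord_recr /= ih addrA.
Qed.

Lemma tree_avg_step Psi k : ~~ splits alpha k (P k) ->
  tree_avg Psi k.+1 = tree_avg Psi k +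
    (P k)%:R^-1 * \sum_(i < P k) (-1) ^+ e k (pos k) i * half_gap Psi k (pos k i).
Proof.
move=> /negbTE h; rewrite /tree_avg /= h -mulrDr -big_split /=.
by congr (_ * _); apply: eq_bigr => i _; rewrite dyadic_mean_child.
Qed.

Lemma tree_avg_split Psi k : splits alpha k (P k) ->
  tree_avg Psi k.+1 = tree_avg Psi k.
Proof.
move=> h; rewrite /tree_avg /= h.
rewrite (sum_double (fun i => dyadic_mean Psi k.+1 (2 * pos k i./2 + odd i))).
rewrite (eq_bigr (fun i => 2 * dyadic_mean Psi k (pos k (nat_of_ord i)))); last first.
  move=> i _; cbv beta; rewrite -dyadic_mean_split.
  have -> : (2 * i)./2 = i by lia.
  have -> : ((2 * i).+1)./2 = i by lia.
  have -> : odd (2 * i) = false by lia.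
  have -> : odd (2 * i).+1 = true by lia.
  by rewrite addn0 addn1.
rewrite -mulr_sumr natrM; field.
by rewrite pnatr_eq0 -lt0n tree_size_gt0.
Qed.

Lemma tree_avg_diff Psi k (M : K) : 0 <= M ->
  (forall a, (a < 2 ^ k)%N -> `|half_gap Psi k a| <= M) ->
  `|tree_avg Psi k.+1 - tree_avg Psi k| <= M.
Proof.
move=> M0 hM; have [/tree_avg_split ->|/tree_avg_step ->] := boolP (splits alpha k (P k)).
  by rewrite subrr normr0.
have P0 : 0 < (P k)%:R :> K by rewrite ltr0n tree_size_gt0.
rewrite addrAC subrr add0r normrM normfV [`|_%:R|]gtr0_norm// mulrC ler_pdivrMr//.
apply: (le_trans (ler_norm_sum _ _ _)).
rewrite mulr_natr -[in leRHS](card_ord (P k)) -sumr_const; apply: ler_sum => i _.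
by rewrite normrM normrX normrN1 expr1n mul1r hM// tree_pos_lt.
Qed.

End TreeAverage.

(** * Decay of tree averages *)

Lemma ler_powRN (K : realType) (r x y : K) : 0 <= r -> 0 < x -> x <= y ->
  y `^ (- r) <= x `^ (- r).
Proof.
move=> r0 x0 xy; rewrite !powRN lef_pV2 ?posrE ?powR_gt0//; last lra.
by apply: ge0_ler_powR; rewrite ?nnegrE//; lra.
Qed.

Section Decay.
Context {K : realType}.
Variables (alpha : K) (f phi : nat -> K -> K) (s C : nat -> K).
Hypothesis alpha01 : 0 <= alpha <= 1.
Hypothesis dphi : forall n (x : K), is_derive x 1 (phi n) (f n x).
Hypothesis f_decay : forall n x, 1 <= x -> `|f n x| <= C n * x `^ (- (s n / 2)).
Hypothesis phi_decay :
  forall n x, 1 <= x -> `|phi n x| <= C n * x `^ (- (s n / 2)).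
Hypothesis f_lip : forall n x y, `|f n x - f n y| <= C n * `|x - y|.
Hypothesis C_gt0 : forall n, 0 < C n.
Hypothesis s_ge0 : forall n, 0 <= s n.
Hypothesis s_le : forall n, s n + alpha <= 1.

(** An antiderivative in [y] of [f n (y * xi)]; the quotient by [xi] is the gain at high
    frequencies. *)
Definition dilated n (xi y : K) : K := phi n (y * xi) / xi.

Lemma is_derive_dilated n (xi y : K) : 0 < xi ->
  is_derive y 1 (dilated n xi) (f n (y * xi)).
Proof.
move=> xi0.
have d1 : is_derive y 1 (fun y : K => y * xi) xi.
  have := @is_deriveM K K id (cst xi) y 1 1 0 _ _.
  rewrite (_ : id * cst xi = fun y => y * xi)//.
  by rewrite scaler0 add0r /= => h; apply: is_derive_eq; rewrite /GRing.scale/= mulr1.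
have d2 : is_derive y 1 (fun y : K => phi n (y * xi)) (f n (y * xi) * xi).
  exact: (@is_derive1_comp _ (phi n) (fun y => y * xi)).
have := @is_deriveM K K (fun y => phi n (y * xi)) (cst xi^-1) y 1
  (f n (y * xi) * xi) 0 _ _.
rewrite (_ : _ * cst xi^-1 = dilated n xi)// scaler0 add0r => h.
apply: is_derive_eq; rewrite /GRing.scale /= mulrC mulfK//; lra.
Qed.

(* The first term of the minimum comes from the mean value theorem, the second
   from the decay of the antiderivative [phi n]. *)
Definition gap_bound n k xi : K :=
  4 * C n * xi `^ (- (s n / 2)) * Num.min 1 (2 ^+ k / xi).

Lemma gap_bound_gt0 n k xi : 0 < xi -> 0 < gap_bound n k xi.
Proof.
move=> xi0; rewrite /gap_bound !mulr_gt0 ?powR_gt0//.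
by rewrite lt_min ltr01 divr_gt0 ?exprn_gt0.
Qed.

Lemma half_gap_bound n k xi a : 1 <= xi -> (a < 2 ^ k)%N ->
  `|half_gap (dilated n xi) k a| <= gap_bound n k xi.
Proof.
move=> xi1 ak.
have xi0 : 0 < xi by lra.
have pd y : 1 <= y <= 2 -> (y * xi) `^ (- (s n / 2)) <= xi `^ (- (s n / 2)).
  move=> y12; apply: ler_powRN => //; first by have := s_ge0 n; lra.
  nra.
have yx y : 1 <= y <= 2 -> 1 <= y * xi by move=> ?; nra.
have p0 : 0 < xi `^ (- (s n / 2)) by rewrite powR_gt0.
have h1 : `|half_gap (dilated n xi) k a| <= C n * xi `^ (- (s n / 2)).
  apply: (half_gap_deriv ak (fun y => is_derive_dilated n y xi0)) => y y12.
  by rewrite (le_trans (f_decay _ (yx _ y12)))// ler_pM2l// pd.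
have h2 : `|half_gap (dilated n xi) k a| <=
    4 * 2 ^+ k * (C n * xi `^ (- (s n / 2)) / xi).
  apply: (half_gap_le ak) => y y12; rewrite /dilated normrM normfV (gtr0_norm xi0).
  rewrite ler_pM2r ?invr_gt0//.
  by rewrite (le_trans (phi_decay _ (yx _ y12)))// ler_pM2l// pd.
rewrite /gap_bound minEle; case: ifP => _.
- rewrite mulr1 (le_trans h1)//; have := C_gt0 n; nra.
- by rewrite (le_trans h2)// le_eqVlt; apply/orP; left; apply/eqP; ring.
Qed.

Lemma gap_bound_anti n k x y : 1 <= x -> x <= y ->
  gap_bound n k y <= gap_bound n k x.
Proof.
move=> x1 xy; rewrite /gap_bound; apply: ler_pM.
- by rewrite mulr_ge0 ?powR_ge0// mulr_ge0// ltW.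
- by rewrite le_min ler01 divr_ge0 ?exprn_ge0//; lra.
- rewrite ler_pM2l ?mulr_gt0//; apply: ler_powRN => //; last lra.
  by have := s_ge0 n; lra.
- rewrite le_min ge_min lexx /= ge_min ler_pM2l ?exprn_gt0//.
  by rewrite lef_pV2 ?posrE ?orbT//; lra.
Qed.

(* The frequencies [xi] run over a grid of step [2 ^- (5 * k)] up to
   [2 ^+ (3 * k)]; beyond that range the trivial bound on the gaps suffices. *)
Definition sign_spec (e : nat -> (nat -> nat) -> nat -> bool) :=
  forall k a, (forall i, (i < tree_size alpha k)%N -> (a i < 2 ^ k)%N) ->
  forall n j, (n <= k)%N -> (j <= 2 ^ (8 * k))%N ->
  let xi := 1 + j%:R / 2 ^+ (5 * k) in
  `|\sum_(i < tree_size alpha k) (-1) ^+ e k a i * half_gap (dilated n xi) k (a i)|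
  <= 2 * Num.sqrt (tree_size alpha k)%:R * gap_bound n k xi * (10 * k%:R + 10).

(** Signs are selected for every level and every candidate list of positions, by one use of
    [choice]; the tree is built afterwards from the resulting strategy. *)
Lemma sign_spec_exists : exists e, sign_spec e.
Proof.
suff H : forall ka : nat * (nat -> nat), exists b : nat -> bool,
    (forall i, (i < tree_size alpha ka.1)%N -> (ka.2 i < 2 ^ ka.1)%N) ->
    forall n j, (n <= ka.1)%N -> (j <= 2 ^ (8 * ka.1))%N ->
    let xi := 1 + j%:R / 2 ^+ (5 * ka.1) in
    `|\sum_(i < tree_size alpha ka.1)
        (-1) ^+ b i * half_gap (dilated n xi) ka.1 (ka.2 i)|
    <= 2 * Num.sqrt (tree_size alpha ka.1)%:R * gap_bound n ka.1 xi
       * (10 * ka.1%:R + 10).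
  have [e he] := choice H.
  by exists (fun k a => e (k, a)) => k a; exact: (he (k, a)).
move=> [k a] /=; set P := tree_size alpha k.
have [ha|nha] := pselect (forall i, (i < P)%N -> (a i < 2 ^ k)%N); last first.
  by exists xpred0.
pose I := ('I_k.+1 * 'I_(2 ^ (8 * k)).+1)%type.
pose xi (j : I) : K := 1 + (j.2 : nat)%:R / 2 ^+ (5 * k).
have xi1 j : 1 <= xi j by rewrite /xi lerDl divr_ge0// exprn_ge0.
(* [sign_choice] asks for a bound at every natural number, hence the extension by 0. *)
pose c i (j : I) := if (i < P)%N then half_gap (dilated j.1 (xi j)) k (a i) else 0.
have B0 j : 0 < gap_bound (j : I).1 k (xi j).
  by apply: gap_bound_gt0; have := xi1 j; lra.
have cB i j : `|c i j| <= gap_bound (j : I).1 k (xi j).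
  rewrite /c; case: ifP => iP; last by rewrite normr0 ltW.
  by apply: half_gap_bound => //; exact: ha.
have [b hb] := sign_choice (tree_size_gt0 alpha k) B0 cB.
exists b => _ n j nk jk.
have jk' : (j < (2 ^ (8 * k)).+1)%N by [].
have nk' : (n < k.+1)%N by [].
have := hb (Ordinal nk', Ordinal jk').
rewrite /xi /=; under eq_bigr do rewrite /c ltn_ord.
move=> /le_trans; apply; rewrite ler_wpM2l//.
  apply: mulr_ge0; first by rewrite mulr_ge0 ?sqrtr_ge0.
  exact/ltW/(B0 (Ordinal nk', Ordinal jk')).
have l2 : ln (2 : K) <= 1.
  rewrite -ler_expR lnK ?posrE//; have := expR_ge1Dx (1 : K); lra.
(* At most 2^k members, at most 2 * 2^(8k) frequencies, and the factor 2 of the potential. Since ln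
   2 <= 1, the logarithm is at most 9k + 2. *)
have cI : 2 * #|{: I}|%:R <= 2 ^+ (9 * k + 2) :> K.
  rewrite card_prod !card_ord -natrM -natrX ler_nat.
  have h1 : (k.+1 <= 2 ^ k)%N by exact: ltn_expl.
  have h2 : ((2 ^ (8 * k)).+1 <= 2 * 2 ^ (8 * k))%N.
    by have := expn_gt0 2 (8 * k); lia.
  have -> : (2 ^ (9 * k + 2) = 4 * (2 ^ k * 2 ^ (8 * k)))%N.
    by rewrite -expnD expnD mulnC; congr (_ * 2 ^ _)%N; lia.
  have := leq_mul h1 h2; lia.
have I0 : 0 < 2 * #|{: I}|%:R :> K.
  by rewrite mulr_gt0// ltr0n card_prod !card_ord.
have := cI; rewrite -ler_ln ?posrE ?exprn_gt0// lnXn//.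
rewrite -[leRHS]mulr_natr natrD natrM => h.
have k0 : 0 <= k%:R :> K by [].
have l0 : 0 <= ln (2 : K) by rewrite ln_ge0//; lra.
nra.
Qed.

(** The first term is the cancellation at a grid frequency next to [xi]. The second absorbs both the
    rounding of [xi] to the grid and the frequencies beyond the grid. *)
Lemma tree_avg_increment e n k xi : sign_spec e -> (n <= k)%N -> 1 <= xi ->
  `|tree_avg alpha e (dilated n xi) k.+1 - tree_avg alpha e (dilated n xi) k|
  <= 20 * (k%:R + 1) / Num.sqrt (tree_size alpha k)%:R * gap_bound n k xi
     + 6 * C n * (2 : K) `^ (- (k%:R / 2)) * xi `^ (- 2^-1).
Proof.
move=> he nk xi1; have xi0 : 0 < xi by lra.
have p20 : 0 < (2 : K) `^ (- (k%:R / 2)) by rewrite powR_gt0.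
have px0 : 0 < xi `^ (- 2^-1) by rewrite powR_gt0.
set P := tree_size alpha k.
have P0 : 0 < P%:R :> K by rewrite ltr0n tree_size_gt0.
have sP0 : 0 < Num.sqrt P%:R :> K by rewrite sqrtr_gt0.
have T1 : 0 <= 20 * (k%:R + 1) / Num.sqrt P%:R * gap_bound n k xi.
  apply: mulr_ge0; last exact/ltW/gap_bound_gt0.
  by rewrite divr_ge0 ?sqrtr_ge0// mulr_ge0// addr_ge0.
have T2 : 0 <= 6 * C n * (2 : K) `^ (- (k%:R / 2)) * xi `^ (- 2^-1).
  by rewrite !mulr_ge0// ltW.
have [spl|nspl] := boolP (splits alpha k P).
  by rewrite tree_avg_split// subrr normr0 addr_ge0.
(* Beyond the grid no cancellation is used: xi > 2^(3k) gives 2^k / xi <= 2^k 2^(-3k/2)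
   xi^(-1/2). *)
have [xik|kxi] := leP xi (2 ^+ (3 * k)); last first.
  apply: (@le_trans _ _ (6 * C n * 2 `^ (- (k%:R / 2)) * xi `^ (- 2^-1))); last first.
    by rewrite lerDr.
  apply: (@le_trans _ _ (gap_bound n k xi)).
    apply: tree_avg_diff => [|a ak]; last exact: half_gap_bound.
    exact/ltW/gap_bound_gt0.
  have q1 : xi `^ (- (s n / 2)) <= 1.
    rewrite -[leRHS](powRr0 xi); apply: ler_powR => //.
    by have := s_ge0 n; lra.
  have q2 : 2 ^+ k / xi <= 2 `^ (- (k%:R / 2)) * xi `^ (- 2^-1).
    have -> : 2 ^+ k / xi = (2 `^ k%:R * xi `^ (- 2^-1)) * xi `^ (- 2^-1).
      rewrite powR_mulrn// -mulrA -powRD; last by rewrite (gt_eqF xi0) implybT.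
      congr (_ * _).
      by rewrite (_ : - 2^-1 - 2^-1 = - 1 :> K) ?powR_inv1 ?ltW//; field.
    rewrite ler_pM2r//.
    have : xi `^ (- 2^-1) <= (2 ^+ (3 * k)) `^ (- 2^-1).
      by apply: ler_powRN; rewrite ?exprn_gt0// ltW.
    rewrite -powR_mulrn// -powRrM natrM => h.
    apply: (@le_trans _ _ (2 `^ k%:R * 2 `^ (3 * k%:R * - 2^-1))).
      by rewrite ler_pM2l// powR_gt0.
    rewrite -powRD ?pnatr_eq0 ?implybT// le_eqVlt; apply/orP; left.
    by apply/eqP; congr powR; field.
  rewrite /gap_bound.
  apply: (@le_trans _ _ (4 * C n * 1 * (2 `^ (- (k%:R / 2)) * xi `^ (- 2^-1)))).
    apply: ler_pM.
    - by rewrite mulr_ge0 ?powR_ge0// mulr_ge0// ltW.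
    - by rewrite le_min ler01 divr_ge0 ?exprn_ge0//; lra.
    - by rewrite ler_pM2l ?mulr_gt0.
    - by rewrite ge_min q2 orbT.
  have := C_gt0 n; have := mulr_gt0 p20 px0; nra.
have p5 : 0 < (2 : K) ^+ (5 * k) by rewrite exprn_gt0.
(* Rounding goes upwards, so that [gap_bound_anti] carries the bound at the grid point back to [xi].
   As the grid starts at 1, the rounded index is still at most 2^(8k). *)
pose z := (xi - 1) * 2 ^+ (5 * k).
have z0 : 0 <= z by rewrite mulr_ge0 ?(ltW p5)//; lra.
have /andP[j1 j2] := truncn_itv z0.
pose j := (Num.truncn z).+1; rewrite -/j in j2.
have jz : j%:R <= z + 1 by rewrite /j -natr1 lerD2r.
pose xi' := 1 + j%:R / 2 ^+ (5 * k) : K.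
have xixi' : xi <= xi'.
  by rewrite /xi' -lerBlDl ler_pdivlMr//; exact: ltW.
have xi'xi : xi' <= xi + 2 ^- (5 * k).
  rewrite /xi' -(@ler_pM2r _ (2 ^+ (5 * k)))// !mulrDl !mulVf ?divfK ?gt_eqF//.
  by rewrite /z in jz; lra.
have jk : (j <= 2 ^ (8 * k))%N.
  rewrite -(ler_nat K) (le_trans jz)// natrX.
  have -> : (2 : K) ^+ (8 * k) = 2 ^+ (3 * k) * 2 ^+ (5 * k).
    by rewrite -exprD -mulnDl.
  have : 1 <= (2 : K) ^+ (5 * k) by apply: exprn_ege1; rewrite ler1n.
  move=> ?; apply: (@le_trans _ _ (xi * 2 ^+ (5 * k))); first by rewrite /z; lra.
  by rewrite ler_pM2r.
have := he k (tree_pos alpha e k) (@tree_pos_lt K alpha e k) n j nk jk.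
rewrite -/xi' -/P => /= H1.
have xi'1 : 1 <= xi' by lra.
have xi'0 : 0 < xi' by lra.
have H2 a : (a < 2 ^ k)%N ->
    `|half_gap (dilated n xi) k a - half_gap (dilated n xi') k a|
    <= 2 * C n * 2 ^- (5 * k).
  move=> ak; rewrite -half_gapB.
  apply: (half_gap_deriv (g := fun y => f n (y * xi) - f n (y * xi')) ak).
    by move=> y; apply: is_deriveB; exact: is_derive_dilated.
  move=> y /andP[y1 y2]; apply: (le_trans (f_lip _ _ _)).
  rewrite -mulrBr normrM distrC (ger0_norm (_ : 0 <= xi' - xi)) ?subr_ge0//.
  rewrite (ger0_norm (_ : 0 <= y)); last by lra.
  have c0 := C_gt0 n; have d0 : 0 <= xi' - xi by lra.
  have d1 : xi' - xi <= 2 ^- (5 * k) by lra.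
  rewrite [leRHS](_ : _ = C n * (2 * 2 ^- (5 * k))); last by ring.
  by rewrite ler_pM2l//; apply: ler_pM; rewrite ?(le_trans _ y1).
rewrite tree_avg_step// addrAC subrr add0r.
have -> : \sum_(i < P) (-1) ^+ e k (tree_pos alpha e k) i *
      half_gap (dilated n xi) k (tree_pos alpha e k i) =
    \sum_(i < P) (-1) ^+ e k (tree_pos alpha e k) i *
      half_gap (dilated n xi') k (tree_pos alpha e k i) +
    \sum_(i < P) (-1) ^+ e k (tree_pos alpha e k) i *
      (half_gap (dilated n xi) k (tree_pos alpha e k i) -
       half_gap (dilated n xi') k (tree_pos alpha e k i)).
  by rewrite -big_split/=; apply: eq_bigr => i _; rewrite mulrBr addrC subrK.
rewrite -/P mulrDr; apply: (le_trans (ler_normD _ _)); apply: lerD.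
- rewrite normrM normfV (gtr0_norm P0) mulrC ler_pdivrMr//; apply: (le_trans H1).
  rewrite -[X in _ <= _ * X]sqr_sqrtr ?(ltW P0)// expr2.
  rewrite [leRHS](_ : _ = 2 * Num.sqrt P%:R * gap_bound n k xi * (10 * k%:R + 10)).
    rewrite ler_wpM2r//.
    by rewrite ler_pM2l ?mulr_gt0//; exact: gap_bound_anti.
  by field; lra.
- rewrite normrM normfV (gtr0_norm P0) mulrC ler_pdivrMr//.
  apply: (@le_trans _ _ (2 * C n * 2 ^- (5 * k) * P%:R)).
    apply: (le_trans (ler_norm_sum _ _ _)).
    rewrite mulr_natr -[in leRHS](card_ord P) -sumr_const; apply: ler_sum => i _.
    by rewrite normrM normrX normrN1 expr1n mul1r H2// tree_pos_lt.
  rewrite ler_pM2r//.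
  have : (2 ^+ (3 * k)) `^ (- 2^-1) <= xi `^ (- 2^-1) by apply: ler_powRN.
  rewrite -powR_mulrn// -powRrM natrM => h.
  (* Here xi <= 2^(3k), so xi^(-1/2) is at least 2^(-3k/2) and a rounding error of order 2^(-5k)
     fits into the second term. *)
  have h2 : (2 : K) ^- (5 * k) <= 2 `^ (- (k%:R / 2)) * 2 `^ (3 * k%:R * - 2^-1).
    rewrite -powRD ?pnatr_eq0 ?implybT// -powR_invn// ler_powR//; first lra.
    by rewrite natrM; have := ler0n K k; lra.
  have h3 : (2 : K) ^- (5 * k) <= 2 `^ (- (k%:R / 2)) * xi `^ (- 2^-1).
    by apply: (le_trans h2); rewrite ler_pM2l.
  have := C_gt0 n; have := mulr_gt0 p20 px0; nra.
Qed.

(** Interpolation: min (1, t) <= t^(alpha/2 - d) with t = 2^k / xi. Of the resulting power of 2, the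
    factor 2^(alpha k / 2) is cancelled by the square root of the number of intervals, which is at
    least half of it, and 2^(-d k) remains. The constant is 20 * 2 * 4 from this term plus 6 from
    the error term. *)
Lemma increment_decay e n k xi d : sign_spec e -> (n <= k)%N -> 1 <= xi ->
  0 < d -> d <= alpha / 2 ->
  `|tree_avg alpha e (dilated n xi) k.+1 - tree_avg alpha e (dilated n xi) k|
  <= 166 * C n * (k%:R + 1) * (2 : K) `^ (- (d * k%:R))
     * xi `^ (- ((s n + alpha) / 2) + d).
Proof.
move=> he nk xi1 d0 da; have xi0 : 0 < xi by lra.
have k0 : 0 <= k%:R :> K by [].
have c0 := C_gt0 n.
apply: (le_trans (tree_avg_increment he nk xi1)).
set T := - ((s n + alpha) / 2) + d.
set u := (2 : K) `^ (- (d * k%:R)); set v := xi `^ T.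
have u0 : 0 < u by rewrite powR_gt0.
have v0 : 0 < v by rewrite powR_gt0.
have xi_le r : r <= T -> xi `^ r <= v by move=> ?; exact: ler_powR.
have d12 : d <= 2^-1 by have /andP[_ a1] := alpha01; lra.
have dk : d * k%:R <= 2^-1 * k%:R by rewrite ler_wpM2r.
have h2 : (2 : K) `^ (- (k%:R / 2)) <= u by apply: ler_powR; [rewrite ler1n|lra].
have h3 : xi `^ (- 2^-1) <= v.
  by apply: xi_le; rewrite /T; have := s_le n; lra.
have /andP[_] := tree_size_bound k alpha01.
set P := tree_size alpha k => P1.
set w := (2 : K) `^ (alpha * k%:R / 2).
have w0 : 0 < w by rewrite powR_gt0.
have sP : w / 2 <= Num.sqrt P%:R :> K.
  have -> : w / 2 = Num.sqrt ((w / 2) ^+ 2).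
    by rewrite sqrtr_sqr ger0_norm// divr_ge0// ltW.
  rewrite ler_sqrt//.
  have -> : (w / 2) ^+ 2 = 2 `^ (alpha * k%:R) / 4.
    have -> : (2 : K) `^ (alpha * k%:R) = w * w.
      by rewrite -powRD ?pnatr_eq0 ?implybT//; congr powR; field.
    by field.
  by have := ler0n K P; lra.
have q0 : 0 < 2 ^+ k / xi by rewrite divr_gt0// exprn_gt0.
have hmin : Num.min 1 (2 ^+ k / xi) <= (2 ^+ k / xi) `^ (alpha / 2 - d).
  have [q1|q1] := leP 1 (2 ^+ k / xi).
    by rewrite -[leLHS](powRr0 (2 ^+ k / xi)); apply: ler_powR => //; lra.
  by apply: ger1_powR; [rewrite q0 ltW|have := alpha01; lra].
have hq : xi `^ (- (s n / 2)) * (2 ^+ k / xi) `^ (alpha / 2 - d) = w * u * v.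
  rewrite powRM ?exprn_ge0 ?invr_ge0 ?(ltW xi0)// -powR_mulrn// -powRrM.
  have -> : xi^-1 = xi `^ (-1) by rewrite powR_inv1 ?ltW.
  rewrite -powRrM mulrCA -powRD; last first.
    by rewrite (gt_eqF xi0) implybT.
  rewrite /w /u /v /T -powRD ?pnatr_eq0 ?implybT//.
  by congr (_ `^ _ * _ `^ _); field.
have h1 : 20 * (k%:R + 1) / Num.sqrt P%:R * gap_bound n k xi <=
    160 * C n * (k%:R + 1) * u * v.
  have -> : 160 * C n * (k%:R + 1) * u * v =
      20 * (k%:R + 1) * (w / 2)^-1 * (4 * C n * (w * u * v)) :> K.
    by field; lra.
  have sP0 : 0 < Num.sqrt P%:R :> K by apply: lt_le_trans sP; lra.
  apply: ler_pM.
  - by rewrite divr_ge0 ?sqrtr_ge0//; lra.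
  - exact/ltW/gap_bound_gt0.
  - by rewrite ler_pM2l ?lef_pV2 ?posrE//; lra.
  - by rewrite /gap_bound -mulrA ler_pM2l ?mulr_gt0// -hq ler_pM2l// powR_gt0.
have h4 : 2 `^ (- (k%:R / 2)) * xi `^ (- 2^-1) <= u * v.
  by apply: ler_pM; rewrite ?powR_ge0.
have := mulr_gt0 u0 v0; move: h1 h4.
set a := 20 * _ / _ * _; set b := 2 `^ _; set c := xi `^ _.
rewrite -!mulrA; set uv := u * v => h1 h4 uv0.
have h5 : C n * (b * c) <= C n * uv by rewrite ler_pM2l.
have h6 : 0 <= C n * uv * k%:R by rewrite !mulr_ge0// ltW.
lra.
Qed.

(** The increments are summed as a geometric series, which gives a bound uniform in the level. *)
Lemma tree_avg_decay e n d : sign_spec e -> 0 < d -> d <= alpha / 2 ->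
  exists D : K, forall xi k, 1 <= xi ->
  `|tree_avg alpha e (dilated n xi) k| <= D * xi `^ (- ((s n + alpha) / 2) + d).
Proof.
move=> he d0 da; have c0 := C_gt0 n.
set T := - ((s n + alpha) / 2) + d.
(* Half of [d] gives the ratio of the series; the other half pays for the factor k + 1 through 1 + u
   k <= exp (u k). *)
pose rho : K := 2 `^ (- (d / 2)).
have rho0 : 0 < rho by rewrite powR_gt0.
have rho1 : rho < 1.
  rewrite /rho powRN invf_lt1 ?powR_gt0// -[ltLHS](powRr0 2) /powR.
  by rewrite !ifF ?gt_eqF// ltr_expR ltr_pM2r ?ln_gt0//; lra.
have rhok k : rho ^+ k = 2 `^ (- (d / 2 * k%:R)).
  by rewrite -powR_mulrn ?ltW// /rho -powRrM; congr powR; ring.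
pose M : K := 1 + (ln 2 * (d / 2))^-1.
have l2 : 0 < ln (2 : K) by rewrite ln_gt0// ltr1n.
have hM k : k%:R + 1 <= M * 2 `^ (d / 2 * k%:R).
  rewrite /powR ifF ?gt_eqF//; set u := ln 2 * (d / 2) in M *.
  have u0 : 0 < u by rewrite mulr_gt0//; lra.
  rewrite (_ : d / 2 * k%:R * ln 2 = u * k%:R); last by rewrite /u; ring.
  have := expR_ge1Dx (u * k%:R); have k0 : 0 <= k%:R :> K by [].
  have ui : u^-1 * u = 1 by rewrite mulVf ?gt_eqF.
  have ui0 : 0 < u^-1 by rewrite invr_gt0.
  move=> h; rewrite /M; apply: (@le_trans _ _ ((1 + u^-1) * (1 + u * k%:R))); last first.
    by rewrite ler_pM2l//; lra.
  rewrite mulrDl mul1r mulrDr mulr1 mulrA ui mul1r.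
  by have := mulr_ge0 (ltW u0) k0; lra.
have M0 : 0 < M by rewrite /M addr_gt0// invr_gt0 mulr_gt0//; lra.
pose D1 : K := C n * (166 * M + 4 * (2 * 2) ^+ n).
have D10 : 0 < D1.
  by apply: mulr_gt0 => //; apply: addr_gt0; apply: mulr_gt0 => //; apply: exprn_gt0; lra.
have xi_le xi r : 1 <= xi -> r <= T -> xi `^ r <= xi `^ T.
  by move=> ? ?; exact: ler_powR.
have T1 : -1 <= T by rewrite /T; have := s_le n; lra.
have s0 := s_ge0 n.
have step xi k : 1 <= xi ->
    `|tree_avg alpha e (dilated n xi) k.+1 - tree_avg alpha e (dilated n xi) k|
    <= D1 * rho ^+ k * xi `^ T.
  move=> xi1; have xi0 : 0 < xi by lra.
  have v0 : 0 < xi `^ T by rewrite powR_gt0.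
  have r0 : 0 < rho ^+ k by rewrite exprn_gt0.
  have [nk|kn] := leqP n k.
    apply: (le_trans (increment_decay he nk xi1 d0 da)); rewrite -/T.
    rewrite ler_pM2r//; set u := (2 : K) `^ (- (d * k%:R)); set r := rho ^+ k.
    have -> : 166 * C n * (k%:R + 1) * u = C n * (166 * ((k%:R + 1) * u)) by ring.
    have -> : D1 * r = C n * (166 * (M * r) + 4 * (2 * 2) ^+ n * r).
      by rewrite /D1; ring.
    rewrite ler_pM2l//; apply: ler_wpDr.
      by apply: mulr_ge0; [rewrite mulr_ge0// exprn_ge0// mulr_ge0|exact: ltW].
    rewrite ler_pM2l// /r /u rhok.
    have -> : (2 : K) `^ (- (d * k%:R)) = 2 `^ (- (d / 2 * k%:R)) / 2 `^ (d / 2 * k%:R).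
      by rewrite -powRN -powRD ?pnatr_eq0 ?implybT//; congr powR; field.
    by rewrite mulrCA [leRHS]mulrC ler_pM2l ?powR_gt0// ler_pdivrMr ?powR_gt0.
  (* Below level [n] the signs take no account of member [n]. The trivial bound yields 2^n / xi,
     where 1 / xi <= xi^T, and 1 <= 2^n rho^k puts these levels under the same series; hence (2 *
     2)^n in [D1]. *)
  apply: (@le_trans _ _ (gap_bound n k xi)).
    apply: tree_avg_diff => [|a ak]; last exact: half_gap_bound.
    exact/ltW/gap_bound_gt0.
  rewrite /gap_bound.
  have q1 : xi `^ (- (s n / 2)) <= 1.
    by rewrite -[leRHS](powRr0 xi); apply: ler_powR => //; lra.
  have q2 : Num.min 1 (2 ^+ k / xi) <= 2 ^+ n * xi `^ T.
    rewrite ge_min; apply/orP; right; apply: ler_pM.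
    - by rewrite exprn_ge0.
    - by rewrite invr_ge0 ltW.
    - by rewrite ler_eXn2l ?ltr1n// ltnW.
    - have -> : xi^-1 = xi `^ (-1) by rewrite powR_inv1 ?ltW.
      exact: xi_le.
  have q3 : 1 <= 2 ^+ n * rho ^+ k.
    have : 2^-1 <= rho.
      rewrite -[leLHS]powR_inv1// /rho.
      by apply: ler_powR; [rewrite ler1n|have /andP[_ ?] := alpha01; lra].
    move=> h; have h' : (2 : K) ^- k <= rho ^+ k by rewrite -exprVn; apply: lerXn2r; rewrite ?nnegrE// (ltW rho0).
    have h'' : (2 : K) ^- n <= 2 ^- k.
      by rewrite lef_pV2 ?posrE ?exprn_gt0// ler_eXn2l ?ltr1n// ltnW.
    rewrite -[leLHS](@divff _ (2 ^+ n)) ?expf_neq0// ler_pM2l ?exprn_gt0//.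
    exact: le_trans h'' h'.
  have q4 : Num.min 1 (2 ^+ k / xi) <= 2 ^+ n * xi `^ T * (2 ^+ n * rho ^+ k).
    apply: (le_trans q2); rewrite ler_peMr// mulr_ge0 ?(ltW v0)// exprn_ge0//.
  apply: (@le_trans _ _ (4 * C n * 1 * (2 ^+ n * xi `^ T * (2 ^+ n * rho ^+ k)))).
    apply: ler_pM => //.
    - by rewrite mulr_ge0 ?powR_ge0// mulr_ge0// ltW.
    - by rewrite le_min ler01 ltW// divr_gt0 ?exprn_gt0.
    - by rewrite ler_pM2l ?mulr_gt0.
  rewrite /D1 exprMn.
  have : 0 <= 166 * M * C n * (rho ^+ k * xi `^ T).
    by rewrite mulr_ge0 ?mulr_ge0 ?(ltW M0) ?(ltW c0) ?(ltW r0) ?(ltW v0)//.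
  lra.
exists (2 * C n + D1 / (1 - rho)) => xi k xi1.
have xi0 : 0 < xi by lra.
have v0 : 0 < xi `^ T by rewrite powR_gt0.
suff H : `|tree_avg alpha e (dilated n xi) k| <=
    (2 * C n + D1 * (1 - rho ^+ k) / (1 - rho)) * xi `^ T.
  apply: (le_trans H); rewrite ler_pM2r// lerD2l ler_pM2r ?invr_gt0 ?subr_gt0//.
  rewrite -[leRHS]mulr1 ler_pM2l// lerBlDr lerDl exprn_ge0//; exact: ltW.
elim: k => [|k ih].
  rewrite expr0 subrr mulr0 mul0r addr0 /tree_avg /= invr1 mul1r big_ord1.
  have -> : 2 * C n * xi `^ T = 2 * 2 ^+ 0 * (C n * xi `^ T) by rewrite expr0; ring.
  apply: dyadic_mean_le => // y y12; rewrite /dilated normrM normfV (gtr0_norm xi0).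
  rewrite ler_pdivrMr//.
  have yx : xi <= y * xi by nra.
  apply: (le_trans (phi_decay _ _)); first lra.
  rewrite -mulrA ler_pM2l//.
  apply: (@le_trans _ _ 1).
    rewrite -[leRHS](powRr0 (y * xi)); apply: ler_powR; lra.
  rewrite -[X in _ * X]powRr1 ?(ltW xi0)// -powRD; last by rewrite (gt_eqF xi0) implybT.
  by rewrite -[leLHS](powRr0 xi); apply: ler_powR => //; lra.
have -> : tree_avg alpha e (dilated n xi) k.+1 =
  tree_avg alpha e (dilated n xi) k + (tree_avg alpha e (dilated n xi) k.+1 -
    tree_avg alpha e (dilated n xi) k) by ring.
apply: (le_trans (ler_normD _ _)); apply: (le_trans (lerD ih (step xi k xi1))).
rewrite -mulrDl ler_pM2r// le_eqVlt; apply/orP; left; apply/eqP.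
by rewrite exprS; field; lra.
Qed.

End Decay.

(** * The Cantor set of a tree *)

Section CantorMap.
Context {K : realType}.
Variables (alpha : K) (e : nat -> (nat -> nat) -> nat -> bool).
Notation P := (tree_size alpha).
Notation pos := (tree_pos alpha e).

Definition cell (k i : nat) : set K :=
  `[gridpt k (pos k i), gridpt k (pos k i).+1].

Definition cantor_set : set K :=
  \bigcap_k \bigcup_(i in [set i | (i < P k)%N]) cell k i.

(** The parameter interval is cut into equal pieces, one for each interval of the level. *)
Definition addr (k : nat) (t : K) : nat := Num.truncn (t * (P k)%:R).

Definition left_end (k : nat) (t : K) : K := gridpt k (pos k (addr k t)).

(** A monotone parametrisation of the Cantor set, under which the natural measure is the image of
    Lebesgue measure on [[0, 1[]. All integrals over the set are taken in the parameter. *)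
Definition cantor_map (t : K) : K := sup (range (left_end ^~ t)).

Lemma truncn_double (x : K) : (Num.truncn (2 * x))./2 = Num.truncn x.
Proof.
have [x0|x0] := leP 0 x; last first.
  have /truncn0Pn -> : ~~ (1 <= x) by rewrite -ltNge; lra.
  by have /truncn0Pn -> : ~~ (1 <= 2 * x) by rewrite -ltNge; lra.
have x20 : 0 <= 2 * x by lra.
have /andP[h1 h2] := truncn_itv x20.
have /andP[] := truncn_itv x0.
set m := Num.truncn (2 * x) in h1 h2 *; set n := Num.truncn x => h3 h4.
have {h1 h4} h : (m < 2 * n.+1)%N.
  by rewrite -(ltr_nat K) natrM; lra.
have h' : (2 * n < m.+1)%N.
  by rewrite -(ltr_nat K) natrM; lra.
lia.
Qed.

Lemma addr_parent k t : parent alpha k (addr k.+1 t) = addr k t.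
Proof.
rewrite /parent /addr /=; case: (splits alpha k (P k)) => //.
by rewrite natrM mulrCA truncn_double.
Qed.

Lemma addr_lt k t : 0 <= t < 1 -> (addr k t < P k)%N.
Proof.
move=> /andP[t0 t1]; have P0 := tree_size_gt0 alpha k.
rewrite /addr truncn_lt_nat ?mulr_ge0//.
by rewrite gtr_pMl// ltr0n.
Qed.

Lemma gridpt_half k a :
  gridpt k a./2 <= gridpt k.+1 a :> K /\
  gridpt k.+1 a.+1 <= gridpt k a./2.+1 :> K.
Proof.
have p0 : 0 < (2 : K) ^+ k.+1 by rewrite exprn_gt0.
rewrite -(gridpt_double k a./2) -(gridpt_double k a./2.+1) /gridpt.
split; rewrite lerD2l ler_pM2r ?invr_gt0// ler_nat; lia.
Qed.

Lemma left_end_step k t : left_end k t <= left_end k.+1 t /\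
  left_end k.+1 t + 2 ^- k.+1 <= left_end k t + 2 ^- k.
Proof.
have := gridpt_half k (pos k.+1 (addr k.+1 t)).
by rewrite tree_pos_parent addr_parent -!gridpt_succ.
Qed.

Lemma left_end_le j k t : left_end j t <= left_end k t + 2 ^- k.
Proof.
have mono d i : left_end i t <= left_end (i + d) t.
  elim: d => [|d ih]; first by rewrite addn0.
  by rewrite addnS (le_trans ih)//; have [] := left_end_step (i + d) t.
have anti d i : left_end (i + d) t + 2 ^- (i + d) <= left_end i t + 2 ^- i.
  elim: d => [|d ih]; first by rewrite addn0.
  by rewrite addnS (le_trans _ ih)//; have [] := left_end_step (i + d) t.
have [jk|kj] := leqP j k.
  by rewrite -(subnKC jk) (le_trans (mono (k - j)%N j))// lerDl invr_ge0 exprn_ge0.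
have := anti (j - k)%N k; rewrite subnKC; last exact: ltnW.
by apply: le_trans; rewrite lerDl invr_ge0 exprn_ge0.
Qed.

Lemma cantor_map_itv k t :
  left_end k t <= cantor_map t <= left_end k t + 2 ^- k.
Proof.
apply/andP; split.
  apply: ub_le_sup; last by exists k.
  by exists (left_end k t + 2 ^- k) => _ [j _ <-]; exact: left_end_le.
apply: ge_sup; first by exists (left_end k t), k.
by move=> _ [j _ <-]; exact: left_end_le.
Qed.

Lemma cantor_map_cell k t : cell k (addr k t) (cantor_map t).
Proof. by rewrite /cell /= in_itv/= gridpt_succ; exact: cantor_map_itv. Qed.

Lemma cantor_map_in t : 0 <= t < 1 -> cantor_set (cantor_map t).
Proof.
by move=> t01 k _; exists (addr k t); [exact: addr_lt|exact: cantor_map_cell].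
Qed.

Lemma tree_pos_homo k i j : (i <= j)%N -> (pos k i <= pos k j)%N.
Proof. by rewrite leq_eqVlt => /predU1P[->//|h]; exact/ltnW/tree_pos_mono. Qed.

Lemma gridpt_homo k a b : (a <= b)%N -> gridpt k a <= gridpt k b :> K.
Proof.
by move=> ab; rewrite lerD2l ler_pM2r ?invr_gt0 ?exprn_gt0// ler_nat.
Qed.

Lemma left_end_homo k : {homo left_end k : x y / x <= y}.
Proof.
move=> x y xy; apply/gridpt_homo/tree_pos_homo.
by apply: le_truncn; rewrite ler_wpM2r.
Qed.

Lemma cantor_map_homo : {homo cantor_map : x y / x <= y}.
Proof.
move=> x y xy; apply: ge_sup; first by exists (left_end 0 x), 0%N.
move=> _ [k _ <-]; apply: (le_trans (left_end_homo k xy)).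
by have /andP[] := cantor_map_itv k y.
Qed.

Lemma measurable_cantor_map : measurable_fun setT cantor_map.
Proof. exact: nondecreasing_measurable cantor_map_homo. Qed.

Lemma cantor_set_sub : cantor_set `<=` `[1, 2].
Proof.
move=> y /(_ 0%N I)[i /= i1]; rewrite /cell /= !in_itv/= => /andP[y1 y2].
rewrite (le_trans (gridpt_ge1 _ _) y1) (le_trans y2)// gridpt_le2//.
Qed.

Lemma cantor_set_compact : compact cantor_set.
Proof.
apply: (subclosed_compact _ (@segment_compact _ 1 2) cantor_set_sub).
apply: closed_bigI => k _; apply: closed_bigcup => [|i _].
  exact: finite_II.
exact: interval_closed.
Qed.

Lemma cantor_set_nonempty : cantor_set !=set0.
Proof. by exists (cantor_map 0); apply: cantor_map_in; rewrite lexx ltr01. Qed.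

(** Two cell lengths between the points mean positions differing by at most 3, hence, by
    [tree_pos_dist], indices differing by at most 3. Truncation adds one more unit, which makes
    4. *)
Lemma cantor_map_dist k t t' : 0 <= t -> 0 <= t' ->
  `|cantor_map t - cantor_map t'| <= 2 * 2 ^- k -> `|t - t'| <= 4 / (P k)%:R.
Proof.
wlog tt' : t t' / t' <= t => [hw t0 t'0|t0 t'0].
  have [h|/ltW h] := leP t' t; first exact: hw.
  by rewrite (distrC (cantor_map t)) (distrC t); exact: hw.
have P0 : 0 < (P k)%:R :> K by rewrite ltr0n tree_size_gt0.
rewrite !ger0_norm ?subr_ge0//; last exact: cantor_map_homo.
move=> h; rewrite ler_pdivlMr// mulrBl.
have /andP[a1 a2] := cantor_map_itv k t; have /andP[b1 b2] := cantor_map_itv k t'.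
have /andP[_] := truncn_itv (mulr_ge0 t0 (ltW P0)); rewrite -/(addr k t) => c1.
have /andP[+ _] := truncn_itv (mulr_ge0 t'0 (ltW P0)).
rewrite -/(addr k t') => c2.
have ii' : (addr k t' <= addr k t)%N by apply: le_truncn; rewrite ler_wpM2r.
have : left_end k t <= left_end k t' + 3 * 2 ^- k by lra.
rewrite /left_end /gridpt -addrA lerD2l -mulrDl ler_pM2r ?invr_gt0 ?exprn_gt0//.
rewrite -natrD ler_nat => h3.
have h4 := tree_pos_dist alpha e k ii'.
have : (addr k t <= addr k t' + 3)%N.
  by rewrite -leq_subLR -(leq_add2l (pos k (addr k t'))) (leq_trans h4).
rewrite -(ler_nat K) natrD; rewrite -natr1 in c1; lra.
Qed.

End CantorMap.

Lemma dyadic_scale (K : realType) (r : K) : 0 < r <= 1 ->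
  exists k, 2 ^- k.+1 < r <= 2 ^- k.
Proof.
move=> /andP[r0 r1].
have ex : exists k, 2 ^- k < r.
  exists (Num.truncn r^-1).+1; rewrite invf_plt ?posrE ?exprn_gt0//.
  rewrite (lt_le_trans (truncnS_gt _))// -natrX ler_nat ltnW//.
  exact: ltn_expl.
case: (ex_minnP ex) => -[|k] hk hmin.
  by move: hk; rewrite expr0 invr1 ltNge r1.
exists k; rewrite hk leNgt; apply/negP => /hmin; rewrite ltnn//.
Qed.

(** * Measures and Fubini *)

Section BoundedIntegrals.
Context d {T : measurableType d} {K : realType}.
Variable mu : {measure set T -> \bar K}.

Lemma integrable_bounded (D : set T) (f : T -> K) (M : K) :
  measurable D -> (mu D < +oo)%E -> measurable_fun D f ->
  (forall x, D x -> `|f x| <= M) -> mu.-integrable D (EFin \o f).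
Proof.
move=> mD muD mf fM; apply: measurable_bounded_integrable => //.
exists M; split; first exact: num_real.
by move=> y My x Dx; rewrite /= (le_trans (fM x Dx))// ltW.
Qed.

Lemma normr_Rintegral_le (D : set T) (f : T -> K) (M : K) :
  measurable D -> (mu D < +oo)%E -> measurable_fun D f ->
  (forall x, D x -> `|f x| <= M) ->
  `|\int[mu]_(x in D) f x| <= M * fine (mu D).
Proof.
move=> mD muD mf fM; have fi := integrable_bounded mD muD mf fM.
apply: (le_trans (le_normr_Rintegral mD fi)).
rewrite -Rintegral_cst//; apply: le_Rintegral => //.
- apply: (integrable_bounded (M := M) mD muD); first exact: measurableT_comp.
  by move=> x Dx; rewrite normr_id fM.
- by apply: (integrable_bounded (M := `|M|)) => //; exact: measurable_cst.
Qed.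

End BoundedIntegrals.

(** Restriction followed by push-forward, packaged as a finite measure with its change of variables.
    Weighted measures ([S] a subgraph), images of products and the natural measure of the Cantor set
    are all obtained from it. *)
Lemma mixture_exists d (T : measurableType d) (K : realType)
    (mu : {measure set T -> \bar K}) (S : set T) (Psi : T -> measurableTypeR K) :
  measurable S -> (mu S < +oo)%E -> measurable_fun setT Psi ->
  exists nu : {finite_measure set (measurableTypeR K) -> \bar K},
    (forall A, measurable A -> nu A = mu (Psi @^-1` A `&` S)) /\
    (forall (g : K -> K) M, measurable_fun setT g -> (forall x, `|g x| <= M) ->
       \int[nu]_x g x = \int[mu]_(z in S) g (Psi z)).
Proof.
move=> mS Soo mPsi.
pose rho : {finite_measure set T -> \bar K} := mfrestr mS Soo.
pose nu1 : {measure set (measurableTypeR K) -> \bar K} := pushforward rho Psi.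
pose nu0 : {measure set (measurableTypeR K) -> \bar K} := nu1 mPsi.
have nu0E A : nu0 A = mu (Psi @^-1` A `&` S) by [].
have fin : fin_num_fun nu0.
  move=> A mA; rewrite nu0E ge0_fin_numE ?measure_ge0//.
  apply: (le_lt_trans _ Soo); apply: le_measure; rewrite ?inE//.
  by apply: measurableI => //; rewrite -[X in measurable X]setTI; exact: (mPsi measurableT A mA).
pose nu : {finite_measure set (measurableTypeR K) -> \bar K} :=
  HB.pack (Measure.sort nu0) (Measure_isFinite.Build _ _ _ nu0 fin).
exists nu; split => [A mA|g M mg gM]; first exact: nu0E.
have rhooo (D : set T) : measurable D -> (rho D < +oo)%E.
  by move=> mD; rewrite -ge0_fin_numE//; exact: fin_num_measure.
have mgPsi (D : set T) : measurable_fun D (g \o Psi).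
  by apply: measurable_funTS; exact: measurableT_comp.
rewrite /Rintegral; congr fine.
rewrite (_ : \int[nu]_x (g x)%:E = \int[nu0]_x (g x)%:E)%E//.
have gi : rho.-integrable setT ((EFin \o g) \o Psi).
  by apply: (integrable_bounded (M := M)) => //; exact: rhooo.
rewrite integral_pushforward//; last exact: measurableT_comp.
rewrite preimage_setT (negligible_integral (N := ~` S))//; last 2 first.
- exact: measurableC.
- by rewrite /rho /= /mfrestr /mrestr setICl measure0.
rewrite setTD setCK; apply: eq_measure_integral => A mA AS.
by rewrite /rho /= /mfrestr /mrestr setIidl.
Qed.

Section FiniteFubini.
Context d1 d2 (T1 : measurableType d1) (T2 : measurableType d2) (K : realType).
Variables (m1 : {finite_measure set T1 -> \bar K}).
Variables (m2 : {finite_measure set T2 -> \bar K}).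

Lemma finite_measure_lty d (T : measurableType d)
  (m : {finite_measure set T -> \bar K}) (A : set T) :
  measurable A -> (m A < +oo)%E.
Proof. by move=> mA; rewrite -ge0_fin_numE//; exact: fin_num_measure. Qed.

Lemma product_measure_lty (A : set (T1 * T2)) :
  measurable A -> ((m1 \x m2) A < +oo)%E.
Proof.
move=> mA; apply: (@le_lt_trans _ _ ((m1 \x m2)%E setT)).
  by apply: le_measure; rewrite ?inE.
rewrite -setXTT product_measure1E//.
by rewrite lte_mul_pinfty// ?finite_measure_lty// ge0_fin_numE// finite_measure_lty.
Qed.

Variables (h : T1 * T2 -> K) (M : K).
Hypothesis mh : measurable_fun setT h.
Hypothesis hM : forall z, `|h z| <= M.

Lemma Rintegral_product12 :
  \int[(m1 \x m2)%E]_z h z = \int[m1]_x \int[m2]_y h (x, y).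
Proof.
have hi : (m1 \x m2)%E.-integrable setT (EFin \o h).
  by apply: (integrable_bounded (M := M)) => //; exact: product_measure_lty.
rewrite {1}/Rintegral -integral12_prod_meas1//; congr fine.
apply: eq_integral => x _; rewrite /fubini_F /= fineK//.
apply: integrable_fin_num => //.
apply: (integrable_bounded (M := M)) => //; first exact: finite_measure_lty.
exact: measurableT_comp.
Qed.

Lemma Rintegral_product21 :
  \int[(m1 \x m2)%E]_z h z = \int[m2]_y \int[m1]_x h (x, y).
Proof.
have hi : (m1 \x m2)%E.-integrable setT (EFin \o h).
  by apply: (integrable_bounded (M := M)) => //; exact: product_measure_lty.
rewrite {1}/Rintegral -integral21_prod_meas1//; congr fine.
apply: eq_integral => x _; rewrite /fubini_G /= fineK//.
apply: integrable_fin_num => //.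
apply: (integrable_bounded (M := M)) => //; first exact: finite_measure_lty.
exact: measurableT_comp.
Qed.

End FiniteFubini.

Section UnitMeasure.
Context {K : realType}.

Lemma lebesgue_unit_lty : (@lebesgue_measure K `[0%R, 1%R[ < +oo)%E.
Proof. by rewrite lebesgue_measure_itv/= lte_fin ltr01 ltry. Qed.

(** The interval is half-open because [addr k 1] would be one past the last interval. *)
Definition unit_lebesgue : {finite_measure set (measurableTypeR K) -> \bar K} :=
  @mfrestr _ (measurableTypeR K) K `[0%R, 1%R[ lebesgue_measure
    (measurable_itv `[(0 : K), 1[) lebesgue_unit_lty.

Lemma unit_lebesgueE (A : set K) :
  unit_lebesgue A = lebesgue_measure (A `&` `[0, 1[).
Proof. by []. Qed.

Lemma unit_lebesgue_setT : unit_lebesgue setT = 1%E.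
Proof.
by rewrite unit_lebesgueE setTI lebesgue_measure_itv/= lte_fin ltr01 sube0.
Qed.

End UnitMeasure.

Section Weighted.
Context {K : realType}.
Implicit Type mu : {finite_measure set (measurableTypeR K) -> \bar K}.

(* The density is realised by pushing forward the part of [mu x Lebesgue] lying
   under the graph of [w]. *)
Lemma weighted_exists mu (w : K -> K) : measurable_fun setT w ->
  (forall x, 0 <= w x <= 1) ->
  exists nu : {finite_measure set (measurableTypeR K) -> \bar K},
    (forall A : set K, measurable A -> mu A = 0%E -> nu A = 0%E) /\
    (forall (g : K -> K) M, measurable_fun setT g -> (forall x, `|g x| <= M) ->
       \int[nu]_x g x = \int[mu]_x (w x * g x)).
Proof.
move=> mw w01.
pose S := [set z : measurableTypeR K * measurableTypeR K | z.2 < w z.1].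
have mS : measurable S.
  have := measurable_fun_ltr (@measurable_snd _ _ (measurableTypeR K) (measurableTypeR K))
    (measurableT_comp mw (@measurable_fst _ _ (measurableTypeR K) (measurableTypeR K))).
  move=> /(_ measurableT [set true] I); rewrite setTI.
  by congr measurable; apply/seteqP; split.
have Soo : ((mu \x unit_lebesgue) S < +oo)%E by exact: product_measure_lty.
have [nu [nuE nuI]] := mixture_exists mS Soo measurable_fst.
exists nu; split => [A mA muA|g M mg gM].
  rewrite nuE//; apply/eqP; rewrite eq_le measure_ge0 andbT.
  apply: (@le_trans _ _ ((mu \x unit_lebesgue)%E (A `*` setT))).
    apply: le_measure; rewrite ?inE.
    - apply: measurableI => //; rewrite -[X in measurable X]setTI.
      exact: measurable_fst.
    - exact: measurableX.
    - by move=> z [].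
  by rewrite product_measure1E// [X in (X * _)%E]muA mul0e.
rewrite (nuI g M)// Rintegral_mkcond (@Rintegral_product12 _ _ _ _ _ _ _ _ M)//.
- apply: eq_Rintegral => x _; have /andP[w0 w1] := w01 x.
  transitivity (\int[unit_lebesgue]_(t in `]-oo, w x[) g x).
    rewrite [RHS]Rintegral_mkcond; apply: eq_Rintegral => t _.
    rewrite !patchE; have [tw|tw] := boolP (t < w x).
      by rewrite !mem_set//= in_itv.
    by rewrite !memNset//= ?in_itv/=; exact/negP.
  rewrite Rintegral_cst// mulrC; congr (_ * _).
  transitivity (fine (@lebesgue_measure K (`]-oo, w x[ `&` `[0%R, 1%R[))) => //.
  rewrite (_ : _ `&` _ = `[0, w x[%classic); last first.
    apply/seteqP; split => t /=; rewrite !in_itv/=; first by move=> [-> /andP[->]].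
    by move=> /andP[-> tw]; split => //; exact: lt_le_trans w1.
  rewrite lebesgue_measure_itv/= lte_fin; case: ltP => [_|wx].
    by rewrite oppr0 addr0.
  by apply/eqP; rewrite eq_le w0.
- apply/(measurable_restrictT _ mS)/measurable_funTS; exact: measurableT_comp.
- move=> z; rewrite patchE; case: ifP => _ //.
  by rewrite normr0 (le_trans _ (gM 0)).
Qed.

(** With [G] the parametrisation of Y and [mu] on R, this is a measure on RY whose transform is an
    average of dilated transforms of [mu]. *)
Lemma product_mixture_exists mu (G : K -> K) : measurable_fun setT G ->
  exists nu : {finite_measure set (measurableTypeR K) -> \bar K},
    (forall A : set K, measurable A ->
       nu A = (mu \x unit_lebesgue)%E [set z | A (z.1 * G z.2)]) /\
    (forall (g : K -> K) M, measurable_fun setT g -> (forall x, `|g x| <= M) ->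
       \int[nu]_x g x = \int[unit_lebesgue]_t \int[mu]_x g (x * G t)).
Proof.
move=> mG.
have mPsi : measurable_fun setT
    (fun z : measurableTypeR K * measurableTypeR K => z.1 * G z.2 : measurableTypeR K).
  by apply: measurable_funM => //; exact: measurableT_comp.
have Soo : ((mu \x unit_lebesgue) setT < +oo)%E by exact: product_measure_lty.
have [nu [nuE nuI]] := mixture_exists measurableT Soo mPsi.
exists nu; split => [A mA|g M mg gM]; first by rewrite nuE// setIT.
rewrite (nuI g M)// (@Rintegral_product21 _ _ _ _ _ _ _ _ M)//.
exact: measurableT_comp.
Qed.

End Weighted.

(** * Fourier decay along the Cantor set *)

Section StepAverage.
Context {K : realType}.
Notation leb := (@lebesgue_measure K).

Lemma Rintegral_unit_lebesgue (F : K -> K) (M : K) : measurable_fun setT F ->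
  (forall t, `|F t| <= M) ->
  \int[unit_lebesgue]_t F t = \int[leb]_(t in `[0%R, 1%R[) F t.
Proof.
move=> mF FM; rewrite /Rintegral; congr fine.
rewrite (@negligible_integral _ (measurableTypeR K) K unit_lebesgue
  setT (~` `[0, 1[))//; last 3 first.
- exact: measurableC.
- apply: (integrable_bounded (M := M)) => //; exact: finite_measure_lty.
- by rewrite /= /mfrestr /mrestr setICl measure0.
rewrite setTD setCK; apply: eq_measure_integral => A mA AS.
by rewrite /= /mfrestr /mrestr setIidl.
Qed.

Lemma lebesgue_itvco_lty (a b : K) : (leb `[a, b[ < +oo)%E.
Proof. by rewrite lebesgue_measure_itv/=; case: ifP; rewrite ltry. Qed.

(** Piece by piece: after m of the n equal pieces the error is at most eps m / n. *)
Lemma step_average (F : K -> K) (v : nat -> K) (n : nat) (M eps : K) :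
  (0 < n)%N -> measurable_fun setT F -> (forall t, `|F t| <= M) ->
  (forall t, 0 <= t < 1 -> `|F t - v (Num.truncn (t * n%:R))| <= eps) ->
  `|\int[unit_lebesgue]_t F t - n%:R^-1 * \sum_(i < n) v i| <= eps.
Proof.
move=> n0 mF FM Fv.
have n0' : 0 < n%:R :> K by rewrite ltr0n.
have Fi (a b : K) : leb.-integrable `[a, b[ (EFin \o F).
  apply: (integrable_bounded (M := M)) => //; first exact: lebesgue_itvco_lty.
  exact: measurable_funTS.
rewrite (Rintegral_unit_lebesgue mF FM).
suff H m : (m <= n)%N ->
    `|\int[leb]_(t in `[0%R, (m%:R / n%:R : K)[) F t - n%:R^-1 * \sum_(i < m) v i|
    <= m%:R / n%:R * eps.
  by have := H n (leqnn n); rewrite divff ?mul1r// gt_eqF.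
elim: m => [_|m ih mn].
  by rewrite mul0r set_itv_ge ?bnd_simp// Rintegral_set0 big_ord0 mulr0 subrr normr0 mul0r.
have mn1 : m%:R / n%:R < m.+1%:R / n%:R :> K by rewrite ltr_pM2r ?invr_gt0// ltr_nat.
have m0 : 0 <= m%:R / n%:R :> K by rewrite divr_ge0.
have mS : m.+1%:R / n%:R = m%:R / n%:R + n%:R^-1 :> K by rewrite -natr1 mulrDl mul1r.
have E : `[0, (m.+1%:R / n%:R)[%classic =
    `[0, (m%:R / n%:R)[%classic `|` `[(m%:R / n%:R), (m.+1%:R / n%:R)[%classic :> set K.
  by rewrite -itv_bndbnd_setU// bnd_simp// ltW.
rewrite E Rintegral_setU//; last 2 first.
- by rewrite -E.
- apply/disj_setPS => t [/=]; rewrite !in_itv/= => /andP[_ h1] /andP[h2 _].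
  by move: (lt_le_trans h1 h2); rewrite ltxx.
have piece : `|\int[leb]_(t in `[(m%:R / n%:R : K), m.+1%:R / n%:R[) F t - n%:R^-1 * v m|
    <= n%:R^-1 * eps.
  have lm : fine (leb `[(m%:R / n%:R), (m.+1%:R / n%:R)[) = n%:R^-1.
    by rewrite lebesgue_measure_itv/= lte_fin mn1/= mS addrAC subrr add0r.
  have -> : n%:R^-1 * v m = \int[leb]_(t in `[(m%:R / n%:R : K), m.+1%:R / n%:R[) v m.
    by rewrite Rintegral_cst// lm mulrC.
  rewrite -RintegralB//; last first.
    by apply: (integrable_bounded (M := `|v m|)) => //; exact: lebesgue_itvco_lty.
  rewrite [leRHS](_ : _ = eps * fine (leb `[(m%:R / n%:R), (m.+1%:R / n%:R)[)).
    2: by rewrite lm mulrC.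
  apply: normr_Rintegral_le => //.
  - exact: lebesgue_itvco_lty.
  - by apply: measurable_funB => //; exact: measurable_funTS.
  move=> t /=; rewrite in_itv/= => /andP[t1 t2].
  have t0 : 0 <= t by exact: le_trans t1.
  have <- : Num.truncn (t * n%:R) = m.
    by apply: truncn_def; rewrite -ler_pdivrMr// t1 -ltr_pdivlMr.
  apply: Fv; rewrite t0 (lt_le_trans t2)// ler_pdivrMr// mul1r ler_nat//.
rewrite big_ord_recr /= mulrDr opprD addrACA [in leRHS]mS [in leRHS]mulrDl.
apply: (le_trans (ler_normD _ _)); apply: lerD; last exact: piece.
by apply: ih; exact: ltnW.
Qed.

End StepAverage.

Section CantorDecay.
Context {K : realType}.
Variables (alpha : K) (f phi : nat -> K -> K) (s C : nat -> K).
Hypothesis alpha01 : 0 <= alpha <= 1.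
Hypothesis dphi : forall n (x : K), is_derive x 1 (phi n) (f n x).
Hypothesis f_decay : forall n x, 1 <= x -> `|f n x| <= C n * x `^ (- (s n / 2)).
Hypothesis phi_decay :
  forall n x, 1 <= x -> `|phi n x| <= C n * x `^ (- (s n / 2)).
Hypothesis f_lip : forall n x y, `|f n x - f n y| <= C n * `|x - y|.
Hypothesis f_bound : forall n x, `|f n x| <= C n.
Hypothesis f_meas : forall n, measurable_fun setT (f n).
Hypothesis C_gt0 : forall n, 0 < C n.
Hypothesis s_ge0 : forall n, 0 <= s n.
Hypothesis s_le : forall n, s n + alpha <= 1.

(** For fixed [xi], the integral and the tree average of level k both differ from the mean over left
    end points by at most C xi 2^(-k). Since the bound on tree averages is uniform in k, it passes
    to the limit. *)
Lemma cantor_decay : exists e, forall n d, 0 < d -> d <= alpha / 2 ->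
  exists D : K, forall xi, 1 <= xi ->
  `|\int[unit_lebesgue]_t f n (cantor_map alpha e t * xi)|
    <= D * xi `^ (- ((s n + alpha) / 2) + d).
Proof.
have [e he] := sign_spec_exists alpha01 dphi f_decay phi_decay C_gt0 s_ge0.
exists e => n d d0 da.
have [D hD] := tree_avg_decay alpha01 dphi f_decay phi_decay f_lip C_gt0
  s_ge0 s_le n he d0 da.
exists D => xi xi1; have xi0 : 0 < xi by lra.
have c0 := C_gt0 n.
apply/ler_addgt0Pr => eps eps0.
have [k hk] : exists k, 2 * C n * xi * 2 ^- k <= eps.
  have q0 : 0 < 2 * C n * xi by rewrite !mulr_gt0.
  exists (Num.truncn (2 * C n * xi / eps)).+1.
  rewrite ler_pdivrMr ?exprn_gt0// [leRHS]mulrC -ler_pdivrMr//.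
  apply: le_trans (ltW (truncnS_gt _)) _.
  by rewrite -natrX ler_nat ltnW// ltn_expl.
have cell_bound y1 y2 a : gridpt k a <= y1 <= gridpt k a.+1 ->
    gridpt k a <= y2 <= gridpt k a.+1 ->
    `|f n (y1 * xi) - f n (y2 * xi)| <= C n * xi * 2 ^- k.
  rewrite gridpt_succ => h1 h2; apply: (le_trans (f_lip _ _ _)).
  rewrite -mulrA ler_pM2l// -mulrBl normrM (gtr0_norm xi0) mulrC ler_pM2l//.
  by rewrite ler_norml; lra.
pose v i := f n (gridpt k (tree_pos alpha e k i) * xi).
have P0 : 0 < (tree_size alpha k)%:R :> K by rewrite ltr0n tree_size_gt0.
have h1 : `|\int[unit_lebesgue]_t f n (cantor_map alpha e t * xi) -
    (tree_size alpha k)%:R^-1 * \sum_(i < tree_size alpha k) v i| <= C n * xi * 2 ^- k.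
  apply: (@step_average _ _ _ _ (C n)) => [||t|t t01].
  - exact: tree_size_gt0.
  - apply: (measurableT_comp (f_meas n)); apply: measurable_funM => //.
    exact: measurable_cantor_map.
  - exact: f_bound.
  rewrite /v; apply: (cell_bound _ _ (tree_pos alpha e k (addr alpha k t))).
    by have := @cantor_map_cell _ alpha e k t; rewrite /cell /= in_itv.
  by rewrite lexx gridpt_homo.
have h2 : `|tree_avg alpha e (dilated phi n xi) k -
    (tree_size alpha k)%:R^-1 * \sum_(i < tree_size alpha k) v i| <= C n * xi * 2 ^- k.
  rewrite /tree_avg -mulrBr -sumrB normrM normfV (gtr0_norm P0) mulrC ler_pdivrMr//.
  apply: (le_trans (ler_norm_sum _ _ _)).
  rewrite mulr_natr -[in leRHS](card_ord (tree_size alpha k)) -sumr_const.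
  apply: ler_sum => i _.
  have [y yi ->] := dyadic_mean_deriv k (tree_pos alpha e k i)
    (fun y => is_derive_dilated dphi n y xi0).
  by apply: cell_bound yi _; rewrite lexx gridpt_homo.
have := hD xi k xi1; move: h1 h2 hk.
set I := Rintegral _ _ _; set A := tree_avg _ _ _ _; set S := _^-1 * _.
rewrite !ler_norml; lra.
Qed.

Variable e : nat -> (nat -> nat) -> nat -> bool.

(** For 2^(-k-1) < r <= 2^(-k), two parameters in the preimage differ by at most 4 / P, so the
    preimage has measure at most 8 / P < 16 / 2^(alpha k). Passing from 2^(-alpha k) to r^alpha
    costs at most another factor 2. *)
Lemma cantor_frostman (x r : K) : 0 < r ->
  (unit_lebesgue (cantor_map alpha e @^-1` `[(x - r)%R, (x + r)%R]) <= (32 * r `^ alpha)%:E)%E.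
Proof.
have /andP[a0 a1] := alpha01.
move=> r0; set A := _ @^-1` _.
have mA : measurable A.
  rewrite -[X in measurable X]setTI; exact: (measurable_cantor_map alpha e).
have [r1|r1] := leP 1 r.
  apply: (@le_trans _ _ (unit_lebesgue setT)).
    by apply: le_measure; rewrite ?inE.
  rewrite unit_lebesgue_setT lee_fin.
  have : 1 <= r `^ alpha by rewrite -[leLHS](powRr0 r); exact: ler_powR.
  lra.
have r01 : 0 < r <= 1 by rewrite r0 ltW.
have [k /andP[k1 k2]] := dyadic_scale r01.
have P0 : 0 < (tree_size alpha k)%:R :> K by rewrite ltr0n tree_size_gt0.
have tx t : A t -> `|cantor_map alpha e t - x| <= r.
  by rewrite /A /= in_itv/= ler_norml => /andP[? ?]; lra.
have [[t0 [At0 t01]]|A0] := pselect ((A `&` `[0, 1[) !=set0); last first.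
  rewrite unit_lebesgueE (_ : _ `&` _ = set0) ?measure0 ?lee_fin ?mulr_ge0 ?powR_ge0//.
  by apply/eqP; apply: contrapT => /negP/set0P.
pose d : K := 4 / (tree_size alpha k)%:R.
apply: (@le_trans _ _ (lebesgue_measure `[t0 - d, t0 + d])).
  rewrite unit_lebesgueE; apply: le_measure; rewrite ?inE//.
    exact: measurableI.
  move=> t [At /=]; rewrite !in_itv/= => /andP[t1 _].
  have : `|t - t0| <= d.
    apply: (cantor_map_dist (e := e)) => //.
      by move: t01; rewrite /= in_itv/= => /andP[].
    have := tx _ At; have := tx _ At0; rewrite !ler_norml => /andP[? ?] /andP[? ?].
    by lra.
  by rewrite ler_norml => /andP[? ?]; lra.
have d0 : 0 < d by rewrite divr_gt0.
rewrite lebesgue_measure_itv/= lte_fin ifT; last by lra.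
rewrite -EFinB lee_fin (_ : _ - _ = 2 * d); last by lra.
have /andP[_ P1] := tree_size_bound k alpha01.
have h : (2 ^- k.+1) `^ alpha <= r `^ alpha.
  by apply: ge0_ler_powR; rewrite ?nnegrE// ltW.
apply: (@le_trans _ _ (32 * (2 ^- k.+1) `^ alpha)); last by rewrite ler_pM2l.
have -> : (2 ^- k.+1) `^ alpha = 2 `^ (- alpha) / 2 `^ (alpha * k%:R) :> K.
  rewrite -powRN -powRD ?pnatr_eq0 ?implybT// -powR_invn// -powRrM.
  by congr powR; rewrite -natr1; ring.
have h2 : 2^-1 <= 2 `^ (- alpha) :> K.
  by rewrite -[leLHS]powR_inv1//; apply: ler_powR; [rewrite ler1n|lra].
set w := 2 `^ (alpha * k%:R) in P1 *.
have w0 : 0 < w by rewrite powR_gt0.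
apply: (@le_trans _ _ (16 / w)).
  rewrite /d mulrA ler_pdivrMr// mulrAC ler_pdivlMr//; lra.
by rewrite mulrA ler_pM2r ?invr_gt0//; lra.
Qed.

End CantorDecay.

(** * Weighted trigonometric integrals *)

(** A uniform quadratic remainder survives integration, so differentiation under the integral sign
    needs no limit theorem. *)
Lemma is_derive_quadratic (K : realType) (g : K -> K) (x l C : K) :
  (forall y, `|g y - g x - (y - x) * l| <= C * (y - x) ^+ 2) ->
  is_derive x 1 g l.
Proof.
move=> gC.
have C0 : 0 <= C.
  have := gC (x + 1); rewrite (_ : x + 1 - x = 1); last by ring.
  by rewrite expr1n mulr1; exact: le_trans.
have cv : h^-1 *: ((g \o shift x) (h *: (1 : K)) - g x) @[h --> 0^'] --> l.
  apply/cvgrPdist_le => eps eps0; near=> h.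
  have h0 : h != 0 by near: h; exact: nbhs_dnbhs_neq.
  rewrite /= /GRing.scale /= mulr1.
  have := gC (h + x); rewrite addrK => hq.
  rewrite (_ : l - _ = - h^-1 * (g (h + x) - g x - h * l)); last first.
    by field.
  rewrite normrM normrN normfV ler_pdivrMl ?normr_gt0//.
  apply: (le_trans hq); rewrite -real_normK ?num_real// expr2 mulrA.
  rewrite mulrC ler_wpM2l// (@le_trans _ _ ((C + 1) * `|h|))//.
    by rewrite ler_wpM2r// lerDl.
  rewrite mulrC -ler_pdivlMr; last by lra.
  near: h; apply: dnbhs0_le; rewrite divr_gt0//; lra.
apply: DeriveDef; first by apply/cvg_ex; exists l.
exact: cvg_lim cv.
Unshelve. all: by end_near. Qed.

Lemma lip_of_derive (K : realType) (g g' : K -> K) (M u v : K) :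
  (forall x : K, is_derive x 1 g (g' x)) -> (forall x, `|g' x| <= M) ->
  `|g v - g u| <= M * `|v - u|.
Proof.
move=> dg gM; wlog uv : u v / u <= v => [hw|].
  have [uv|/ltW uv] := leP u v; first exact: hw.
  by rewrite distrC (distrC v); exact: hw.
have cont : {within `[u, v], continuous g}.
  apply: continuous_subspaceT => y; apply: differentiable_continuous.
  by apply/derivable1_diffP; have [] := dg y.
have [c _ ->] := MVT_segment uv (fun y _ => dg y) cont.
by rewrite normrM ler_wpM2r.
Qed.

Lemma sin_lip (K : realType) (u v : K) : `|sin v - sin u| <= `|v - u|.
Proof.
rewrite -[leRHS]mul1r; apply: (lip_of_derive (g' := cos)) => x.
exact: cos_max.
Qed.

Lemma cos_lip (K : realType) (u v : K) : `|cos v - cos u| <= `|v - u|.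
Proof.
rewrite -[leRHS]mul1r; apply: (lip_of_derive (g' := fun x => - sin x)) => x.
by rewrite normrN sin_max.
Qed.

Lemma sin_quadratic (K : realType) (u v : K) :
  `|sin v - sin u - (v - u) * cos u| <= (v - u) ^+ 2.
Proof.
have cont x y : {within `[x, y], continuous (@sin K)}.
  by apply: continuous_subspaceT => z; exact: continuous_sin.
have [c cuv ->] : exists2 c, `|c - u| <= `|v - u| &
    sin v - sin u = (v - u) * cos c.
  have [uv|/ltW uv] := leP u v.
    have [c /[!in_itv]/= /andP[c1 c2] E] :=
      MVT_segment uv (fun y _ => is_derive_sin y) (cont u v).
    exists c; last by rewrite E mulrC.
    by rewrite !ger0_norm ?subr_ge0// lerD2r.
  have [c /[!in_itv]/= /andP[c1 c2] E] :=
    MVT_segment uv (fun y _ => is_derive_sin y) (cont v u).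
  exists c; last by rewrite -[LHS]opprB E; ring.
  by rewrite !ler0_norm ?subr_le0// lerN2 lerD2r.
rewrite -mulrBr normrM -[leRHS]real_normK ?num_real// expr2 ler_wpM2l//.
by rewrite (le_trans (cos_lip _ _)).
Qed.

Section TrigIntegrals.
Context {K : realType}.
Variables (mu : {finite_measure set (measurableTypeR K) -> \bar K}) (a b : K).
Hypothesis a0 : 0 < a.
Local Notation D := (`[a, b]%classic : set K).
Local Notation mass := (fine (mu D)).

(** The phase treats real and imaginary parts of the transform alike: [theta = - (pi / 2)] gives the
    sine transform. *)
Definition cosI (theta : K) (k : K -> K) (t : K) : K :=
  \int[mu]_(r in D) (cos (t * r + theta) * k r).

(** The antiderivative of [cosI] in [t]. The division by [r] enters here and is harmless as
    [0 < a]. *)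
Definition sinI (theta : K) (k : K -> K) (t : K) : K :=
  \int[mu]_(r in D) (sin (t * r + theta) / r * k r).

Let mD : measurable (D : set (measurableTypeR K)). Proof. exact: measurable_itv. Qed.

Let Doo : (mu D < +oo)%E. Proof. exact: finite_measure_lty. Qed.

Lemma measurable_cos_affine t theta :
  measurable_fun setT (fun r : K => cos (t * r + theta)).
Proof.
apply: (measurableT_comp (continuous_measurable_fun (@continuous_cos K))).
by apply: measurable_funD => //; exact: measurable_funM.
Qed.

Lemma measurable_sin_affine t theta :
  measurable_fun setT (fun r : K => sin (t * r + theta)).
Proof.
apply: (measurableT_comp (continuous_measurable_fun (@continuous_sin K))).
by apply: measurable_funD => //; exact: measurable_funM.
Qed.

Lemma measurable_inv_itv : measurable_fun D (fun r : K => r^-1).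
Proof.
apply: subspace_continuous_measurable_fun => //.
apply: continuous_in_subspaceT => r; rewrite inE /= in_itv/= => /andP[ar _].
by apply: inv_continuous; rewrite gt_eqF// (lt_le_trans a0).
Qed.

Variable k : K -> K.
Hypothesis mk : measurable_fun setT k.
Hypothesis k1 : forall r, `|k r| <= 1.

Lemma cosI_integrable theta t :
  mu.-integrable D (EFin \o (fun r => cos (t * r + theta) * k r)).
Proof.
apply: (integrable_bounded (M := 1)) => //.
  by apply: measurable_funTS; apply: measurable_funM => //; exact: measurable_cos_affine.
move=> r _; rewrite normrM -[leRHS]mulr1; apply: ler_pM => //; exact: cos_max.
Qed.

Lemma sinI_integrable theta t :
  mu.-integrable D (EFin \o (fun r => sin (t * r + theta) / r * k r)).
Proof.
apply: (integrable_bounded (M := a^-1)) => //.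
  apply: measurable_funM; last exact: measurable_funTS.
  apply: measurable_funM; last exact: measurable_inv_itv.
  by apply: measurable_funTS; exact: measurable_sin_affine.
move=> r /=; rewrite in_itv/= => /andP[ar _]; have r0 := lt_le_trans a0 ar.
rewrite !normrM -[leRHS]mulr1; apply: ler_pM => //; rewrite -[leRHS]mul1r.
apply: ler_pM => //; first exact: sin_max.
by rewrite gtr0_norm ?invr_gt0// lef_pV2.
Qed.

Lemma cosI_bound theta t : `|cosI theta k t| <= mass.
Proof.
rewrite -[leRHS]mul1r; apply: normr_Rintegral_le => //.
  by apply: measurable_funTS; apply: measurable_funM => //; exact: measurable_cos_affine.
move=> r _; rewrite normrM -[leRHS]mulr1; apply: ler_pM => //; exact: cos_max.
Qed.

Lemma cosI_lip theta t u : 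
  `|cosI theta k t - cosI theta k u| <= b * mass * `|t - u|.
Proof.
rewrite /cosI -RintegralB; [|exact: mD|exact: cosI_integrable|exact: cosI_integrable].
rewrite mulrAC; apply: normr_Rintegral_le => //.
  apply: measurable_funTS; apply: measurable_funB; apply: measurable_funM => //;
  exact: measurable_cos_affine.
move=> r /=; rewrite in_itv/= => /andP[ar rb]; have r0 := lt_le_trans a0 ar.
rewrite -mulrBl normrM -[leRHS]mulr1; apply: ler_pM => //.
apply: (le_trans (cos_lip _ _)).
rewrite (_ : _ - _ = (t - u) * r); last by ring.
by rewrite normrM (gtr0_norm r0) mulrC ler_wpM2r.
Qed.

Lemma is_derive_sinI theta (t : K) : is_derive t 1 (sinI theta k) (cosI theta k t).
Proof.
apply: (is_derive_quadratic (C := b * mass)) => u.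
rewrite /sinI /cosI -RintegralZl; [|exact: mD|exact: cosI_integrable].
rewrite -RintegralB; [|exact: mD|exact: sinI_integrable|exact: sinI_integrable].
have i1 : mu.-integrable D (EFin \o (fun r =>
    sin (u * r + theta) / r * k r - sin (t * r + theta) / r * k r)).
  exact: (integrableB mD (sinI_integrable theta u) (sinI_integrable theta t)).
have i2 : mu.-integrable D (EFin \o (fun r =>
    (u - t) * (cos (t * r + theta) * k r))).
  exact: (integrableZl mD (u - t) (cosI_integrable theta t)).
rewrite -RintegralB//.
rewrite mulrAC; apply: normr_Rintegral_le => //.
  by apply: measurable_funB; apply/measurable_EFinP; [exact: measurable_int i1|exact: measurable_int i2].
move=> r /=; rewrite in_itv/= => /andP[ar rb]; have r0 := lt_le_trans a0 ar.
rewrite (_ : _ - _ = (sin (u * r + theta) - sin (t * r + theta) -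
   ((u * r + theta) - (t * r + theta)) * cos (t * r + theta)) / r * k r); last first.
  by field; rewrite gt_eqF.
rewrite normrM -[leRHS]mulr1; apply: ler_pM => //.
rewrite normrM normfV (gtr0_norm r0) ler_pdivrMr//.
apply: (le_trans (sin_quadratic _ _)).
rewrite (_ : _ - _ = (u - t) * r); last by ring.
rewrite exprMn mulrC [in leRHS]mulrAC ler_wpM2r ?sqr_ge0// expr2.
by rewrite ler_wpM2r// ltW.
Qed.

End TrigIntegrals.

Section WeightedDecay.
Context {K : realType}.
Variables (mu : {finite_measure set (measurableTypeR K) -> \bar K}) (a b : K).
Hypothesis a0 : 0 < a.
Hypothesis ab : a <= b.
Local Notation D := (`[a, b]%classic : set K).
Local Notation mass := (fine (mu D)).
Variables (A s : K).
Hypothesis A0 : 0 <= A.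
Hypothesis s01 : 0 <= s <= 1.
Hypothesis mu_decay : forall theta x, 2^-1 <= x ->
  `|cosI mu a b theta (fun=> 1) x| <= A * x `^ (- (s / 2)).

(* On [`[a, b]] the weight is bounded below, and multiplying by it costs no
   decay: [sin (x * r + theta) / r * sin (wfreq * r)] is the integral over
   [`[0, wfreq]] of [sin (x * r + theta) * cos (t * r)] in [t], a combination of
   frequencies within [1 / 2] of [x]. *)
Definition wfreq : K := (2 * (1 + b))^-1.
Definition weight (r : K) : K := sin (wfreq * r).

Let b0 : 0 < b. Proof. exact: lt_le_trans ab. Qed.

Lemma wfreq_gt0 : 0 < wfreq.
Proof. by rewrite invr_gt0 mulr_gt0// addr_gt0. Qed.

Lemma wfreq_le : wfreq <= 2^-1.
Proof. by rewrite lef_pV2 ?posrE ?mulr_gt0 ?addr_gt0// ler_peMr// lerDl ltW. Qed.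

(** On [[a, b]] the argument of the weight stays where the sine is positive and increasing, so the
    weight is at least its value at [a] and the weighted measure is non-zero. *)
Lemma wfreq_itv r : a <= r <= b -> 0 < wfreq * r <= 2^-1.
Proof.
move=> /andP[ar rb]; have r0 : 0 < r by exact: lt_le_trans ar.
rewrite mulr_gt0 ?wfreq_gt0//= /wfreq mulrC ler_pdivrMr ?mulr_gt0 ?addr_gt0//.
by rewrite mulrA mulVf// mul1r (le_trans rb)// lerDr.
Qed.

Lemma measurable_weight : measurable_fun setT weight.
Proof.
by have := measurable_sin_affine wfreq 0; under eq_fun do rewrite addr0.
Qed.

Lemma weight_le1 r : `|weight r| <= 1. Proof. exact: sin_max. Qed.

Let one_le1 (r : K) : `|1 : K| <= 1. Proof. by rewrite normr1. Qed.

(** A shift by at most 1/2 keeps x >= 1 above x / 2, and 2^(s/2) <= 2. This is why decay is assumed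
    from 1/2 on. *)
Lemma decay_shift theta x t : 1 <= x -> `|t| <= 2^-1 ->
  `|cosI mu a b theta (fun=> 1) (x + t)| <= 2 * A * x `^ (- (s / 2)).
Proof.
move=> x1; rewrite ler_norml => /andP[t1 t2].
have xt : x / 2 <= x + t by lra.
apply: (le_trans (mu_decay _ _)); first lra.
rewrite [2 * A]mulrC -mulrA ler_wpM2l//.
have /andP[s_ge0 s_le1] := s01.
have s0 : 0 <= s / 2 by lra.
apply: (@le_trans _ _ ((x / 2) `^ (- (s / 2)))); first by apply: ler_powRN => //; lra.
rewrite !powRN powRM; [|lra|lra].
rewrite invfM mulrC ler_wpM2r ?invr_ge0 ?powR_ge0//.
have half_powR r : (2^-1 : K) `^ r = 2 `^ (- r).
  by rewrite -mulN1r powRrM powR_inv1.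
rewrite -powRN half_powR opprK -[leRHS]powRr1//.
by apply: ler_powR; [rewrite ler1n|lra].
Qed.

Lemma cosI_one_integrable theta x :
  mu.-integrable D (EFin \o (fun r => cos (x * r + theta) * 1)).
Proof. by apply: cosI_integrable => // r; rewrite normr1. Qed.

(** Product to sum: the weight replaces the frequency [x] by [x + wfreq] and [x - wfreq], and the
    phase by [theta - pi / 2]. *)
Lemma cosI_weight_decay theta x : 1 <= x ->
  `|cosI mu a b theta weight x| <= 2 * A * x `^ (- (s / 2)).
Proof.
move=> x1; have c0 := wfreq_gt0; have c1 := wfreq_le.
have -> : cosI mu a b theta weight x =
    2^-1 * (cosI mu a b (theta - pi / 2) (fun=> 1) (x + wfreq) -
            cosI mu a b (theta - pi / 2) (fun=> 1) (x - wfreq)).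
  rewrite /cosI -RintegralB//; [|exact: cosI_one_integrable..].
  rewrite -RintegralZl//; last first.
    exact: (integrableB _ (cosI_one_integrable _ _) (cosI_one_integrable _ _)).
  apply: eq_Rintegral => r _; rewrite /weight !mulr1.
  rewrite !addrA !cosBpihalf mulrDl mulrBl.
  rewrite (_ : x * r + wfreq * r + theta = (x * r + theta) + wfreq * r); last by ring.
  rewrite (_ : x * r - wfreq * r + theta = (x * r + theta) - wfreq * r); last by ring.
  by rewrite sinD sinB; field.
have h1 := @decay_shift (theta - pi / 2) x wfreq x1.
have h2 := @decay_shift (theta - pi / 2) x (- wfreq) x1.
rewrite normrN gtr0_norm// in h1 h2; have {}h1 := h1 c1; have {}h2 := h2 c1.
rewrite normrM gtr0_norm ?invr_gt0// mulrC ler_pdivrMr//.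
by apply: (le_trans (ler_normB _ _)); lra.
Qed.

Lemma sinI_weight_decay theta x : 1 <= x ->
  `|sinI mu a b theta weight x| <= 2 * A * x `^ (- (s / 2)).
Proof.
move=> x1; have c0 := wfreq_gt0; have c1 := wfreq_le.
pose k r := sin (x * r + theta).
have mk : measurable_fun setT k by exact: measurable_sin_affine.
have k1 r : `|k r| <= 1 by exact: sin_max.
(* The roles are exchanged: the weight over [r] becomes the kernel of [sinI], at frequency [wfreq],
   and the oscillation at [x] becomes the weight. As a function of its frequency the new integral
   vanishes at 0, so the mean value theorem bounds it through its derivative [cosI]. *)
have -> : sinI mu a b theta weight x = sinI mu a b 0 k wfreq.
  by apply: eq_Rintegral => r _; rewrite /weight /k addr0; ring.
have U0 : sinI mu a b 0 k 0 = 0.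
  rewrite /sinI; under eq_Rintegral do rewrite mul0r addr0 sin0 !mul0r.
  by rewrite Rintegral_cst// mul0r.
have V t : `|t| <= 2^-1 -> `|cosI mu a b 0 k t| <= 2 * A * x `^ (- (s / 2)).
  move=> t1.
  have -> : cosI mu a b 0 k t =
      2^-1 * (cosI mu a b (theta - pi / 2) (fun=> 1) (x + t) +
              cosI mu a b (theta - pi / 2) (fun=> 1) (x - t)).
    rewrite /cosI -RintegralD//; [|exact: cosI_one_integrable..].
    rewrite -RintegralZl//; last first.
      exact: (integrableD _ (cosI_one_integrable _ _) (cosI_one_integrable _ _)).
    apply: eq_Rintegral => r _; rewrite /k !mulr1.
    rewrite !addrA !cosBpihalf mulrDl mulrBl addr0.
    rewrite (_ : x * r + t * r + theta = (x * r + theta) + t * r); last by ring.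
    rewrite (_ : x * r - t * r + theta = (x * r + theta) - t * r); last by ring.
    by set u := x * r + theta; rewrite (sinD u) (sinB u); field.
  have h1 := @decay_shift (theta - pi / 2) x t x1 t1.
  have h2 := @decay_shift (theta - pi / 2) x (- t) x1.
  rewrite normrN in h2; have {}h2 := h2 t1.
  rewrite normrM gtr0_norm ?invr_gt0// mulrC ler_pdivrMr//.
  by apply: (le_trans (ler_normD _ _)); lra.
have cont : {within `[0, wfreq], continuous (sinI mu a b 0 k)}.
  apply: continuous_subspaceT => y; apply: differentiable_continuous.
  by apply/derivable1_diffP; have [] := is_derive_sinI mu b a0 mk k1 0 y.
have [t + E] := MVT_segment (ltW c0)
  (fun t _ => is_derive_sinI mu b a0 mk k1 0 t) cont.
rewrite in_itv/= => /andP[t0 t1].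
have -> : sinI mu a b 0 k wfreq = cosI mu a b 0 k t * wfreq.
  by move: E; rewrite U0 !subr0.
rewrite normrM (gtr0_norm c0) -[leRHS]mulr1; apply: ler_pM => //; [exact: ltW| |lra].
by apply: V; rewrite ger0_norm//; lra.
Qed.

Lemma weighted_measure_exists : mu (~` D) = 0%E -> mu setT != 0%E ->
  exists nu : {finite_measure set (measurableTypeR K) -> \bar K},
  [/\ (forall S : set K, measurable S -> mu S = 0%E -> nu S = 0%E),
      nu setT != 0%E &
      (forall theta y x, \int[nu]_r cos (x * (r * y) + theta) =
         cosI mu a b theta weight (y * x))].
Proof.
move=> muD mu0.
have mD : measurable D by exact: measurable_itv.
(* The cut-off outside [[a, b]] ensures values in [[0, 1]], as [weighted_exists] requires. *)
pose w r := if a <= r <= b then weight r else 0.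
have wE : w = weight \_ D.
  apply/funext => r; rewrite patchE /w; have [h|h] := boolP (a <= r <= b).
    by rewrite mem_set//= in_itv.
  by rewrite memNset//= in_itv/=; exact/negP.
have mw : measurable_fun setT w.
  rewrite wE; apply/(measurable_restrictT _ mD); apply: measurable_funTS.
  exact: measurable_weight.
have w01 r : 0 <= w r <= 1.
  rewrite /w; case: ifP => [/wfreq_itv/andP[h1 h2]|_]; last by rewrite lexx ler01.
  by rewrite sin_le1 andbT ltW// sin_gt0_pi// h1/= (le_lt_trans h2)//;
    have := pi_ge2 K; lra.
have [nu [nu0 nuI]] := weighted_exists mu mw w01.
have nuD (g : K -> K) (M : K) : measurable_fun setT g -> (forall x, `|g x| <= M) ->
    \int[nu]_x g x = \int[mu]_(x in D) (weight x * g x).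
  move=> mg gM; rewrite (nuI _ M mg gM) [RHS]Rintegral_mkcond.
  by apply: eq_Rintegral => x _; rewrite wE !patchE; case: ifP => _ //; rewrite mul0r.
exists nu; split=> //.
  apply/eqP => nuT.
  have m1 : measurable_fun setT (fun _ : K => 1 : K) by exact: measurable_cst.
  have := nuD (fun=> 1) 1 m1 one_le1.
  rewrite Rintegral_cst// [X in fine X]nuT /= mulr0 => /esym; apply/eqP; rewrite gt_eqF//.
  have mass0 : 0 < mass.
    rewrite fine_gt0// finite_measure_lty// andbT lt0e measure_ge0 andbT.
    apply: contra_neq mu0 => muD0; apply/eqP; rewrite eq_le measure_ge0 andbT.
    rewrite -(setvU D); apply: (le_trans (measureU2 _ _ _)) => //.
      exact: measurableC.
    by rewrite [X in (X + _)%E]muD [X in (_ + X)%E]muD0 adde0.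
  apply: (@lt_le_trans _ _ (sin (wfreq * a) * mass)).
    have aab : a <= a <= b by rewrite lexx.
    have /andP[h1 h2] := wfreq_itv aab; have p2 := pi_ge2 K.
    by rewrite mulr_gt0// sin_gt0_pi// h1/=; lra.
  rewrite -Rintegral_cst//; apply: le_Rintegral => //.
  - by apply: (integrable_bounded (M := 1)) => //;
      [exact: finite_measure_lty|move=> ? _; exact: sin_max].
  - apply: (integrable_bounded (M := 1)) => //; first exact: finite_measure_lty.
      apply: measurable_funTS; apply: measurable_funM => //; exact: measurable_weight.
    by move=> r _; rewrite mulr1 weight_le1.
  move=> r /=; rewrite in_itv/= => /andP[ar rb]; rewrite mulr1 /weight.
  have aab : a <= a <= b by rewrite lexx.
  have arb : a <= r <= b by rewrite ar.
  have /andP[h1 h2] := wfreq_itv aab; have /andP[h3 h4] := wfreq_itv arb.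
  have p2 := pihalf_ge1 K.
  have [|rlt] := leP r a; first by move=> ra; rewrite (@le_anti _ _ r a) ?ra.
  rewrite ltW// ltr_sin ?ltr_pM2l ?wfreq_gt0// in_itv/=; apply/andP; split; lra.
move=> theta y x; rewrite (nuD _ 1).
- apply: eq_Rintegral => r _; rewrite mulrC; congr (cos _ * _); ring.
- have := measurable_cos_affine (x * y) theta.
  by under [in X in X -> _]eq_fun do rewrite -mulrA [y * _]mulrC.
- by move=> r; exact: cos_max.
Qed.

End WeightedDecay.

Lemma compact_mulset (K : realType) (A B : set K) :
  compact A -> compact B -> compact (mulset A B).
Proof.
move=> cA cB.
have -> : mulset A B = (fun z : K * K => z.1 * z.2) @` (A `*` B).
  apply/seteqP; split => [_ [x Ax [y By <-]]|_ [[x y] [/= Ax By] <-]].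
    by exists (x, y).
  by exists x => //; exists y.
apply: continuous_compact; last exact: compact_setX.
apply: continuous_subspaceT => z.
by apply: continuousM; [exact: cvg_fst|exact: cvg_snd].
Qed.

(** * Multiplying the Cantor set by a family of measures *)

Section Family.
Context {K : realType}.
Variables (alpha : K) (mu : nat -> {finite_measure set (measurableTypeR K) -> \bar K}).
Variables (a b A s : nat -> K).
Hypothesis alpha01 : 0 <= alpha <= 1.
Hypothesis a0 : forall n, 0 < a n.
Hypothesis ab : forall n, a n <= b n.
Hypothesis A0 : forall n, 0 <= A n.
Hypothesis s0 : forall n, 0 <= s n.
Hypothesis s_le : forall n, s n + alpha <= 1.
Hypothesis mu_decay : forall n theta x, 2^-1 <= x ->
  `|cosI (mu n) (a n) (b n) theta (fun=> 1) x| <= A n * x `^ (- (s n / 2)).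
Hypothesis mu_itv : forall n, mu n (~` `[a n, b n]) = 0%E.
Hypothesis mu_neq0 : forall n, mu n setT != 0%E.

Lemma cantor_family_decay : exists e, forall n,
  exists nu : {finite_measure set (measurableTypeR K) -> \bar K},
  [/\ (forall S : set K, compact S -> mu n (~` S) = 0%E ->
         nu (~` mulset S (cantor_set alpha e)) = 0%E),
      nu setT != 0%E &
      forall d, 0 < d -> d <= alpha / 2 -> exists D : K, forall x, 1 <= x ->
        `|\int[nu]_r cos (x * r)| <= D * x `^ (- ((s n + alpha) / 2) + d) /\
        `|\int[nu]_r sin (x * r)| <= D * x `^ (- ((s n + alpha) / 2) + d)].
Proof.
(* Index 2n carries the cosine transform of member [n], index 2n + 1 its sine transform. *)
pose theta (j : nat) : K := if odd j then - (pi / 2) else 0.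
pose f (j : nat) := cosI (mu j./2) (a j./2) (b j./2) (theta j) (weight (b j./2)).
pose phi (j : nat) := sinI (mu j./2) (a j./2) (b j./2) (theta j) (weight (b j./2)).
pose mass n : K := fine (mu n (`[a n, b n]%classic : set K)).
(* One constant for all bounds: 2A for the decay, b times the mass for the Lipschitz bound, the mass
   for the size, and 1 for positivity. *)
pose C (j : nat) := 2 * A j./2 + (1 + b j./2) * mass j./2 + 1.
have b0 n : 0 < b n by exact: lt_le_trans (a0 n) (ab n).
have m0 n : 0 <= mass n by rewrite fine_ge0.
have bm0 n : 0 <= b n * mass n by rewrite mulr_ge0// ltW.
have s01 n : 0 <= s n <= 1.
  by have /andP[? ?] := alpha01; have := s_le n; rewrite s0 /=; lra.
have mw n : measurable_fun setT (weight (b n)) by exact: measurable_weight.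
have w1 n r : `|weight (b n) r| <= 1 by exact: weight_le1.
have CA j : 2 * A j./2 <= C j.
  by rewrite /C; have := m0 j./2; have := bm0 j./2; lra.
have f_decay j x : 1 <= x -> `|f j x| <= C j * x `^ (- (s j./2 / 2)).
  move=> x1; apply: (@le_trans _ _ (2 * A j./2 * x `^ (- (s j./2 / 2)))).
    by apply: cosI_weight_decay => // *; exact: mu_decay.
  by rewrite ler_wpM2r ?powR_ge0.
have phi_decay j x : 1 <= x -> `|phi j x| <= C j * x `^ (- (s j./2 / 2)).
  move=> x1; apply: (@le_trans _ _ (2 * A j./2 * x `^ (- (s j./2 / 2)))).
    by apply: sinI_weight_decay => // *; exact: mu_decay.
  by rewrite ler_wpM2r ?powR_ge0.
have f_lip j x y : `|f j x - f j y| <= C j * `|x - y|.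
  apply: (@le_trans _ _ (b j./2 * mass j./2 * `|x - y|)); first exact: cosI_lip.
  by rewrite ler_wpM2r// /C; have := m0 j./2; have := A0 j./2; lra.
have f_bound j x : `|f j x| <= C j.
  apply: (@le_trans _ _ (mass j./2)); first exact: cosI_bound.
  by rewrite /C; have := A0 j./2; have := bm0 j./2; lra.
have C0 j : 0 < C j.
  by rewrite /C; have := m0 j./2; have := bm0 j./2; have := A0 j./2; lra.
have dphi j (x : K) : is_derive x 1 (phi j) (f j x) by exact: is_derive_sinI.
have f_meas j : measurable_fun setT (f j).
  apply: continuous_measurable_fun => x; apply/cvgrPdist_le => eps eps0.
  apply/nbhs_ballP; exists (eps / C j) => /=; first exact: divr_gt0.
  move=> y /= xy; apply: (le_trans (f_lip j x y)).
  by rewrite mulrC -ler_pdivlMr//; exact: ltW.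
have [e he] := @cantor_decay K alpha f phi (fun j => s j./2) C alpha01 dphi f_decay
  phi_decay f_lip f_bound f_meas C0 (fun j => s0 j./2) (fun j => s_le j./2).
exists e => n.
have [sg [sg0 sgT sgI]] := weighted_measure_exists (a0 n) (ab n) (mu_itv n) (mu_neq0 n).
have [nu [nuE nuI]] := product_mixture_exists sg (measurable_cantor_map alpha e).
have intcos th x : \int[nu]_r cos (x * r + th) =
    \int[unit_lebesgue]_t cosI (mu n) (a n) (b n) th (weight (b n))
      (cantor_map alpha e t * x).
  rewrite (nuI _ 1); [|exact: measurable_cos_affine|move=> ?; exact: cos_max].
  by apply: eq_Rintegral => t _; rewrite sgI.
exists nu; split.
- move=> S cS muS.
  have cY : compact (mulset S (cantor_set alpha e)).
    by apply: compact_mulset => //; exact: cantor_set_compact.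
  have clY := compact_closed (@Rhausdorff K) cY.
  have mY : measurable (~` mulset S (cantor_set alpha e)).
    by apply: measurableC; exact: closed_measurable.
  have mS : measurable (~` S : set K).
    apply: measurableC; apply: closed_measurable.
    exact: compact_closed (@Rhausdorff K) cS.
  apply/eqP; rewrite eq_le measure_ge0 andbT nuE//.
  apply: (@le_trans _ _ ((sg \x unit_lebesgue)%E
      ((~` S `*` setT) `|` (setT `*` ~` `[0%R, 1%R[)))).
    apply: le_measure; rewrite ?inE.
    - rewrite -[X in measurable X]setTI.
      have mPsi : measurable_fun setT (fun z : measurableTypeR K * measurableTypeR K =>
          z.1 * cantor_map alpha e z.2 : measurableTypeR K).
        apply: measurable_funM => //; apply: measurableT_comp => //.
        exact: measurable_cantor_map.
      exact: mPsi.
    - apply: measurableU; apply: measurableX => //; exact: measurableC.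
    move=> [r t] /= nY; have [Sr|nS] := pselect (S r); last by left.
    right; split => // t01; apply: nY; exists r => //; exists (cantor_map alpha e t) => //.
    by apply: cantor_map_in; move: t01; rewrite /= in_itv.
  apply: (@le_trans _ _ ((sg \x unit_lebesgue)%E (~` S `*` setT) +
      (sg \x unit_lebesgue)%E (setT `*` ~` `[0%R, 1%R[))%E).
    apply: measureU2; first exact: measurableX.
    by apply: measurableX => //; exact: measurableC.
  rewrite !product_measure1E//; last exact: measurableC.
  rewrite [X in (X * _ + _)%E](sg0 _ mS muS) mul0e add0e.
  rewrite [X in (_ * X)%E](_ : _ = 0%E) ?mule0//.
  by rewrite /= /mfrestr /mrestr setICl measure0.
- rewrite nuE// (_ : [set z | _] = setT `*` setT); last by apply/seteqP; split.
  by rewrite product_measure1E// [X in (_ * X)%E]unit_lebesgue_setT mule1.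
move=> d d0 da.
have [D1 hD1] := he n.*2 d d0 da; have [D2 hD2] := he n.*2.+1 d d0 da.
exists (Num.max D1 D2) => x x1; split.
- have -> : \int[nu]_r cos (x * r) = \int[nu]_r cos (x * r + 0).
    by under [RHS]eq_Rintegral do rewrite addr0.
  rewrite intcos; have := hD1 x x1; rewrite /f /theta odd_double doubleK => h.
  by apply: (le_trans h); rewrite ler_wpM2r ?powR_ge0// le_max lexx.
- have -> : \int[nu]_r sin (x * r) = \int[nu]_r cos (x * r + - (pi / 2)).
    by under [RHS]eq_Rintegral do rewrite cosBpihalf.
  rewrite intcos; have := hD2 x x1.
  rewrite /f /theta /= odd_double uphalf_double /= => h.
  by apply: (le_trans h); rewrite ler_wpM2r ?powR_ge0// le_max lexx orbT.
Qed.

End Family.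

(** * Fourier dimension and trigonometric decay *)

Section Support.
Context {K : realType}.
Implicit Type mu : finite_borel_measure K.

Lemma closed_msupport mu : closed (msupport mu).
Proof.
rewrite /msupport closedC; apply: bigcup_open => U [].
by [].
Qed.

(** The union defining the complement of the support may be uncountable, but each of its points lies
    in a null interval with rational end points, and these are countably many. *)
Lemma msupportC_null mu : mu (~` msupport mu) = 0%E.
Proof.
pose F (n : nat) : set K := if @unpickle (rat * rat)%type n is Some pq then
  if mu (`]ratr pq.1, ratr pq.2[%classic : set K) == 0%E
  then `]ratr pq.1, ratr pq.2[%classic else set0 else set0.
have negF n : mu.-negligible (F n : set (measurableTypeR K)).
  rewrite /F; case: unpickle => [pq|]; last exact: negligible_set0.
  case: ifPn => [/eqP h|_]; last exact: negligible_set0.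
  by apply/negligibleP.
have mS : measurable (~` msupport mu : set K).
  by apply: measurableC; apply: closed_measurable; exact: closed_msupport.
apply/negligibleP => //; apply: negligibleS (negligible_bigcup negF).
rewrite /msupport setCK => x [U [oU muU] Ux].
have [eps /= eps0 xU] : nbhs_ball x U by apply/nbhs_ballP; exact: open_nbhs_nbhs.
have /rat_in_itvoo[p] : x - eps < x by rewrite ltrBlDr ltrDl.
have /rat_in_itvoo[q] : x < x + eps by rewrite ltrDl.
rewrite !in_itv/= => /andP[q1 q2] /andP[p1 p2].
have sub : `]ratr p, ratr q[%classic `<=` U.
  move=> y /=; rewrite in_itv/= => /andP[y1 y2]; apply: xU => /=.
  by rewrite /ball /= ltr_norml; lra.
exists (pickle (p, q)); first exact: I.
rewrite /F pickleK /= ifT/=; first by rewrite in_itv/= p2 q1.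
apply/eqP; apply/eqP; rewrite eq_le measure_ge0 andbT -muU.
apply: le_measure => //; rewrite inE//.
exact: open_measurable.
Qed.

Lemma supported_null mu (A : set K) : closed A -> supported_measures A mu ->
  mu (~` A) = 0%E.
Proof.
move=> cA [_ _ sA]; apply/eqP; rewrite eq_le measure_ge0 andbT.
rewrite -(msupportC_null mu); apply: le_measure; rewrite ?inE.
- by apply: measurableC; exact: closed_measurable.
- by apply: measurableC; apply: closed_measurable; exact: closed_msupport.
- exact: subsetC.
Qed.

Lemma null_supported mu (A : set K) : compact A -> mu (~` A) = 0%E ->
  mu setT != 0%E -> supported_measures A mu.
Proof.
move=> cA muA mu0.
have clA := compact_closed (@Rhausdorff K) cA.
have sA : msupport mu `<=` A.
  move=> x; apply: contraPP => nA; apply: contrapT => /contrapT; apply.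
  by exists (~` A) => //; split => //; exact: closed_openC.
split => //; first exact/eqP.
apply: (subclosed_compact _ cA sA); exact: closed_msupport.
Qed.

Lemma normc_fourier mu xi :
  ComplexField.Normc.normc (fourier mu xi) ^+ 2 =
  (\int[mu]_x cos (2 * pi * xi * x)) ^+ 2 + (\int[mu]_x sin (2 * pi * xi * x)) ^+ 2.
Proof.
rewrite /fourier /complex_integral /ComplexField.Normc.normc /=.
rewrite sqr_sqrtr; last by rewrite addr_ge0 ?sqr_ge0.
congr (_ ^+ 2 + _).
  by apply: eq_Rintegral => x _; rewrite cosN; congr cos; ring.
rewrite -[RHS]sqrrN; congr (_ ^+ 2).
have ms : mu.-integrable setT (EFin \o (fun x => sin (2 * pi * xi * x))).
  apply: (integrable_bounded (M := 1)) => //; first exact: finite_measure_lty.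
    by have := measurable_sin_affine (2 * pi * xi) 0; under eq_fun do rewrite addr0.
  by move=> ? _; exact: sin_max.
rewrite -[RHS]mulN1r -RintegralZl//; apply: eq_Rintegral => x _.
by rewrite sinN mulN1r; congr (- sin _); ring.
Qed.

(** Verbatim the condition inside [fourier_dim], so that [fourier_dimE] holds by conversion. *)
Definition fourier_decay mu (s : K) : Prop :=
  (ereal_sup [set (ComplexField.Normc.normc (fourier mu xi) ^+ 2
     * `|xi| `^ s)%:E | xi in [set: K]] < +oo)%E.

(** The change to angular frequency x = 2 pi xi gives (2 pi)^(s/2); the factor 2 in [A] pays for the
    phase, through the addition formula. *)
Lemma fourier_decay_trig mu s : 0 <= s <= 1 -> fourier_decay mu s ->
  exists2 A : K, 0 <= A & forall theta x, 2^-1 <= x ->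
    `|\int[mu]_r cos (x * r + theta)| <= A * x `^ (- (s / 2)).
Proof.
move=> /andP[s0 s1]; rewrite /fourier_decay => supoo.
pose S := ereal_sup [set (ComplexField.Normc.normc (fourier mu xi) ^+ 2
     * `|xi| `^ s)%:E | xi in [set: K]].
have [B hB] : exists B : K, forall xi,
    ComplexField.Normc.normc (fourier mu xi) ^+ 2 * `|xi| `^ s <= B.
  have ub xi : ((ComplexField.Normc.normc (fourier mu xi) ^+ 2
     * `|xi| `^ s)%:E <= S)%E by apply: ereal_sup_ubound; exists xi.
  move: ub supoo; rewrite -/S; case: S => [r| |] ub // _.
    by exists r => xi; have := ub xi; rewrite lee_fin.
  by exists 0 => xi; have := ub xi.
have B0 : 0 <= B.
  by apply: (le_trans _ (hB 1)); rewrite mulr_ge0 ?sqr_ge0 ?powR_ge0.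
pose A := 2 * Num.sqrt B * (2 * pi) `^ (s / 2).
have pi0 := pi_gt0 K.
have p0 : 0 < 2 * pi :> K by rewrite mulr_gt0.
exists A; first by rewrite !mulr_ge0 ?sqrtr_ge0 ?powR_ge0.
move=> theta x x1; have x0 : 0 < x by lra.
pose Ic := \int[mu]_r cos (x * r); pose Is := \int[mu]_r sin (x * r).
have icos : mu.-integrable setT (EFin \o (fun r => cos (x * r))).
  apply: (integrable_bounded (M := 1)) => //; first exact: finite_measure_lty.
    by have := measurable_cos_affine x 0; under eq_fun do rewrite addr0.
  by move=> ? _; exact: cos_max.
have isin : mu.-integrable setT (EFin \o (fun r => sin (x * r))).
  apply: (integrable_bounded (M := 1)) => //; first exact: finite_measure_lty.
    by have := measurable_sin_affine x 0; under eq_fun do rewrite addr0.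
  by move=> ? _; exact: sin_max.
have E : \int[mu]_r cos (x * r + theta) = cos theta * Ic - sin theta * Is.
  rewrite /Ic /Is -!RintegralZl// -RintegralB//.
  - by apply: eq_Rintegral => r _; rewrite cosD; ring.
  - exact: (integrableZl _ (cos theta) icos).
  - exact: (integrableZl _ (sin theta) isin).
have key : Ic ^+ 2 + Is ^+ 2 <= (Num.sqrt B * (2 * pi) `^ (s / 2) * x `^ (- (s / 2))) ^+ 2.
  have := hB (x / (2 * pi)); rewrite normc_fourier.
  rewrite (_ : 2 * pi * (x / (2 * pi)) = x); last by field; lra.
  rewrite -/Ic -/Is gtr0_norm ?divr_gt0//.
  rewrite (@powRM _ x (2 * pi)^-1) ?invr_ge0 ?(ltW x0) ?(ltW p0)// => h.
  have q1 : (2 * pi)^-1 `^ s = ((2 * pi) `^ s)^-1.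
    by rewrite -powRN -mulN1r powRrM powR_inv1// ltW.
  have q2 : (2 * pi) `^ s = ((2 * pi) `^ (s / 2)) ^+ 2.
    by rewrite expr2 -powRD ?(gt_eqF p0) ?implybT//; congr powR; field.
  have q3 : x `^ s * (x `^ (- (s / 2))) ^+ 2 = 1.
    rewrite expr2 -!powRD ?(gt_eqF x0) ?implybT//.
    by rewrite (_ : _ + _ = 0) ?powRr0//; field.
  rewrite !exprMn sqr_sqrtr// -q2.
  rewrite q1 in h.
  have w0 : 0 < (2 * pi) `^ s by exact: powR_gt0.
  have -> : Ic ^+ 2 + Is ^+ 2 =
      (Ic ^+ 2 + Is ^+ 2) * x `^ s * (x `^ (- (s / 2))) ^+ 2.
    by rewrite -mulrA q3 mulr1.
  rewrite ler_wpM2r ?sqr_ge0//.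
  by move: h; rewrite mulrA ler_pdivrMr.
set W := Num.sqrt B * _ * _ in key.
have W0 : 0 <= W by rewrite !mulr_ge0 ?sqrtr_ge0 ?powR_ge0.
have hc : `|Ic| <= W.
  rewrite -(ler_pXn2r (n := 2))// ?nnegrE//.
  by rewrite real_normK ?num_real// (le_trans _ key)// lerDl sqr_ge0.
have hs : `|Is| <= W.
  rewrite -(ler_pXn2r (n := 2))// ?nnegrE//.
  by rewrite real_normK ?num_real// (le_trans _ key)// lerDr sqr_ge0.
rewrite E (_ : A * _ = W + W); last by rewrite /A /W; ring.
apply: (le_trans (ler_normB _ _)); rewrite !normrM; apply: lerD.
- by rewrite -[leRHS]mul1r; apply: ler_pM => //; exact: cos_max.
- by rewrite -[leRHS]mul1r; apply: ler_pM => //; exact: sin_max.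
Qed.

(** For |xi| < 1 the total mass suffices; otherwise x = 2 pi xi has |x| >= |xi|, and parity settles
    negative x. *)
Lemma trig_fourier_decay mu (t D : K) : 0 < t -> 0 <= D ->
  (forall x, 1 <= x -> `|\int[mu]_r cos (x * r)| <= D * x `^ (- (t / 2)) /\
                       `|\int[mu]_r sin (x * r)| <= D * x `^ (- (t / 2))) ->
  fourier_decay mu t.
Proof.
move=> t0 D0 hD; rewrite /fourier_decay.
pose M := fine (mu setT).
have M0 : 0 <= M by rewrite fine_ge0.
have trig_mass x : `|\int[mu]_r cos (x * r)| <= M /\ `|\int[mu]_r sin (x * r)| <= M.
  rewrite /M -[X in _ <= X /\ _ <= X]mul1r; split; apply: normr_Rintegral_le => //.
  - exact: finite_measure_lty.
  - by have := measurable_cos_affine x 0; under eq_fun do rewrite addr0.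
  - by move=> ? _; exact: cos_max.
  - exact: finite_measure_lty.
  - by have := measurable_sin_affine x 0; under eq_fun do rewrite addr0.
  - by move=> ? _; exact: sin_max.
have pi2 := pi_ge2 K.
apply: (@le_lt_trans _ _ (2 * M ^+ 2 + 2 * D ^+ 2)%:E); last exact: ltry.
apply: ge_ereal_sup => _ [xi _ <-]; rewrite lee_fin normc_fourier.
set x := 2 * pi * xi.
have sq (u v : K) : `|u| <= v -> u ^+ 2 <= v ^+ 2.
  move=> uv; rewrite -[u ^+ 2]real_normK ?num_real// lerXn2r// nnegrE//.
  exact: le_trans uv.
have [xi1|xi1] := leP 1 `|xi|; last first.
  have [/sq h1 /sq h2] := trig_mass x.
  apply: (@le_trans _ _ (2 * M ^+ 2)); last by rewrite lerDl mulr_ge0// sqr_ge0.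
  have p1 : `|xi| `^ t <= 1.
    apply: (@le_trans _ _ (1 `^ t)); last by rewrite powR1.
    by apply: ge0_ler_powR; rewrite ?nnegrE//; exact: ltW.
  rewrite -[leRHS]mulr1; apply: ler_pM => //; rewrite ?powR_ge0 ?addr_ge0 ?sqr_ge0//.
  lra.
have {}hD : (\int[mu]_r cos (x * r)) ^+ 2 <= (D * `|x| `^ (- (t / 2))) ^+ 2 /\
    (\int[mu]_r sin (x * r)) ^+ 2 <= (D * `|x| `^ (- (t / 2))) ^+ 2.
  have x1 : 1 <= `|x| by rewrite /x normrM gtr0_norm; [nra|rewrite mulr_gt0 ?pi_gt0].
  have [/sq h1 /sq h2] := hD _ x1; move: h1 h2; case: (ger0P x) => _ h1 h2 //.
  split; first by move: h1; under eq_Rintegral do rewrite mulNr cosN.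
  move: h2; rewrite (_ : \int[mu]_r sin (- x * r) = - \int[mu]_r sin (x * r)).
    by rewrite sqrrN.
  have ms : mu.-integrable setT (EFin \o (fun r => sin (x * r))).
    apply: (integrable_bounded (M := 1)) => //; first exact: finite_measure_lty.
      by have := measurable_sin_affine x 0; under eq_fun do rewrite addr0.
    by move=> ? _; exact: sin_max.
  by rewrite -[RHS]mulN1r -RintegralZl//; apply: eq_Rintegral => r _; rewrite mulNr sinN mulN1r.
have [h1 h2] := hD.
have xi0 : 0 < `|xi| by lra.
have xix : `|xi| <= `|x|.
  rewrite /x normrM gtr0_norm; last by rewrite mulr_gt0 ?pi_gt0.
  nra.
have x0 : 0 < `|x| by exact: lt_le_trans xix.
have q : (D * `|x| `^ (- (t / 2))) ^+ 2 * `|xi| `^ t <= D ^+ 2.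
  rewrite exprMn -[leRHS]mulr1 -mulrA ler_wpM2l ?sqr_ge0//.
  rewrite expr2 -powRD ?(gt_eqF x0) ?implybT// (_ : _ + _ = - t); last by field.
  rewrite powRN mulrC ler_pdivrMr ?powR_gt0// mul1r.
  by apply: ge0_ler_powR; rewrite ?nnegrE// ltW.
set w := `|xi| `^ t in q *.
have w0 : 0 <= w by exact: powR_ge0.
rewrite mulrDl; have := ler_wpM2r w0 h1; have := ler_wpM2r w0 h2.
have := sqr_ge0 M; lra.
Qed.

End Support.

(** * Fourier dimension and covers *)

Section Fejer.
Context {K : realType}.

(** With truncated subtraction [(i - j) + (j - i)] is |i - j|. Enlarging the square by a row and a
    column adds one diagonal term and each positive distance twice. *)
Lemma sum_double_dist (g : nat -> K) N :
  \sum_(i < N) \sum_(j < N) g ((i - j) + (j - i))%N =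
  \sum_(n < N) (g 0%N + 2 * \sum_(h < n) g h.+1).
Proof.
elim: N => [|N ih]; first by rewrite !big_ord0.
rewrite !big_ord_recr /= subnn addn0.
under eq_bigr do rewrite big_ord_recr /=.
rewrite big_split /= ih -!addrA; congr (_ + _).
have -> : \sum_(i < N) g (i - N + (N - i))%N = \sum_(h < N) g h.+1.
  rewrite (reindex_inj rev_ord_inj) /=; apply: eq_bigr => i _; congr g.
  by have := ltn_ord i; lia.
have -> : \sum_(i < N) g (N - i + (i - N))%N = \sum_(h < N) g h.+1.
  rewrite (reindex_inj rev_ord_inj) /=; apply: eq_bigr => i _; congr g.
  by have := ltn_ord i; lia.
by ring.
Qed.

(** Dyadic blocks: each contributes at most 2^((1-s)k). Counting blocks instead of summing a
    geometric series keeps the bound uniform up to s = 1. *)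
Lemma sum_powRN_le (s : K) k : 0 <= s <= 1 ->
  \sum_(h < 2 ^ k) (h.+1%:R : K) `^ (- s) <= (k%:R + 1) * 2 `^ ((1 - s) * k%:R).
Proof.
move=> /andP[s0 s1]; elim: k => [|k ih].
  by rewrite expn0 big_ord1 mulr0 powRr0 powR1; lra.
have -> : (2 ^ k.+1 = 2 ^ k + 2 ^ k)%N by rewrite expnS; lia.
rewrite big_split_ord /=; apply: (@le_trans _ _ ((k%:R + 1) * 2 `^ ((1 - s) * k%:R) +
    2 `^ ((1 - s) * k%:R))).
  apply: lerD => //.
  apply: (@le_trans _ _ (\sum_(i < 2 ^ k) (2 : K) `^ (- s * k%:R))).
    have p2 : 0 < (2 : K) ^+ k by exact: exprn_gt0.
    apply: ler_sum => i _; rewrite [- s * _]mulrC powRrM powR_mulrn//.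
    by apply: ler_powRN => //; rewrite -natrX ler_nat /= leqW// leq_addr.
  rewrite sumr_const card_ord -[leLHS]mulr_natr natrX -powR_mulrn// -powRD; last first.
    by rewrite pnatr_eq0 implybT.
  by rewrite le_eqVlt; apply/orP; left; apply/eqP; congr powR; ring.
have -> : (k.+1%:R : K) = k%:R + 1 by rewrite natr1.
rewrite -{2}[2 `^ _]mul1r -mulrDl ler_wpM2l ?addr_ge0//.
by apply: ler_powR; [rewrite ler1n|have := ler0n K k; nra].
Qed.

(** The squared modulus of the sum of e^(i m t) over m < N, that is, N times the Fejer kernel. *)
Definition fejer (N : nat) (t : K) : K :=
  (\sum_(m < N) cos (m%:R * t)) ^+ 2 + (\sum_(m < N) sin (m%:R * t)) ^+ 2.

Lemma fejerE N t : fejer N t = \sum_(i < N) \sum_(j < N) cos ((i%:R - j%:R) * t).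
Proof.
rewrite /fejer !expr2 !big_distrl -big_split /=; apply: eq_bigr => i _.
rewrite !big_distrr -big_split /=; apply: eq_bigr => j _.
by rewrite mulrBl cosB.
Qed.

Lemma cos_ge_half (u : K) : `|u| <= 1 -> 2^-1 <= cos u.
Proof.
move=> u1.
have h : `|sin (u / 2)| <= 2^-1.
  have := sin_lip 0 (u / 2); rewrite sin0 !subr0 normrM [`|2^-1|]ger0_norm//.
  by move=> h; lra.
have -> : cos u = 1 - 2 * sin (u / 2) ^+ 2.
  rewrite [in LHS](_ : u = u / 2 + u / 2); last by field.
  by rewrite cosD -!expr2 cos2sin2; ring.
have : sin (u / 2) ^+ 2 <= 2^-1 ^+ 2.
  by rewrite -[leLHS]real_normK ?num_real// lerXn2r ?nnegrE.
lra.
Qed.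

Lemma fejer_ge N t : (0 < N)%N -> `|t| <= N%:R^-1 ->
  (N%:R / 2) ^+ 2 <= fejer N t.
Proof.
move=> N0 tN; have NR : 0 < N%:R :> K by rewrite ltr0n.
apply: (@le_trans _ _ ((\sum_(m < N) cos (m%:R * t)) ^+ 2)); last first.
  by rewrite lerDl sqr_ge0.
have h : N%:R / 2 <= \sum_(m < N) cos (m%:R * t).
  rewrite -[X in X%:R / 2]card_ord -sum1_card natr_sum mulr_suml.
  apply: ler_sum => m _; rewrite mul1r; apply: cos_ge_half.
  rewrite normrM ger0_norm// (le_trans (ler_wpM2l _ tN))// ler_pdivrMr// mul1r.
  by rewrite ler_nat ltnW.
by rewrite lerXn2r// nnegrE ?(le_trans _ h)// divr_ge0.
Qed.

Lemma fejer_ge0 N t : 0 <= fejer N t.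
Proof. by rewrite addr_ge0 ?sqr_ge0. Qed.

End Fejer.

Section FourierCover.
Context {K : realType}.
Implicit Type mu : finite_borel_measure K.

Definition cosT mu (x : K) := \int[mu]_r cos (x * r).
Definition sinT mu (x : K) := \int[mu]_r sin (x * r).

Lemma integrable_cosT mu x : mu.-integrable setT (EFin \o (fun r => cos (x * r))).
Proof.
apply: (integrable_bounded (M := 1)) => //; first exact: finite_measure_lty.
  by have := measurable_cos_affine x 0; under eq_fun do rewrite addr0.
by move=> ? _; exact: cos_max.
Qed.

Lemma integrable_sinT mu x : mu.-integrable setT (EFin \o (fun r => sin (x * r))).
Proof.
apply: (integrable_bounded (M := 1)) => //; first exact: finite_measure_lty.
  by have := measurable_sin_affine x 0; under eq_fun do rewrite addr0.
by move=> ? _; exact: sin_max.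
Qed.

Lemma Rintegral_sum d (T : measurableType d) (m : {measure set T -> \bar K})
    (I : Type) (r : seq I) (F : I -> T -> K) :
  (forall i, m.-integrable setT (EFin \o F i)) ->
  m.-integrable setT (EFin \o (fun x => \sum_(i <- r) F i x)) /\
  \int[m]_x (\sum_(i <- r) F i x) = \sum_(i <- r) \int[m]_x F i x.
Proof.
move=> Fi; elim: r => [|i r [ih1 ih2]].
  rewrite big_nil; under eq_Rintegral do rewrite big_nil.
  split; last by rewrite Rintegral_cst// mul0r.
  rewrite (_ : EFin \o _ = cst 0%E); first exact: integrable0.
  by apply/funext => x /=; rewrite big_nil.
have E : (fun x => \sum_(j <- i :: r) F j x) = (fun x => F i x + \sum_(j <- r) F j x).
  by apply/funext => x; rewrite big_cons.
rewrite E big_cons; split; first exact: (integrableD _ (Fi i) ih1).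
by rewrite RintegralD// ih2.
Qed.

Definition smoothed mu N (y : K) : K := \int[mu]_x fejer N (x - y).

Lemma smoothed_expansion mu N y :
  mu.-integrable setT (EFin \o (fun x => fejer N (x - y))) /\
  smoothed mu N y =
  \sum_(i < N) \sum_(j < N) (cosT mu (i%:R - j%:R) * cos ((i%:R - j%:R) * y) +
                             sinT mu (i%:R - j%:R) * sin ((i%:R - j%:R) * y)).
Proof.
have E x : fejer N (x - y) = \sum_(i < N) \sum_(j < N)
    (cos ((i%:R - j%:R) * y) * cos ((i%:R - j%:R) * x) +
     sin ((i%:R - j%:R) * y) * sin ((i%:R - j%:R) * x)).
  rewrite fejerE; apply: eq_bigr => i _; apply: eq_bigr => j _.
  by rewrite mulrBr cosB; ring.
pose F (i j : nat) x := cos ((i%:R - j%:R) * y) * cos ((i%:R - j%:R) * x) +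
    sin ((i%:R - j%:R) * y) * sin ((i%:R - j%:R) * x) : K.
have ic i j := integrableZl measurableT (cos ((i%:R - j%:R) * y))
  (integrable_cosT mu (i%:R - j%:R)).
have isn i j := integrableZl measurableT (sin ((i%:R - j%:R) * y))
  (integrable_sinT mu (i%:R - j%:R)).
have Fi i j : mu.-integrable setT (EFin \o F i j).
  exact: (integrableD measurableT (ic i j) (isn i j)).
have Fi1 i := (Rintegral_sum (index_enum 'I_N) (fun j : 'I_N => Fi i j)).
have Fi2 := (Rintegral_sum (index_enum 'I_N) (fun i : 'I_N => (Fi1 i).1)).
have {}E : (fun x => fejer N (x - y)) = fun x => \sum_(i < N) \sum_(j < N) F i j x.
  by apply/funext => x; rewrite E.
rewrite /smoothed E; split; first exact: Fi2.1.
rewrite Fi2.2.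
apply: eq_bigr => i _; rewrite (Fi1 i).2; apply: eq_bigr => j _.
rewrite RintegralD//; [|exact: ic|exact: isn].
rewrite !RintegralZl//; [|exact: integrable_sinT|exact: integrable_cosT].
by rewrite /cosT /sinT; ring.
Qed.

Lemma smoothed_integral mu N :
  mu.-integrable setT (EFin \o smoothed mu N) /\
  \int[mu]_y smoothed mu N y =
  \sum_(i < N) \sum_(j < N) (cosT mu (i%:R - j%:R) ^+ 2 + sinT mu (i%:R - j%:R) ^+ 2).
Proof.
pose F (i j : nat) y := cosT mu (i%:R - j%:R) * cos ((i%:R - j%:R) * y) +
                        sinT mu (i%:R - j%:R) * sin ((i%:R - j%:R) * y) : K.
have ic i j := integrableZl measurableT (cosT mu (i%:R - j%:R))
  (integrable_cosT mu (i%:R - j%:R)).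
have isn i j := integrableZl measurableT (sinT mu (i%:R - j%:R))
  (integrable_sinT mu (i%:R - j%:R)).
have Fi i j : mu.-integrable setT (EFin \o F i j).
  exact: (integrableD measurableT (ic i j) (isn i j)).
have Fi1 i := (Rintegral_sum (index_enum 'I_N) (fun j : 'I_N => Fi i j)).
have Fi2 := (Rintegral_sum (index_enum 'I_N) (fun i : 'I_N => (Fi1 i).1)).
rewrite (_ : smoothed mu N = fun y => \sum_(i < N) \sum_(j < N) F i j y); last first.
  by apply/funext => y; exact: (smoothed_expansion mu N y).2.
split; first exact: Fi2.1.
rewrite Fi2.2; apply: eq_bigr => i _; rewrite (Fi1 i).2; apply: eq_bigr => j _.
rewrite RintegralD//; [|exact: ic|exact: isn].
rewrite RintegralZl//; last exact: integrable_cosT.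
by rewrite RintegralZl//; exact: integrable_sinT.
Qed.

(** [L] is the union of the listed cells of mass below [delta]. *)
Lemma light_cells mu (I : nat -> set K) (c : seq nat) (delta : K) :
  0 <= delta -> (forall j, measurable (I j)) ->
  exists L : set K, [/\ measurable L, (mu L <= ((size c)%:R * delta)%:E)%E &
    forall y, (\bigcup_(j in [set` c]) I j) y -> ~ L y ->
      exists2 j, I j y & delta <= fine (mu (I j))].
Proof.
move=> delta0 mI; elim: c => [|j c [L [mL Ld hL]]].
  by exists set0; split=> //; [rewrite measure0 mul0r|move=> y []].
have d0 : mu (I j) = (fine (mu (I j)))%:E.
  by rewrite fineK//; apply: fin_num_measure; exact: mI.
have [h|h] := ltP (fine (mu (I j))) delta; last first.
  exists L; split=> //.
    by apply: (le_trans Ld); rewrite lee_fin /= -natr1 mulrDl mul1r lerDl.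
  move=> y [i /=]; rewrite inE => /predU1P[->|ic] Iy nL; first by exists j.
  by apply: hL => //; exists i.
exists (I j `|` L); split.
- by apply: measurableU; [exact: mI|].
- apply: (@le_trans _ _ (mu (I j) + mu L)%E) => /=.
    by apply: measureU2; [exact: mI|].
  rewrite -natr1 mulrDl mul1r addrC EFinD; apply: leeD => //.
  by rewrite [leLHS]d0 lee_fin ltW.
move=> y [i /=]; rewrite inE => /predU1P[->|ic] Iy nL; first by case: nL; left.
by apply: hL => [|Ly]; [exists i|apply: nL; right].
Qed.

Lemma smoothed_ge mu N y (I : set K) : (0 < N)%N -> measurable I -> I y ->
  (forall x, I x -> `|x - y| <= N%:R^-1) ->
  (N%:R / 2) ^+ 2 * fine (mu I) <= smoothed mu N y.
Proof.
move=> N0 mI Iy hI.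
rewrite -Rintegral_cst// Rintegral_mkcond; apply: le_Rintegral => //.
- apply: (integrable_bounded (M := (N%:R / 2) ^+ 2)) => //.
  + exact: finite_measure_lty.
  + by apply/(measurable_restrictT _ mI).
  by move=> x _; rewrite patchE; case: ifP; rewrite ?normr0 ?ger0_norm ?sqr_ge0.
- exact: (smoothed_expansion mu N y).1.
move=> x _; rewrite patchE; case: ifPn => [/set_mem Ix|_]; last exact: fejer_ge0.
by apply: fejer_ge => //; exact: hI.
Qed.

Lemma smoothed_ge0 mu N y : 0 <= smoothed mu N y.
Proof. by apply: Rintegral_ge0 => x _; exact: fejer_ge0. Qed.

(* Cells of mass below [mu setT / (2 * J)] carry at most half of the mass, and on
   the others the Fejer-smoothed measure is large. *)
Lemma cover_energy mu N (I : nat -> set K) (c : seq nat) (J : K) :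
  (0 < N)%N -> 0 < J -> (forall j, measurable (I j)) ->
  (forall j x y, I j x -> I j y -> `|x - y| <= N%:R^-1) ->
  (size c)%:R <= J -> mu (~` \bigcup_(j in [set` c]) I j) = 0%E ->
  N%:R ^+ 2 * fine (mu setT) ^+ 2 <= 16 * J * \int[mu]_y smoothed mu N y.
Proof.
move=> N0 J0 mI Id cJ muI.
set m := fine (mu setT); have m0 : 0 <= m by rewrite fine_ge0.
pose delta := m / (2 * J).
have delta0 : 0 <= delta by rewrite divr_ge0// mulr_ge0// ltW.
have [L [mL Ld hL]] := light_cells mu c delta0 mI.
set U := \bigcup_(j in [set` c]) I j in muI hL *.
have mU : measurable U by apply: fin_bigcup_measurable => // j _.
pose G := U `\` L.
have mG : measurable G by exact: measurableD.
have fin A : measurable A -> mu A = (fine (mu A))%:E.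
  by move=> mA; rewrite fineK//; exact: fin_num_measure.
have Lm : fine (mu L) <= m / 2.
  rewrite -lee_fin -fin// (le_trans Ld)// lee_fin.
  apply: (@le_trans _ _ (J * delta)); first by rewrite ler_wpM2r.
  by rewrite /delta le_eqVlt; apply/orP; left; apply/eqP; field; lra.
have Gm : m / 2 <= fine (mu G).
  suff : m <= fine (mu L) + fine (mu G) by lra.
  rewrite -lee_fin EFinD -!fin//.
  apply: (@le_trans _ _ (mu (~` U) + mu (L `|` G))%E).
    rewrite (_ : setT = ~` U `|` (L `|` G)).
      by apply: measureU2; [exact: measurableC|exact: measurableU].
    apply/seteqP; split => // x _; rewrite /G.
    have [Ux|nU] := pselect (U x); last by left.
    by right; have [Lx|nL] := pselect (L x); [left|right].
  by rewrite [X in (X + _)%E]muI add0e; apply: measureU2.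
have [iw _] := smoothed_integral mu N.
have : (N%:R / 2) ^+ 2 * delta * fine (mu G) <= \int[mu]_y smoothed mu N y.
  rewrite -Rintegral_cst// Rintegral_mkcond; apply: le_Rintegral => //.
  - apply: (integrable_bounded (M := (N%:R / 2) ^+ 2 * delta)) => //.
    + exact: finite_measure_lty.
    + by apply/(measurable_restrictT _ mG).
    have w0 : 0 <= (N%:R / 2) ^+ 2 * delta by rewrite mulr_ge0 ?sqr_ge0.
    by move=> x _; rewrite patchE; case: ifP; rewrite ?normr0// ger0_norm.
  move=> y _; rewrite patchE; case: ifPn => [/set_mem[Uy nLy]|_]; last exact: smoothed_ge0.
  have [j Ijy dj] := hL y Uy nLy.
  apply: (@le_trans _ _ ((N%:R / 2) ^+ 2 * fine (mu (I j)))).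
    by rewrite ler_wpM2l ?sqr_ge0.
  by apply: smoothed_ge => // x Ix; exact: Id Ix Ijy.
set W := \int[mu]_y _ => hW.
have h2 : (N%:R / 2) ^+ 2 * delta * (m / 2) <= W.
  by apply: le_trans hW; rewrite ler_wpM2l// mulr_ge0 ?sqr_ge0.
(* The 16 collects 4 from the kernel, 2 from [delta] and 2 from the mass of [G]. *)
rewrite (_ : N%:R ^+ 2 * m ^+ 2 = 16 * J * ((N%:R / 2) ^+ 2 * delta * (m / 2))).
  by rewrite ler_pM2l// mulr_gt0.
by rewrite /delta; field; lra.
Qed.

End FourierCover.

(** Squaring 1 + v k <= exp (v k), with v = (d/2) ln 2, gives quadratic growth, which overtakes the
    linear bound once k > 2B / v^2. *)
Lemma exponential_growth (K : realType) (d B : K) :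
  (forall k : nat, (2 : K) `^ (d * k%:R) <= B * (k%:R + 1)) -> d <= 0.
Proof.
move=> hB; rewrite leNgt; apply/negP => d0.
have l2 : 0 < ln (2 : K) by rewrite ln_gt0// ltr1n.
pose v := d / 2 * ln 2; have v0 : 0 < v by rewrite mulr_gt0// divr_gt0.
have B0 : 0 <= B by have := hB 0%N; rewrite mulr0 powRr0; lra.
pose k := (Num.truncn (2 * B / v ^+ 2)).+1.
have hk : 2 * B / v ^+ 2 < k%:R by exact: truncnS_gt.
have k1 : 1 <= k%:R :> K by rewrite ler1n.
have v2 : 0 < v ^+ 2 by rewrite exprn_gt0.
have h1 : 2 * B < k%:R * v ^+ 2 by rewrite -ltr_pdivrMr.
have h2 : (1 + v * k%:R) ^+ 2 <= 2 `^ (d * k%:R).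
  have -> : (2 : K) `^ (d * k%:R) = expR (v * k%:R) ^+ 2.
    rewrite /powR ifF ?gt_eqF// expr2 -expRD; congr expR.
    by rewrite /v; field.
  rewrite lerXn2r ?nnegrE ?expR_ge0 ?expR_ge1Dx//.
  by rewrite addr_ge0// mulr_ge0// ltW.
have h3 := le_trans h2 (hB k).
have h4 : 2 * B * k%:R < k%:R * v ^+ 2 * k%:R by rewrite ltr_pM2r//; lra.
have h5 : B * (k%:R + 1) <= 2 * B * k%:R.
  by rewrite mulrAC [leRHS]mulrC; apply: ler_wpM2l => //; lra.
have h6 : 0 <= v * k%:R by rewrite mulr_ge0// ltW.
have h7 : (1 + v * k%:R) ^+ 2 = 1 + 2 * (v * k%:R) + k%:R * v ^+ 2 * k%:R by ring.
lra.
Qed.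

Section CoverBound.
Context {K : realType}.
Implicit Type mu : finite_borel_measure K.

Definition dyadic_cell (k j : nat) : set K := `[gridpt k j, gridpt k j.+1].

Lemma dyadic_cell_dist k j x y : dyadic_cell k j x -> dyadic_cell k j y ->
  `|x - y| <= 2 ^- k.
Proof.
rewrite /dyadic_cell /= !in_itv/= gridpt_succ => /andP[? ?] /andP[? ?].
by rewrite ler_norml; lra.
Qed.

(** The energy is the sum of squared transforms at the differences i - j. The diagonal is bounded by
    the mass, a difference h >= 1 by the decay 2 A^2 h^(-s), and each of the 2^k rows costs a
    partial sum of h^(-s). *)
Lemma smoothed_energy_le mu s A k : 0 <= s <= 1 ->
  (forall theta x, 2^-1 <= x ->
    `|\int[mu]_r cos (x * r + theta)| <= A * x `^ (- (s / 2))) ->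
  \int[mu]_y smoothed mu (2 ^ k) y <=
  2 ^+ k * ((2 * fine (mu setT) ^+ 2 + 4 * A ^+ 2) * ((k%:R + 1) * 2 `^ ((1 - s) * k%:R))).
Proof.
move=> s01 hA; set m := fine (mu setT).
pose g (h : nat) := if h is h'.+1 then 2 * A ^+ 2 * (h'.+1%:R) `^ (- s) else 2 * m ^+ 2.
have m0 : 0 <= m by rewrite fine_ge0.
have sq (u v : K) : `|u| <= v -> u ^+ 2 <= v ^+ 2.
  move=> uv; rewrite -[u ^+ 2]real_normK ?num_real// lerXn2r// nnegrE//.
  exact: le_trans uv.
have g_ge0 h : 0 <= g h.
  case: h => [|h] /=; first by rewrite mulr_ge0 ?sqr_ge0.
  by apply: mulr_ge0; [rewrite mulr_ge0 ?sqr_ge0|exact: powR_ge0].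
have cosNT x : cosT mu (- x) = cosT mu x.
  by rewrite /cosT; under eq_Rintegral do rewrite mulNr cosN.
have sinNT x : sinT mu (- x) = - sinT mu x.
  rewrite /sinT -[RHS]mulN1r -RintegralZl//; last exact: integrable_sinT.
  by apply: eq_Rintegral => r _; rewrite mulNr sinN mulN1r.
have pos h : cosT mu h%:R ^+ 2 + sinT mu h%:R ^+ 2 <= g h.
  case: h => [|h].
    have c1 : `|cosT mu 0| <= m.
      rewrite -[leRHS]mul1r; apply: normr_Rintegral_le => //.
      - exact: finite_measure_lty.
      - by have := measurable_cos_affine 0 (0 : K); under eq_fun do rewrite addr0.
      by move=> ? _; exact: cos_max.
    have s1 : `|sinT mu 0| <= m.
      rewrite -[leRHS]mul1r; apply: normr_Rintegral_le => //.
      - exact: finite_measure_lty.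
      - by have := measurable_sin_affine 0 (0 : K); under eq_fun do rewrite addr0.
      by move=> ? _; exact: sin_max.
    by rewrite /g; have := sq _ _ c1; have := sq _ _ s1; lra.
  have h1 : 2^-1 <= h.+1%:R :> K.
    by apply: (@le_trans _ _ 1); [lra|rewrite ler1n].
  have c1 : `|cosT mu h.+1%:R| <= A * h.+1%:R `^ (- (s / 2)).
    by have := hA 0 _ h1; under eq_Rintegral do rewrite addr0.
  have s1 : `|sinT mu h.+1%:R| <= A * h.+1%:R `^ (- (s / 2)).
    by have := hA (- (pi / 2)) _ h1; under eq_Rintegral do rewrite cosBpihalf.
  have e2 : (A * h.+1%:R `^ (- (s / 2))) ^+ 2 = A ^+ 2 * h.+1%:R `^ (- s).
    rewrite exprMn expr2 -[X in _ * X = _]powRD ?pnatr_eq0 ?implybT//.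
    by congr (_ * powR _ _); field.
  by rewrite /g; have := sq _ _ c1; have := sq _ _ s1; rewrite e2; lra.
have all_le i j : cosT mu (i%:R - j%:R) ^+ 2 + sinT mu (i%:R - j%:R) ^+ 2 <=
    g ((i - j) + (j - i))%N.
  have [ij|ji] := leqP i j.
    rewrite -opprB cosNT sinNT sqrrN -natrB// (_ : (i - j + (j - i) = j - i)%N)//.
    by lia.
  rewrite -natrB ?(ltnW ji)// (_ : (i - j + (j - i) = i - j)%N)//; lia.
rewrite (smoothed_integral mu (2 ^ k)).2.
apply: (@le_trans _ _
  (\sum_(i < (2 ^ k)%N) \sum_(j < (2 ^ k)%N) g ((i - j) + (j - i))%N)).
  by apply: ler_sum => i _; apply: ler_sum => j _; exact: all_le.
rewrite sum_double_dist.
set S := (k%:R + 1) * 2 `^ ((1 - s) * k%:R).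
have S1 : 1 <= S.
  have /andP[s0 s1] := s01.
  have : 1 <= (2 : K) `^ ((1 - s) * k%:R).
    rewrite -[leLHS](powRr0 2); apply: ler_powR; first by rewrite ler1n.
    by rewrite mulr_ge0//; lra.
  by rewrite /S; have := ler0n K k; nra.
have gS : \sum_(h < 2 ^ k) g h.+1 <= 2 * A ^+ 2 * S.
  have A2 : 0 <= 2 * A ^+ 2 by rewrite mulr_ge0// sqr_ge0.
  by rewrite /g -mulr_sumr ler_wpM2l// sum_powRN_le.
rewrite -natrX -[X in X%:R * _]card_ord mulr_natl -sumr_const.
apply: ler_sum => n _.
have h1 : \sum_(h < n) g h.+1 <= \sum_(h < 2 ^ k) g h.+1.
  have nk : (n <= 2 ^ k)%N by exact: ltnW.
  move: (nat_of_ord n) nk => l lk.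
  rewrite -(subnKC lk) big_split_ord /= lerDl.
  by apply: sumr_ge0 => i _; exact: (g_ge0 (l + i).+1).
have h2 : 2 * m ^+ 2 <= 2 * m ^+ 2 * S.
  by rewrite ler_peMr// mulr_ge0// sqr_ge0.
rewrite [g 0%N]/g mulrDl; lra.
Qed.

(** Comparing both estimates of the energy for N = 2^k gives 2^((s - alpha) k) <= B (k + 1) for all
    k. *)
Lemma fourier_decay_cover mu s alpha : 0 <= s <= 1 -> mu setT != 0%E ->
  fourier_decay mu s ->
  (forall k, exists c : seq nat, (size c)%:R <= (2 : K) `^ (alpha * k%:R) /\
     mu (~` \bigcup_(j in [set` c]) dyadic_cell k j) = 0%E) ->
  s <= alpha.
Proof.
move=> s01 mu0 /(fourier_decay_trig s01)[A A0 hA] cov.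
set m := fine (mu setT).
have m0 : 0 < m by rewrite fine_gt0// finite_measure_lty// andbT lt0e mu0 measure_ge0.
pose B := 16 * (2 * m ^+ 2 + 4 * A ^+ 2) / m ^+ 2.
rewrite -subr_le0; apply: (@exponential_growth _ _ B) => k.
have [c [ck muc]] := cov k.
have N0 : (0 < 2 ^ k)%N by rewrite expn_gt0.
have J0 : 0 < (2 : K) `^ (alpha * k%:R) by rewrite powR_gt0.
have cd j x y : dyadic_cell k j x -> dyadic_cell k j y -> `|x - y| <= (2 ^ k)%:R^-1.
  by rewrite natrX; exact: dyadic_cell_dist.
have := cover_energy N0 J0 (fun j => measurable_itv _) cd ck muc.
have := smoothed_energy_le k s01 hA.
rewrite natrX -/m; set W := Rintegral _ _ _.
set q := (2 : K) ^+ k; set J := (2 : K) `^ (alpha * k%:R).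
set T := (2 : K) `^ ((1 - s) * k%:R); set X := (2 : K) `^ ((s - alpha) * k%:R).
set E := 2 * m ^+ 2 + 4 * A ^+ 2 => hW hE.
have q0 : 0 < q by exact: exprn_gt0.
have T0 : 0 < T by exact: powR_gt0.
have qE : q = X * (J * T).
  rewrite /q /X /J /T -!powRD ?pnatr_eq0 ?implybT// -powR_mulrn//.
  by congr powR; ring.
have {}hE : q * (q * m ^+ 2) <= q * (16 * J * (E * ((k%:R + 1) * T))).
  have J16 : 0 <= 16 * J by rewrite mulr_ge0// ltW.
  have := le_trans hE (ler_wpM2l J16 hW).
  rewrite (_ : q ^+ 2 * m ^+ 2 = q * (q * m ^+ 2)); last by ring.
  move=> h; apply: (le_trans h); rewrite le_eqVlt; apply/orP; left.
  by apply/eqP; ring.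
rewrite ler_pM2l// qE in hE.
have JT : 0 < J * T by exact: mulr_gt0.
rewrite /B mulrAC ler_pdivlMr ?exprn_gt0// -(ler_pM2l JT).
by move: hE; rewrite -/E; lra.
Qed.

End CoverBound.

(** * Hausdorff and Minkowski dimensions *)

Lemma powR2_large (K : realType) (g M : K) : 0 < g ->
  exists k0, forall k, (k0 <= k)%N -> M <= 2 `^ (g * k%:R).
Proof.
move=> g0; have l2 : 0 < ln (2 : K) by rewrite ln_gt0// ltr1n.
have u0 : 0 < g * ln 2 by rewrite mulr_gt0.
exists (Num.truncn (M / (g * ln 2))).+1 => k hk.
rewrite /powR ifF ?gt_eqF//; apply: (le_trans _ (expR_ge1Dx _)).
have : M / (g * ln 2) <= k%:R.
  by rewrite (le_trans (ltW (truncnS_gt _)))// ler_nat.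
rewrite ler_pdivrMr// => h; rewrite mulrAC mulrC; lra.
Qed.

Section Diam.
Context {K : realType}.
Implicit Types U : set K.

Lemma diam_ge0 U : (0 <= diam U)%E.
Proof. by apply: ereal_sup_ubound; left. Qed.

Lemma le_dist_diam U x y : U x -> U y -> (`|x - y|%:E <= diam U)%E.
Proof. by move=> Ux Uy; apply: ereal_sup_ubound; right; exists x => //; exists y. Qed.

Lemma diam_le U (r : K) : 0 <= r -> (forall x y, U x -> U y -> `|x - y| <= r) ->
  (diam U <= r%:E)%E.
Proof.
move=> r0 h; apply: ge_ereal_sup => _ [->|[x Ux [y Uy <-]]]; rewrite lee_fin//.
exact: h.
Qed.

Lemma diam0 : diam (set0 : set K) = 0%E.
Proof. by apply/eqP; rewrite eq_le diam_ge0 andbT; apply: diam_le. Qed.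

End Diam.

Section Hausdorff.
Context {K : realType}.
Variables (alpha : K) (Y : set K).
Hypothesis alpha0 : 0 <= alpha.

Lemma hausdorff_premeasure_ge0 s delta : (0 <= hausdorff_premeasure s delta Y)%E.
Proof.
apply: le_ereal_inf_tmp => _ [U _ <-]; apply: nneseries_ge0 => i _ _.
exact: poweR_ge0.
Qed.

Lemma hausdorff_dim_le :
  (forall k, exists c : seq nat, (size c)%:R <= (2 : K) `^ (alpha * k%:R) /\
     Y `<=` \bigcup_(j in [set` c]) dyadic_cell k j) ->
  (hausdorff_dim Y <= alpha%:E)%E.
Proof.
move=> cov; apply/lee_addgt0Pr => eps eps0; rewrite -EFinD.
apply: ereal_inf_lbound; have s0 : 0 < alpha + eps by rewrite ltr_wpDl.
exists (alpha + eps) => //; split => //; set s := alpha + eps in s0 *.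
apply/eqP; rewrite eq_le; apply/andP; split; last first.
  apply: (@le_trans _ _ (hausdorff_premeasure s 1 Y)).
    exact: hausdorff_premeasure_ge0.
  by apply: ereal_sup_ubound; exists 1 => //=.
apply: ge_ereal_sup => _ [delta /= delta0 <-].
apply/lee_addgt0Pr => z z0; rewrite add0e.
have [k1 hk1] := powR2_large delta^-1 (ltr01 : 0 < (1 : K)).
have [k2 hk2] := powR2_large z^-1 eps0.
pose k := maxn k1 k2.
have kd : 2 ^- k <= delta.
  have := hk1 k (leq_maxl _ _); rewrite mul1r powR_mulrn// => h.
  by rewrite -[delta]invrK lef_pV2 ?posrE ?exprn_gt0 ?invr_gt0.
have kz : 2 `^ (- (eps * k%:R)) <= z.
  rewrite powRN -[z]invrK lef_pV2 ?posrE ?powR_gt0 ?invr_gt0//.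
  exact: hk2 (leq_maxr _ _).
have [c [ck Yc]] := cov k.
(* Padding with empty sets adds nothing, since their diameter is 0 and 0^s = 0 for s > 0. *)
pose U i : set K := if (i < size c)%N then dyadic_cell k (nth 0%N c i) else set0.
have Ud i : (diam (U i) <= (2 ^- k)%:E)%E.
  rewrite /U; case: ifP => _; last by rewrite diam0 lee_fin invr_ge0 exprn_ge0.
  apply: diam_le; first by rewrite invr_ge0 exprn_ge0.
  by move=> x y; exact: dyadic_cell_dist.
apply: (@le_trans _ _ (\sum_(0 <= i <oo) poweR (diam (U i)) s)%E).
  apply: ereal_inf_lbound; exists U => //; split.
    move=> y /Yc[j /= jc yj]; exists (index j c) => //.
    by rewrite /U index_mem jc nth_index.
  by move=> i; rewrite (le_trans (Ud i))// lee_fin.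
have term i : (poweR (diam (U i)) s <=
    (if (i < size c)%N then (2 ^- k) `^ s else 0)%:E)%E.
  rewrite /U; case: ifP => ic; last by rewrite diam0 poweR_EFin powR0// gt_eqF.
  have := Ud i; have := diam_ge0 (U i); rewrite /U ic.
  case: (diam _) => [r| |]//; rewrite !lee_fin => r0 rk.
  by apply: ge0_ler_powR; rewrite ?nnegrE ?invr_ge0 ?exprn_ge0// ltW.
apply: lime_le; first by apply: is_cvg_nneseries => i _ _; exact: poweR_ge0.
apply: nearW => n.
apply: (@le_trans _ _ (\sum_(0 <= i < n) (if (i < size c)%N then (2 ^- k) `^ s else 0)%:E)%E).
  exact: lee_sum.
rewrite sumEFin lee_fin -big_mkcond /=.
apply: (@le_trans _ _ ((size c)%:R * (2 ^- k) `^ s)).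
  rewrite big_const_seq iter_addr addr0 -[leLHS]mulr_natl ler_wpM2r ?powR_ge0//.
  rewrite ler_nat -size_filter -[leqRHS](size_iota 0).
  apply: uniq_leq_size; first by rewrite filter_uniq// iota_uniq.
  by move=> i; rewrite mem_filter !mem_iota /= => /andP[].
apply: le_trans kz.
apply: (@le_trans _ _ (2 `^ (alpha * k%:R) * (2 ^- k) `^ s)).
  by rewrite ler_wpM2r ?powR_ge0.
rewrite -powR_invn// -powRrM -powRD ?pnatr_eq0 ?implybT//.
by rewrite le_eqVlt; apply/orP; left; apply/eqP; congr powR; rewrite /s; ring.
Qed.

Variables (nu : finite_borel_measure K) (C : K).
Hypothesis C0 : 0 < C.
Hypothesis frostman : forall x r : K, 0 < r ->
  (nu (`[(x - r)%R, (x + r)%R]%classic : set K) <= (C * r `^ alpha)%:E)%E.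
Hypothesis nuY : nu (~` Y) = 0%E.
Hypothesis nu0 : nu setT != 0%E.
Hypothesis mY : measurable (Y : set K).

(** Radius 0 arises from covering sets with a single point; for alpha > 0 it follows from small
    positive radii. *)
Lemma frostman0 x r : 0 < alpha -> 0 <= r ->
  (nu (`[(x - r)%R, (x + r)%R]%classic : set K) <= (C * r `^ alpha)%:E)%E.
Proof.
move=> a0; rewrite le_eqVlt => /predU1P[<-|]; last exact: frostman.
rewrite powR0 ?gt_eqF// mulr0 subr0 addr0.
apply/lee_addgt0Pr => eps eps0; rewrite add0e.
pose r' := (eps / C) `^ alpha^-1.
have r'0 : 0 < r' by rewrite powR_gt0// divr_gt0.
have E : C * r' `^ alpha = eps.
  rewrite /r' -powRrM mulVf ?gt_eqF// powRr1 ?divr_ge0 ?ltW//.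
  by field; rewrite gt_eqF.
rewrite -E; apply: le_trans (frostman x r'0).
apply: le_measure; rewrite ?inE// => y /=; rewrite !in_itv/= => /andP[? ?].
by lra.
Qed.

(** Mass distribution principle. If s < alpha had measure 0, some cover by sets of diameter d <= 1
    would have too small a sum of d^s, although d^alpha <= d^s. *)
Lemma hausdorff_dim_ge : (alpha%:E <= hausdorff_dim Y)%E.
Proof.
apply: le_ereal_inf_tmp => _ [s [s0 hs] <-]; rewrite lee_fin leNgt.
apply/negP => sa; have a0 : 0 < alpha by exact: lt_trans sa.
pose m := fine (nu setT).
have m0 : 0 < m by rewrite fine_gt0// finite_measure_lty// andbT lt0e nu0 measure_ge0.
have pre : (hausdorff_premeasure s 1 Y < (m / C)%:E)%E.
  apply: (@le_lt_trans _ _ 0%E); last by rewrite lte_fin divr_gt0.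
  by rewrite -hs; apply: ereal_sup_ubound; exists 1 => //=.
have [_ [U [YU Ud] <-] hU] := ereal_inf_lt pre.
pose d i := fine (diam (U i)).
have dE i : diam (U i) = (d i)%:E.
  rewrite /d; have := Ud i; have := diam_ge0 (U i).
  by case: (diam _).
have d0 i : 0 <= d i by rewrite fine_ge0// diam_ge0.
have d1 i : d i <= 1 by rewrite -lee_fin -dE.
(* Covering sets are arbitrary; each is replaced by a measurable interval around one of its points,
   with its diameter as radius. *)
pose B i : set K := if pselect (U i !=set0) is left h
  then `[xget 0 (U i) - d i, xget 0 (U i) + d i]%classic else set0.
have mB i : measurable (B i) by rewrite /B; case: pselect.
have UB i : U i `<=` B i.
  move=> y Uy; rewrite /B; case: pselect => [h|]; last by case; exists y.
  have Ux : U i (xget 0 (U i)) by exact: xgetPex h.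
  have := le_dist_diam Uy Ux; rewrite dE lee_fin ler_norml /= in_itv/=.
  by move=> /andP[? ?]; lra.
have nuB i : (nu (B i) <= C%:E * poweR (diam (U i)) s)%E.
  rewrite dE poweR_EFin -EFinM.
  rewrite /B; case: pselect => [h|_]; last first.
    by rewrite measure0 lee_fin mulr_ge0 ?powR_ge0// ltW.
  apply: (le_trans (frostman0 _ a0 (d0 i))); rewrite lee_fin ler_pM2l//.
  have := d0 i; rewrite le_eqVlt => /predU1P[<-|di].
    by rewrite !powR0// gt_eqF.
  by apply: ger_powR; [rewrite di d1|exact: ltW].
have : (m%:E <= C%:E * \sum_(0 <= i <oo) poweR (diam (U i)) s)%E.
  rewrite -nneseriesZl//; last by move=> i _; exact: poweR_ge0.
  apply: (@le_trans _ _ (\sum_(0 <= i <oo) nu (B i))%E); last first.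
    by apply: lee_nneseries => // i _.
  have mUB : measurable (\bigcup_i B i) by apply: bigcup_measurable => i _; exact: mB.
  apply: (@le_trans _ _ (nu (\bigcup_i B i))); last first.
    exact: measure_sigma_subadditive.
  have -> : m%:E = nu setT by rewrite /m fineK// fin_num_measure.
  apply: (@le_trans _ _ (nu (~` Y) + nu (\bigcup_i B i))%E); last first.
    by rewrite [X in (X + _)%E]nuY add0e.
  rewrite (_ : setT = ~` Y `|` \bigcup_i B i).
    by apply: measureU2 => //; exact: measurableC.
  apply/seteqP; split => // y _; have [Yy|nY] := pselect (Y y); last by left.
  by right; have [i _ Uy] := YU _ Yy; exists i => //; exact: UB.
have S0 : (0 <= \sum_(0 <= i <oo) poweR (diam (U i)) s)%E.
  by apply: nneseries_ge0 => i _ _; exact: poweR_ge0.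
move: hU S0; case: (limn _) => [S| |]//.
rewrite lte_fin ltr_pdivlMr// => hS _; rewrite -EFinM lee_fin => hm.
by move: hm; rewrite mulrC leNgt hS.
Qed.

End Hausdorff.

Section Minkowski.
Context {K : realType}.
Variables (alpha : K) (Y : set K).
Hypothesis alpha0 : 0 <= alpha.

Let ratio (e : K) : \bar K := (ln (covering_number Y e) / ln (1 / e))%:E.

Let covering_le e (c : seq K) : Y `<=` \bigcup_(x in [set` c]) ball x e ->
  covering_number Y e <= (size c)%:R.
Proof.
move=> Yc; apply: ge_inf; last by exists c.
by exists 0 => _ [c' _ <-].
Qed.

Hypothesis cov : forall k, exists c : seq nat,
  (size c)%:R <= (2 : K) `^ (alpha * k%:R) /\
  Y `<=` \bigcup_(j in [set` c]) dyadic_cell k j.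

Let dyadic_cover k (e : K) : 2 ^- k < e -> exists2 c : seq K,
  (size c)%:R <= (2 : K) `^ (alpha * k%:R) &
  Y `<=` \bigcup_(x in [set` c]) ball x e.
Proof.
move=> ke; have [c [ck Yc]] := cov k.
exists [seq gridpt k j | j <- c]; first by rewrite size_map.
move=> y /Yc[j /= jc yj]; exists (gridpt k j) => /=; first exact: map_f.
rewrite /ball /= (le_lt_trans _ ke)//; apply: dyadic_cell_dist yj.
by rewrite /dyadic_cell /= in_itv/= lexx gridpt_homo.
Qed.

Lemma upper_minkowski_dim_le : (upper_minkowski_dim Y <= alpha%:E)%E.
Proof.
apply/lee_addgt0Pr => eps eps0; rewrite -EFinD.
have l2 : 0 < ln (2 : K) by rewrite ln_gt0// ltr1n.
(* For k >= alpha / eps, alpha (k + 1) <= (alpha + eps) k: this absorbs the gap of one level between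
   the cover used and the scale. *)
pose k0 := (Num.truncn (alpha / eps)).+1.
pose r : K := 2 ^- k0.
have r0 : 0 < r by rewrite invr_gt0 exprn_gt0.
rewrite /upper_minkowski_dim /limf_esup.
apply: (@le_trans _ _ (ereal_sup [set ratio e | e in [set e | 0 < e < r]])).
  apply: ereal_inf_lbound; exists [set e | 0 < e < r] => //.
  near=> e; rewrite /=; apply/andP; split.
    by near: e; exact: nbhs_right_gt.
  by near: e; exact: nbhs_right_lt.
apply: ge_ereal_sup => _ [e /= /andP[e0 er] <-]; rewrite lee_fin.
have r1 : r <= 1.
  by rewrite /r invf_le1 ?exprn_gt0// exprn_ege1// ler1n.
have e01 : 0 < e <= 1 by rewrite e0 (ltW (lt_le_trans er r1)).
have [k /andP[k1 k2]] := dyadic_scale e01.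
have kk0 : (k0 <= k)%N.
  rewrite leqNgt; apply/negP => kk; move: (lt_trans k1 er).
  rewrite /r ltf_pV2 ?posrE ?exprn_gt0// ltr_eXn2l ?ltr1n// ltnNge.
  by rewrite kk.
have k_gt0 : 0 < k%:R :> K by rewrite ltr0n (leq_trans _ kk0).
have [c ck Yc] := dyadic_cover k1.
have Ne : ln (covering_number Y e) <= alpha * k.+1%:R * ln 2.
  have N1 := le_trans (covering_le Yc) ck.
  (* [ln] is 0 on non-positive arguments. *)
  have [N0|N0] := leP (covering_number Y e) 0.
    by rewrite ln0//; apply: mulr_ge0; [rewrite mulr_ge0|exact: ltW].
  by rewrite -ln_powR ler_ln ?posrE ?powR_gt0.
have le : k%:R * ln 2 <= ln (1 / e).
  rewrite -ln_powR ler_ln ?posrE ?powR_gt0 ?divr_gt0// powR_mulrn// div1r.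
  by rewrite -[leLHS]invrK lef_pV2 ?posrE ?invr_gt0 ?exprn_gt0.
have le0 : 0 < ln (1 / e) by apply: lt_le_trans le; rewrite mulr_gt0.
rewrite ler_pdivrMr//; apply: (le_trans Ne).
apply: (@le_trans _ _ ((alpha + eps) * (k%:R * ln 2))); last first.
  by rewrite ler_wpM2l// addr_ge0// ltW.
rewrite mulrA ler_pM2r// -natr1 mulrDr mulr1 mulrDl lerD2l.
have : alpha / eps <= k%:R.
  by rewrite (le_trans (ltW (truncnS_gt _)))// ler_nat.
by rewrite ler_pdivrMr// mulrC.
Unshelve. all: by end_near. Qed.

Variables (nu : finite_borel_measure K) (C : K).
Hypothesis C0 : 0 < C.
Hypothesis frostman : forall x r : K, 0 < r ->
  (nu (`[(x - r)%R, (x + r)%R]%classic : set K) <= (C * r `^ alpha)%:E)%E.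
Hypothesis nuY : nu (~` Y) = 0%E.
Hypothesis nu0 : nu setT != 0%E.
Hypothesis mY : measurable (Y : set K).

Let m := fine (nu setT).

Let m_gt0 : 0 < m.
Proof. by rewrite fine_gt0// finite_measure_lty// andbT lt0e nu0 measure_ge0. Qed.

Lemma covering_number_ge e : 0 < e -> m / C * e `^ (- alpha) <= covering_number Y e.
Proof.
move=> e0.
(* Some finite cover must exist, since [inf] of the empty set is 0. *)
have [k ke] : exists k, 2 ^- k < e.
  have [k0 hk] := powR2_large (2 / e) (ltr01 : 0 < (1 : K)).
  exists k0; have := hk k0 (leqnn _); rewrite mul1r powR_mulrn// => h.
  rewrite invf_plt ?posrE ?exprn_gt0//; apply: lt_le_trans h.
  by rewrite ltr_pMl ?invr_gt0// ltr1n.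
have [c0 _ Yc0] := dyadic_cover ke.
apply: lb_le_inf; first by exists (size c0)%:R, c0.
move=> _ [c /= Yc <-].
rewrite powRN -mulrA -invfM ler_pdivrMr ?mulr_gt0 ?powR_gt0//.
rewrite -lee_fin /m fineK ?fin_num_measure//.
pose B (x : K) : set K := `[x - e, x + e]%classic.
have mB (s : seq K) : measurable (\bigcup_(x in [set` s]) B x).
  by apply: fin_bigcup_measurable => // x _; exact: measurable_itv.
have sub (s : seq K) : (nu (\bigcup_(x in [set` s]) B x) <=
    ((size s)%:R * (C * e `^ alpha))%:E)%E.
  elim: s => [|x s ih].
    by rewrite mul0r (_ : \bigcup_(_ in _) _ = set0) ?measure0// bigcup0.
  rewrite (_ : \bigcup_(_ in _) _ = B x `|` \bigcup_(x in [set` s]) B x).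
    apply: (@le_trans _ _ (nu (B x) + nu (\bigcup_(x in [set` s]) B x))%E).
      by apply: measureU2; [exact: measurable_itv|exact: mB].
    rewrite /= -natr1 mulrDl mul1r addrC EFinD; apply: leeD => //; exact: frostman.
  apply/seteqP; split=> [y [z /=]|y].
    by rewrite inE => /predU1P[->|zs] Bz; [left|right; exists z].
  move=> [By|[z /= zs Bz]]; first by exists x => //=; rewrite mem_head.
  by exists z => //=; rewrite inE zs orbT.
apply: (le_trans _ (sub c)).
apply: (@le_trans _ _ (nu (~` Y) + nu (\bigcup_(x in [set` c]) B x))%E); last first.
  by rewrite [X in (X + _)%E]nuY add0e.
have mYB : (nu setT <= nu (~` Y `|` \bigcup_(x in [set` c]) B x))%E.
  apply: le_measure; rewrite ?inE//.
    by apply: measurableU; [exact: measurableC|exact: mB].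
  move=> y _; have [Yy|nY] := pselect (Y y); last by left.
  right; have [x xc xy] := Yc _ Yy; exists x => //.
  move: xy; rewrite /B /ball /= ltr_norml in_itv/= => /andP[? ?].
  by apply/andP; split; lra.
by apply: (le_trans mYB); apply: measureU2; [exact: measurableC|exact: mB].
Qed.

Lemma upper_minkowski_dim_ge : (alpha%:E <= upper_minkowski_dim Y)%E.
Proof.
apply/lee_addgt0Pr => eps eps0; rewrite -leeBlDr// -EFinB.
apply: le_ereal_inf_tmp => _ [V V0 <-].
pose L := `|ln (m / C)|.
have L0 : 0 <= L by exact: normr_ge0.
(* Below [t], |ln (m / C)| is at most eps ln (1 / e), so the constant in the covering bound costs at
   most eps. *)
pose t := expR (- ((L + 1) / eps)).
have t0 : 0 < t by exact: expR_gt0.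
have /filter_ex[e [Ve e0 et]] : \forall e \near 0^'+, [/\ V e, 0 < e & e < t].
  near=> e; split; near: e; [exact: V0|exact: nbhs_right_gt|exact: nbhs_right_lt].
apply: (@le_trans _ _ (ratio e)); last by apply: ereal_sup_ubound; exists e.
rewrite lee_fin.
have el : (L + 1) / eps < ln (1 / e).
  rewrite div1r lnV ?posrE// ltrNr -[ltRHS]expRK ltr_ln ?posrE//.
have l0 : 0 < ln (1 / e).
  by apply: le_lt_trans el; rewrite divr_ge0// ?addr_ge0// ltW.
have N0 := covering_number_ge e0.
have mC : 0 < m / C by exact: divr_gt0.
have lN : ln (m / C) + alpha * ln (1 / e) <= ln (covering_number Y e).
  have -> : ln (m / C) + alpha * ln (1 / e) = ln (m / C * e `^ (- alpha)).
    rewrite (@lnM _ (m / C) (e `^ (- alpha))) ?posrE ?powR_gt0// ln_powR div1r lnV ?posrE//; ring.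
  have p0 : 0 < m / C * e `^ (- alpha) by rewrite mulr_gt0// powR_gt0.
  by rewrite ler_ln ?posrE// (lt_le_trans p0).
rewrite ler_pdivlMr//; apply: le_trans lN.
have : - L <= ln (m / C) by rewrite lerNl /L -normrN ler_norm.
move: el; rewrite ltr_pdivrMr// => el; lra.
Unshelve. all: by end_near. Qed.

End Minkowski.

(** * Fourier dimension of the Cantor set and of products *)

Section FourierDim.
Context {K : realType}.
Implicit Types (A Y : set K) (s t : K).

Definition decay_exponents A : set K := [set s : K | 0 < s < 1 /\
  exists2 mu : finite_borel_measure K, supported_measures A mu & fourier_decay mu s].

Lemma fourier_dimE A : fourier_dim A = sup (decay_exponents A).
Proof. by []. Qed.

Lemma le_fourier_dim A s : decay_exponents A s -> s <= fourier_dim A.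
Proof.
move=> As; apply: ub_le_sup => //; exists 1 => t [/andP[_ /ltW]].
by [].
Qed.

(** The bound [0 <= t] settles the case without exponents, where [sup] is 0. *)
Lemma fourier_dim_le A t : 0 <= t ->
  (forall s, decay_exponents A s -> s <= t) -> fourier_dim A <= t.
Proof.
move=> t0 At; rewrite fourier_dimE; have [->|/set0P A0] := eqVneq (decay_exponents A) set0.
  by rewrite sup0.
exact: ge_sup.
Qed.

Lemma fourier_dim_ge0 A : 0 <= fourier_dim A.
Proof.
rewrite fourier_dimE; have [->|/set0P[s As]] := eqVneq (decay_exponents A) set0.
  by rewrite sup0.
apply: (le_trans _ (le_fourier_dim As)); have [/andP[/ltW]] := As.
by [].
Qed.

Lemma lt_fourier_dim A t : 0 <= t -> t < fourier_dim A ->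
  exists2 s, decay_exponents A s & t < s.
Proof.
move=> t0 tA; apply: contrapT => h.
suff : fourier_dim A <= t by rewrite leNgt tA.
apply: fourier_dim_le => // s As; rewrite leNgt; apply/negP => ts.
by apply: h; exists s.
Qed.

Lemma fourier_dim_ge A t : t <= 1 ->
  (forall u, 0 < u -> u < t -> decay_exponents A u) -> t <= fourier_dim A.
Proof.
move=> t1 At; rewrite leNgt; apply/negP => h; have h0 := fourier_dim_ge0 A.
have : (fourier_dim A + t) / 2 <= fourier_dim A.
  by apply: le_fourier_dim; apply: At; lra.
by lra.
Qed.

Lemma fourier_dim_le_cover alpha Y : 0 <= alpha -> compact Y ->
  (forall k, exists c : seq nat, (size c)%:R <= (2 : K) `^ (alpha * k%:R) /\
     Y `<=` \bigcup_(j in [set` c]) dyadic_cell k j) ->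
  fourier_dim Y <= alpha.
Proof.
move=> a0 cY cov; apply: fourier_dim_le => // s [/andP[s0 s1] [mu muY mus]].
have clY := compact_closed (@Rhausdorff K) cY.
have mu0 : mu setT != 0%E by have [/eqP] := muY.
have muY0 := supported_null clY muY.
apply: (@fourier_decay_cover _ mu) => //; first by rewrite !ltW.
move=> k; have [c [ck Yc]] := cov k; exists c; split => //.
apply/eqP; rewrite eq_le measure_ge0 andbT -muY0.
apply: le_measure; rewrite ?inE.
- apply: measurableC; apply: bigcup_measurable => j _; exact: measurable_itv.
- by apply: measurableC; exact: closed_measurable.
- exact: subsetC.
Qed.

End FourierDim.

Lemma cantor_set_cover (K : realType) (alpha : K) e : 0 <= alpha <= 1 ->
  forall k, exists c : seq nat, (size c)%:R <= (2 : K) `^ (alpha * k%:R) /\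
     cantor_set alpha e `<=` \bigcup_(j in [set` c]) dyadic_cell k j.
Proof.
move=> alpha01 k.
exists [seq tree_pos alpha e k i | i <- iota 0 (tree_size alpha k)]; split.
  by rewrite size_map size_iota; have /andP[] := tree_size_bound k alpha01.
move=> y /(_ k I)[i /= ik yi]; exists (tree_pos alpha e k i) => //=.
by apply: map_f; rewrite mem_iota.
Qed.

Lemma cantor_measure (K : realType) (alpha : K) e : 0 <= alpha <= 1 ->
  exists nu : finite_borel_measure K,
  [/\ nu (~` cantor_set alpha e) = 0%E, nu setT != 0%E &
      forall x r : K, 0 < r ->
        (nu (`[(x - r)%R, (x + r)%R]%classic : set K) <= (32 * r `^ alpha)%:E)%E].
Proof.
move=> alpha01.
have [nu [nuE _]] := mixture_exists (mu := @unit_lebesgue K) measurableT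
  (finite_measure_lty _ measurableT) (measurable_cantor_map alpha e).
have cY := @cantor_set_compact K alpha e.
exists nu; split.
- rewrite nuE; last first.
    apply: measurableC; apply: closed_measurable.
    exact: compact_closed (@Rhausdorff K) cY.
  rewrite setIT [LHS]unit_lebesgueE (_ : _ `&` _ = set0) ?measure0//.
  apply/seteqP; split => // t [/= nt]; rewrite in_itv/= => t01.
  by apply: nt; exact: cantor_map_in.
- by rewrite nuE// setIT preimage_setT [X in X != _]unit_lebesgue_setT.
- move=> x r r0; rewrite nuE ?setIT; last exact: measurable_itv.
  exact: cantor_frostman.
Qed.

Lemma hausdorff_minkowski_dim (K : realType) (alpha : K) (Y : set K)
    (nu : finite_borel_measure K) (C : K) : 0 <= alpha -> compact Y ->
  (forall k, exists c : seq nat, (size c)%:R <= (2 : K) `^ (alpha * k%:R) /\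
     Y `<=` \bigcup_(j in [set` c]) dyadic_cell k j) ->
  0 < C -> nu (~` Y) = 0%E -> nu setT != 0%E ->
  (forall x r : K, 0 < r ->
     (nu (`[(x - r)%R, (x + r)%R]%classic : set K) <= (C * r `^ alpha)%:E)%E) ->
  hausdorff_dim Y = alpha%:E /\ upper_minkowski_dim Y = alpha%:E.
Proof.
move=> a0 cY cov C0 nuY nu0 frost.
have mY : measurable (Y : set K).
  by apply: closed_measurable; exact: compact_closed (@Rhausdorff K) cY.
split; apply/eqP; rewrite eq_le; apply/andP; split.
- exact: hausdorff_dim_le.
- exact: (hausdorff_dim_ge C0 frost).
- exact: upper_minkowski_dim_le.
- exact: (upper_minkowski_dim_ge cov C0 frost).
Qed.

(** * Choice of the family and conclusion *)

Lemma mulset1l (K : realType) (A : set K) : mulset [set 1] A = A.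
Proof.
apply/seteqP; split => [_ [_ -> [y Ay <-]]|y Ay]; first by rewrite mul1r.
by exists 1 => //; exists y => //; rewrite mul1r.
Qed.

Lemma mulset1r (K : realType) (A : set K) : mulset A [set 1] = A.
Proof.
apply/seteqP; split => [_ [y Ay [_ -> <-]]|y Ay]; first by rewrite mulr1.
by exists y => //; exists 1 => //; rewrite mulr1.
Qed.

Lemma compact_pos_bounds (K : realType) (R : set K) : R !=set0 -> compact R ->
  R `<=` `]0, +oo[ -> exists a b : K, 0 < a /\ R `<=` `[a, b].
Proof.
move=> R0 cR Rpos.
have ci : {within R, continuous (id : K -> K)}.
  by apply: continuous_subspaceT => x; exact: cvg_id.
have [a /set_mem Ra ha] := compact_EVT_min R0 cR ci.
have [b /set_mem Rb hb] := compact_EVT_max R0 cR ci.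
exists a, b; split; first by have := Rpos a Ra; rewrite /= in_itv/= andbT.
by move=> x Rx; rewrite /= in_itv/=; apply/andP; split; [exact/ha/mem_set|exact/hb/mem_set].
Qed.

(** For d <= eps a Dirac mass with exponent 0 serves, as there may be no exponent at all. Otherwise
    an exponent above d - eps is lowered to d - eps, which keeps it at most d. The tuple lets a
    single [choice] produce the three sequences. *)
Lemma decay_witness (K : realType) (S : set K) (d eps : K) : S !=set0 ->
  compact S -> 0 <= d <= fourier_dim S -> 0 < eps ->
  exists p : finite_borel_measure K * (K * K), let: (mu, (s, A)) := p in
    [/\ mu (~` S) = 0%E, mu setT != 0%E, 0 <= s <= d, d - eps <= s &
        0 <= A /\ forall theta x, 2^-1 <= x ->
          `|\int[mu]_r cos (x * r + theta)| <= A * x `^ (- (s / 2))].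
Proof.
move=> [r0 Sr0] cS /andP[d0 dS] eps0.
have clS := compact_closed (@Rhausdorff K) cS.
have [h|h] := ltP 0 (d - eps); last first.
  pose dirac0 : {finite_measure set (measurableTypeR K) -> \bar K} :=
    @dirac _ (measurableTypeR K) r0 K.
  exists (dirac0, (0, 1)); split => //.
  - by rewrite /= /dirac indicE memNset// => /(_ Sr0).
  - by rewrite /= /dirac indicE mem_set// eqe oner_eq0.
  - by rewrite lexx.
  - split => // theta x _; rewrite mul0r oppr0 powRr0 mulr1.
    apply: (le_trans (normr_Rintegral_le (M := 1) _ _ _ _)) => //.
    + exact: finite_measure_lty.
    + exact: measurable_cos_affine.
    + by move=> ? _; exact: cos_max.
    + by rewrite mul1r /= /dirac indicE mem_set.
have [s [/andP[s0 s1] [mu muS mus]] ds] : exists2 s, decay_exponents S s & d - eps < s.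
  by apply: lt_fourier_dim; [exact: ltW|lra].
have [A A0 hA] := fourier_decay_trig (ltac:(by rewrite !ltW) : 0 <= s <= 1) mus.
exists (mu, (d - eps, 2 * A)); split.
- exact: supported_null.
- by have [/eqP] := muS.
- by apply/andP; split; lra.
- by [].
- split => [|theta x x2]; first by rewrite mulr_ge0.
  (* Lowering the exponent on [[1/2, 1]] costs at most 2^u <= 2, hence the constant 2A. *)
  apply: (le_trans (hA theta x x2)); rewrite (mulrC 2) -mulrA ler_wpM2l//.
  have x0 : 0 < x by lra.
  pose u := (s - (d - eps)) / 2.
  have u0 : 0 <= u by rewrite /u; lra.
  have -> : x `^ (- (s / 2)) = x `^ (- u) * x `^ (- ((d - eps) / 2)).
    by rewrite -powRD ?(gt_eqF x0) ?implybT//; congr powR; rewrite /u; field.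
  rewrite ler_wpM2r ?powR_ge0//.
  rewrite powRN -[leRHS]invrK lef_pV2 ?posrE ?invr_gt0 ?powR_gt0//.
  apply: (@le_trans _ _ ((2^-1) `^ u)); last by apply: ge0_ler_powR; rewrite ?nnegrE ?invr_ge0// ltW.
  by apply: ger1_powR; [lra|rewrite /u; lra].
Qed.

Lemma cosI_total (K : realType) (mu : finite_borel_measure K) (a b theta x : K) :
  mu (~` `[a, b]) = 0%E ->
  cosI mu a b theta (fun=> 1) x = \int[mu]_r cos (x * r + theta).
Proof.
move=> muab; rewrite /cosI /Rintegral; congr fine.
under eq_integral do rewrite mulr1.
pose N : set (measurableTypeR K) := ~` `[a, b]%classic.
have mN : measurable N by apply: measurableC; exact: measurable_itv.
rewrite [RHS](@negligible_integral _ _ _ mu setT N _ mN measurableT)//.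
- by rewrite setTD setCK.
- apply: (integrable_bounded (M := 1)) => //; first exact: finite_measure_lty.
    exact: measurable_cos_affine.
  by move=> ? _; exact: cos_max.
Qed.

Lemma cantor_set_product_dim (K : realType) (alpha : K) (R : set K) :
  0 < alpha <= 1 -> R !=set0 -> compact R -> R `<=` `]0, +oo[ ->
  exists e, alpha <= fourier_dim (cantor_set alpha e) /\
    Num.min 1 (fourier_dim R + alpha) <=
      fourier_dim (mulset R (cantor_set alpha e)).
Proof.
move=> /andP[al0 al1] R0 cR Rpos.
have alpha01 : 0 <= alpha <= 1 by rewrite ltW.
pose d' := Num.min (fourier_dim R) (1 - alpha).
have d'0 : 0 <= d' by rewrite le_min fourier_dim_ge0 subr_ge0.
(* Index 0 is reserved for [Y] itself, written as [{1} Y]. *)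
pose S n : set K := if n is _.+1 then R else [set 1].
pose d n : K := if n is _.+1 then d' else 0.
have S0 n : S n !=set0 by case: n => //; exists 1.
have cS n : compact (S n) by case: n => // ; exact: compact_set1.
have dS n : 0 <= d n <= fourier_dim (S n).
  by case: n => [|n] /=; rewrite ?lexx ?fourier_dim_ge0// d'0 ge_min lexx.
have eps0 n : 0 < (n.+1%:R : K)^-1 by rewrite invr_gt0.
have [p hp] := choice (fun n => decay_witness (S0 n) (cS n) (dS n) (eps0 n)).
pose mu n := (p n).1; pose s n := (p n).2.1; pose A n := (p n).2.2.
have {}hp n : [/\ mu n (~` S n) = 0%E, mu n setT != 0%E, 0 <= s n <= d n,
    d n - n.+1%:R^-1 <= s n & 0 <= A n /\ forall theta x, 2^-1 <= x ->
      `|\int[mu n]_r cos (x * r + theta)| <= A n * x `^ (- (s n / 2))].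
  by move: (hp n); rewrite /mu /s /A; case: (p n) => m [t B].
have [a [b [a0 Rab]]] := compact_pos_bounds R0 cR Rpos.
(* One interval for all members must contain both R and the point 1. *)
pose a' := Num.min a 1; pose b' := Num.max b 1.
have a'0 : 0 < a' by rewrite lt_min a0 ltr01.
have a'1 : a' <= 1 by rewrite ge_min lexx orbT.
have b'1 : 1 <= b' by rewrite le_max lexx orbT.
have a'b' : a' <= b' by exact: le_trans b'1.
have S_itv n : S n `<=` `[a', b'].
  case: n => [|n] x /=; rewrite in_itv/=.
    by move=> ->; rewrite a'1.
  by move=> /Rab; rewrite /= in_itv/= ge_min le_max => /andP[-> ->].
have mS n : measurable (S n : set K).
  by apply: closed_measurable; exact: compact_closed (@Rhausdorff K) (cS n).
have mu_itv n : mu n (~` `[a', b']) = 0%E.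
  have [muS _ _ _ _] := hp n.
  apply/eqP; rewrite eq_le measure_ge0 andbT -muS.
  apply: le_measure; rewrite ?inE.
  - by apply: measurableC; exact: measurable_itv.
  - by apply: measurableC; exact: mS.
  - exact/subsetC/S_itv.
have [e he] : exists e, forall n,
    exists nu : {finite_measure set (measurableTypeR K) -> \bar K},
    [/\ (forall T : set K, compact T -> mu n (~` T) = 0%E ->
           nu (~` mulset T (cantor_set alpha e)) = 0%E),
        nu setT != 0%E &
        forall d, 0 < d -> d <= alpha / 2 -> exists D : K, forall x, 1 <= x ->
          `|\int[nu]_r cos (x * r)| <= D * x `^ (- ((s n + alpha) / 2) + d) /\
          `|\int[nu]_r sin (x * r)| <= D * x `^ (- ((s n + alpha) / 2) + d)].
  apply: (@cantor_family_decay _ alpha mu (fun=> a') (fun=> b') A s) => //.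
  - by move=> n; have [_ _ _ _ []] := hp n.
  - by move=> n; have [_ _ /andP[]] := hp n.
  - move=> n; have [_ _ /andP[_ sd] _ _] := hp n.
    have : d n <= 1 - alpha.
      by case: n {sd} => [|n]; rewrite /d ?subr_ge0// /d' ge_min lexx orbT.
    lra.
  - move=> n theta x x2; have [_ _ _ _ [_ hA]] := hp n.
    apply: le_trans (hA theta x x2).
    rewrite le_eqVlt; apply/orP; left; apply/eqP; congr `|_|.
    exact: cosI_total.
  - by move=> n; have [] := hp n.
exists e; set Y := cantor_set alpha e.
have cY : compact Y by exact: cantor_set_compact.
have exponent n u : 0 < u < 1 -> u < s n + alpha ->
    decay_exponents (mulset (S n) Y) u.
  move=> /andP[u0 u1] us; split; first by rewrite u0.
  have [nu [nuS nu0 nuD]] := he n; have [muS _ _ _ _] := hp n.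
  exists nu; first by apply: null_supported (nuS _ _ muS) nu0 => //; exact: compact_mulset.
  (* The second bound on the loss makes -(s + alpha)/2 + del at most -u/2. *)
  pose del := Num.min (alpha / 2) ((s n + alpha - u) / 2).
  have del0 : 0 < del by rewrite lt_min; apply/andP; split; lra.
  have [D hD] := nuD del del0 (ltac:(by rewrite ge_min lexx) : del <= alpha / 2).
  have delu : del <= (s n + alpha - u) / 2 by rewrite ge_min lexx orbT.
  apply: (@trig_fourier_decay _ _ u (Num.max D 0)); rewrite ?le_max ?lexx ?orbT//.
  move=> x x1; have [h1 h2] := hD x x1.
  have h : D * x `^ (- ((s n + alpha) / 2) + del) <= Num.max D 0 * x `^ (- (u / 2)).
    apply: (@le_trans _ _ (Num.max D 0 * x `^ (- ((s n + alpha) / 2) + del))).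
      by rewrite ler_wpM2r ?powR_ge0// le_max lexx.
    rewrite ler_wpM2l ?le_max ?lexx ?orbT//; apply: ler_powR => //; lra.
  by split; [exact: le_trans h1 h|exact: le_trans h2 h].
split.
  apply: fourier_dim_ge => // u u0 ua; rewrite -(mulset1l Y).
  apply: (exponent 0%N); first by rewrite u0 (lt_le_trans ua).
  by have [_ _ /andP[h _] _ _] := hp 0%N; lra.
apply: fourier_dim_ge; first by rewrite ge_min lexx.
move=> u u0; rewrite lt_min => /andP[u1 ud].
have ud' : u < d' + alpha.
  rewrite -ltrBlDr lt_min ltrBlDr ud /=; lra.
pose n := Num.truncn (d' + alpha - u)^-1.
(* Index 0 being taken, member [n.+1] has exponent at least d' - 1/(n + 2), and n is chosen so that
   this plus alpha exceeds u. *)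
apply: (exponent n.+1); first by rewrite u0.
have [_ _ _ ds _] := hp n.+1.
have {}ds : d' - (n.+2%:R)^-1 <= s n.+1 := ds.
have : (n.+2%:R : K)^-1 < d' + alpha - u.
  rewrite invf_plt ?posrE ?subr_gt0//.
  by rewrite (lt_trans (truncnS_gt _))// ltr_nat.
move: ds; set w := (n.+2%:R : K)^-1; lra.
Qed.

Theorem theorem1p6 (K : realType) (alpha : K) (R : set K)
    (alpha01 : 0 <= alpha <= 1)
    (R0 : R !=set0) (Rcompact : compact R) (Rpos : R `<=` `]0, +oo[) :
  exists Y : set K,
    [/\ Y !=set0, compact Y & Y `<=` `[1, 2]] /\
    [/\ fourier_dim Y = alpha,
        hausdorff_dim Y = alpha%:E &
        upper_minkowski_dim Y = alpha%:E] /\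
    fourier_dim (mulset R Y) >= Num.min 1 (fourier_dim R + fourier_dim Y).
Proof.
have /andP[] := alpha01; rewrite le_eqVlt => /predU1P[al0|al0] al1; last first.
  have [||||e [eY eRY]] := @cantor_set_product_dim K alpha R => //; first by rewrite al0.
  set Y := cantor_set alpha e in eY eRY.
  have cY : compact Y by exact: cantor_set_compact.
  have cov := cantor_set_cover e alpha01.
  have [nu [nuY nu0 frost]] := cantor_measure e alpha01.
  have [hY mY] := hausdorff_minkowski_dim (ltW al0) cY cov
    (ltr0n K 32 : 0 < 32%:R) nuY nu0 frost.
  have fY : fourier_dim Y = alpha.
    apply/eqP; rewrite eq_le eY andbT.
    by apply: fourier_dim_le_cover => //; exact: ltW.
  exists Y; split; first by split=> //; [exact: cantor_set_nonempty|exact: cantor_set_sub].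
  by rewrite fY.
(* For alpha = 0 the set {1} works: one cell covers it at every level, its Dirac mass is a Frostman
   measure of exponent 0, and R{1} = R. *)
rewrite -al0.
have cY : compact [set (1 : K)] by exact: compact_set1.
have cov k : exists c : seq nat, (size c)%:R <= (2 : K) `^ (0 * k%:R) /\
     [set 1] `<=` \bigcup_(j in [set` c]) @dyadic_cell K k j.
  exists [:: 0%N]; rewrite mul0r powRr0; split => // _ ->.
  exists 0%N; first by rewrite /= inE.
  rewrite /dyadic_cell /= in_itv/= gridpt_succ /gridpt mul0r addr0 lexx /=.
  by rewrite lerDl invr_ge0 exprn_ge0.
pose nu : {finite_measure set (measurableTypeR K) -> \bar K} :=
  @dirac _ (measurableTypeR K) 1 K.
have [hY mY] : hausdorff_dim [set (1 : K)] = 0%:E /\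
    upper_minkowski_dim [set (1 : K)] = 0%:E.
  apply: (@hausdorff_minkowski_dim _ _ _ nu 1) => //.
  - by rewrite /= /dirac indicE memNset//=; apply.
  - by rewrite /= /dirac indicE mem_set// eqe oner_eq0.
  - move=> x r r0; rewrite powRr0 mulr1 /= /dirac indicE lee_fin.
    by case: (_ \in _).
have fY : fourier_dim [set (1 : K)] = 0.
  apply/eqP; rewrite eq_le fourier_dim_ge0 andbT.
  exact: fourier_dim_le_cover.
exists [set 1]; split; first split => //.
- by exists 1.
- by move=> _ ->; rewrite /= in_itv/= lexx ler1n.
- by rewrite fY mulset1r addr0 ge_min lexx orbT.
Qed.
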